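(* Let $p\ge 3$ be a prime. Let $\mathfrak{S}$ be a ring with an element $E\in\mathfrak{S}$ such that $(p,E)$ is a regular sequence in $\mathfrak{S}$ and $\mathfrak{S}$ is complete for the $(p,E)$-adic topology, and let $\varphi:\mathfrak{S}\to\mathfrak{S}$ be a lift of Frobenius (a ring endomorphism inducing the $p$-power map on $\mathfrak{S}/p\mathfrak{S}$). Let $R=\mathfrak{S}/E\mathfrak{S}$, let $S$ be the $p$-adic completion of the divided power envelope of the ideal $E\mathfrak{S}\subseteq\mathfrak{S}$, and let $\underline{\mathfrak{S}}$ and $\underline{S}$ be the associated frames (see context). Assume that $c:=\varphi_1(E)=p^{-1}\varphi(E)$ is a unit of $S$, so that the natural map $\mathfrak{S}\to S$ is a $c$-homomorphism of frames $\lambda:\underline{\mathfrak{S}}\to\underline{S}$. For $n\geq 1$ let $\lambda_n:\underline{\mathfrak{S}}{}_n\to\underline{S}{}_n$ be the reduction of $\lambda$ modulo $p^n$. Then the frame homomorphisms $\lambda$ and $\lambda_n$ for all $n\ge 1$ are crystalline, i.e. the base change functors $\lambda^*:\mathrm{Win}(\underline{\mathfrak{S}})\to\mathrm{Win}(\underline{S})$ and $\lambda_n^*:\mathrm{Win}(\underline{\mathfrak{S}}{}_n)\to\mathrm{Win}(\underline{S}{}_n)$ are equivalences of categories.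
   Context: Frames. A frame $(S,\mathrm{Fil}\,S,R,\varphi,\varphi_1,\varpi)$ consists of a ring $S$, an ideal $\mathrm{Fil}\,S$, the quotient $R=S/\mathrm{Fil}\,S$, a ring endomorphism $\varphi$ of $S$ reducing to the $p$-power map modulo $pS$, a $\varphi$-linear map $\varphi_1:\mathrm{Fil}\,S\to S$, and $\varpi\in S$ with $\varphi=\varpi\varphi_1$ on $\mathrm{Fil}\,S$, such that $\mathrm{Fil}\,S+pS\subseteq\mathrm{Rad}(S)$ (Jacobson radical). Windows. A window over such a frame is $(M,\mathrm{Fil}\,M,\Phi,\Phi_1)$ with $M$ a finitely generated projective $S$-module, $\mathrm{Fil}\,M\subseteq M$ a submodule, and $\varphi$-linear maps $\Phi:M\to M$, $\Phi_1:\mathrm{Fil}\,M\to M$ such that: (1) there is a decomposition $M=L\oplus N$ with $\mathrm{Fil}\,M=L\oplus(\mathrm{Fil}\,S)N$; (2) $\Phi_1(sm)=\varphi_1(s)\Phi(m)$ for $s\in\mathrm{Fil}\,S$, $m\in M$; (3) $\Phi(m)=\varpi\Phi_1(m)$ for $m\in\mathrm{Fil}\,M$; (4) $\Phi_1(\mathrm{Fil}\,M)+\Phi(M)$ generates $M$. Morphisms are $S$-linear maps preserving $\mathrm{Fil}$ and commuting with $\Phi$ and $\Phi_1$; $\mathrm{Win}(\underline{S})$ is the resulting category. A $c$-homomorphism of frames $\alpha:\underline{S}\to\underline{S}'$ (with $c\in S'$ a unit) is a ring homomorphism $\alpha:S\to S'$ with $\varphi'\alpha=\alpha\varphi$, $\alpha(\mathrm{Fil}\,S)\subseteq\mathrm{Fil}\,S'$,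 $\varphi_1'\alpha=c\cdot\alpha\varphi_1$, $\alpha(\varpi)=c\varpi'$. The base change $\alpha^*(M,\mathrm{Fil}\,M,\Phi,\Phi_1)$ has underlying module $M'=S'\otimes_SM$, with $\mathrm{Fil}\,M'$ generated by $(\mathrm{Fil}\,S')M'$ and the image of $\mathrm{Fil}\,M$, and $\Phi',\Phi_1'$ the unique maps making it a window such that $f:M\to M'$, $m\mapsto 1\otimes m$, satisfies $\Phi'f=f\Phi$ and $\Phi_1'f=c\cdot f\Phi_1$ on $\mathrm{Fil}\,M$. The homomorphism $\alpha$ is called crystalline if $\alpha^*:\mathrm{Win}(\underline{S})\to\mathrm{Win}(\underline{S}')$ is an equivalence. The frames here. $\underline{\mathfrak{S}}=(\mathfrak{S},E\mathfrak{S},R,\varphi,\varphi_1',\varphi(E))$ with $\varphi_1'(Ex)=\varphi(x)$. The ring $S$ is $\mathbf{Z}_p$-flat; $\underline{S}=(S,\mathrm{Fil}\,S,R,\varphi,\varphi_1,p)$ where $\mathrm{Fil}\,S=\ker(S\to R)$, $\varphi$ is the natural extension of $\varphi$ to $S$, and $\varphi_1=p^{-1}\varphi$ on $\mathrm{Fil}\,S$. The frames $\underline{\mathfrak{S}}{}_n$ and $\underline{S}{}_n$ are obtained by applying $\otimes\,\mathbf{Z}/p^n\mathbf{Z}$ componentwise. *)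

(* Defs.v *)
From HB Require Import structures.
From mathcomp Require Import all_boot all_algebra.
From mathcomp Require Import boolp classical_sets.

Set Implicit Arguments.
Unset Strict Implicit.
Unset Printing Implicit Defensive.

Import GRing.Theory.

Local Open Scope classical_set_scope.
Local Open Scope ring_scope.

(* All rings are commutative with 1; the zero ring is allowed, so they are    *)
(* [comPzRingType]s. Ideals and submodules are Prop-valued sets; an ideal of  *)
(* [A] is a submodule of the regular module [A^o].                            *)

Definition is_unit (A : comPzRingType) (a : A) : Prop := exists b, a * b = 1.

Section Modules.
Variables (A : comPzRingType) (M : lmodType A).

Definition submodule (N : set M) : Prop :=
  [/\ N 0, forall x y, N x -> N y -> N (x + y) & forall a x, N x -> N (a *: x)].

Definition span (X : set M) : set M :=
  [set m | exists (n : nat) (a : 'I_n -> A) (x : 'I_n -> M),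
     (forall i, X (x i)) /\ m = \sum_i a i *: x i].

Definition smul_sub (I : set A) (N : set M) : set M :=
  span [set m | exists a x, [/\ I a, N x & m = a *: x]].

Definition direct_sum (L N : set M) : Prop :=
  (forall m, exists l n, [/\ L l, N n & m = l + n]) /\ L `&` N = [set 0].

Definition finitely_generated : Prop :=
  exists (n : nat) (e : 'I_n -> M), span (range e) = setT.

Definition projective : Prop :=
  forall (P Q : lmodType A) (g : {linear P -> Q}) (f : {linear M -> Q}),
    (forall y, exists x, g x = y) ->
    exists h : {linear M -> P}, forall m, g (h m) = f m.

End Modules.

Section Ideals.
Variable A : comPzRingType.

Definition ideal (I : set A) : Prop := submodule (I : set A^o).

Definition ideal_gen (X : set A) : set A := span (X : set A^o).

Definition principal (a : A) : set A := range ( *%R a).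

Definition ideal_pow (I : set A) (n : nat) : set A :=
  ideal_gen [set z | exists x : 'I_n -> A, (forall i, I (x i)) /\ z = \prod_i x i].

Definition maximal_ideal (m : set A) : Prop :=
  [/\ ideal m, ~ m 1
    & forall J : set A, ideal J -> ~ J 1 -> m `<=` J -> J = m].

Definition jacobson_radical : set A :=
  [set x | forall m, maximal_ideal m -> m x].

Definition regular_pair (a b : A) : Prop :=
  [/\ forall x, a * x = 0 -> x = 0,
      forall x, principal a (b * x) -> principal a x
    & ~ ideal_gen [set a; b] 1].

(* Bijectivity of [A -> lim A/I^n]: a compatible family of residue classes is *)
(* represented by a sequence of lifts.                                        *)
Definition adic_complete (I : set A) : Prop :=
  forall x : nat -> A, (forall n, ideal_pow I n (x n.+1 - x n)) ->
    exists! a, forall n, ideal_pow I n (a - x n).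

End Ideals.

(* [q : A -> B] exhibits [B] as the quotient ring [A/I]. *)
Definition quotient_map (A B : comPzRingType) (I : set A)
    (q : {rmorphism A -> B}) : Prop :=
  (forall b, exists a, q a = b) /\ (forall a, q a = 0 <-> I a).

(* [i : A -> B] exhibits [B] as [lim A/I^n]: here [Q n] is [A/I^n] with       *)
(* quotient map [q n], the [pr n] are the projections of the limit, and a     *)
(* family [x] is compatible when [x n] is the image of [x n.+1] under the     *)
(* transition map [A/I^n.+1 -> A/I^n].                                        *)
Definition adic_completion (A B : comPzRingType) (I : set A)
    (i : {rmorphism A -> B}) : Prop :=
  exists (Q : nat -> comPzRingType)
         (q : forall n, {rmorphism A -> Q n})
         (pr : forall n, {rmorphism B -> Q n}),
    let compatible (x : forall n, Q n) :=
      forall n a, q n.+1 a = x n.+1 -> q n a = x n in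
    [/\ forall n, quotient_map (ideal_pow I n) (q n),
        forall n a, pr n (i a) = q n a,
        forall b, compatible (fun n => pr n b)
      & forall x, compatible x -> exists! b, forall n, pr n b = x n].

(* Divided powers [gam n x] are only meaningful for [x] in the ideal [I]. *)
Definition pd_structure (A : comPzRingType) (I : set A)
    (gam : nat -> A -> A) : Prop :=
  ideal I /\
  [/\ forall x, I x -> gam 0 x = 1 /\ gam 1 x = x,
      forall n x, I x -> (0 < n)%N -> I (gam n x),
      forall n x y, I x -> I y ->
        gam n (x + y) = \sum_(i < n.+1) gam i x * gam (n - i)%N y,
      forall n a x, I x -> gam n (a * x) = a ^+ n * gam n x
    & (forall m n x, I x ->
        gam m x * gam n x = 'C(m + n, m)%:R * gam (m + n)%N x) /\
      (forall m n x, I x -> (0 < n)%N ->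
        gam m (gam n x) = ((m * n)`! %/ (m`! * n`! ^ m))%:R * gam (m * n)%N x)].

(* [(D, J, gam)] with [eta : A -> D] is the divided power envelope of [I]. *)
Definition pd_envelope (A : comPzRingType) (I : set A)
    (D : comPzRingType) (J : set D) (gam : nat -> D -> D)
    (eta : {rmorphism A -> D}) : Prop :=
  [/\ pd_structure J gam,
      eta @` I `<=` J
    & forall (B : comPzRingType) (K : set B) (del : nat -> B -> B)
             (f : {rmorphism A -> B}),
        pd_structure K del -> f @` I `<=` K ->
        let extends_f (g : {rmorphism D -> B}) :=
          [/\ forall a, g (eta a) = f a,
              g @` J `<=` K
            & forall n x, J x -> g (gam n x) = del n (g x)] in
        exists g, extends_f g /\ (forall g', extends_f g' -> g' =1 g)].

Definition frobenius_lift (p : nat) (A : comPzRingType)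
    (phi : {rmorphism A -> A}) : Prop :=
  forall x, principal p%:R (phi x - x ^+ p).

(* A frame with underlying ring [S]; its quotient [R = S/Fil S] is determined *)
(* by [Fil S] and not recorded. [fr_phi1] is a map [Fil S -> S], totalized:   *)
(* its values outside [Fil S] are irrelevant.                                 *)
Record frame (p : nat) (S : comPzRingType) := Frame {
  fr_Fil : set S;
  fr_phi : {rmorphism S -> S};
  fr_phi1 : S -> S;
  fr_varpi : S;
  fr_Fil_ideal : ideal fr_Fil;
  fr_phi_frob : frobenius_lift p fr_phi;
  fr_phi1D : forall x y, fr_Fil x -> fr_Fil y ->
    fr_phi1 (x + y) = fr_phi1 x + fr_phi1 y;
  fr_phi1M : forall a x, fr_Fil x -> fr_phi1 (a * x) = fr_phi a * fr_phi1 x;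
  fr_phiE : forall x, fr_Fil x -> fr_phi x = fr_varpi * fr_phi1 x;
  fr_rad : forall x y, fr_Fil x -> jacobson_radical (x + p%:R * y)
}.

(* As for frames, [win_Phi1] is a map [Fil M -> M] with irrelevant values     *)
(* outside [Fil M].                                                           *)
Record window (p : nat) (S : comPzRingType) (F : frame p S) := Window {
  win_mod :> lmodType S;
  win_Fil : set win_mod;
  win_Phi : {linear win_mod -> win_mod | fr_phi F \; *:%R};
  win_Phi1 : win_mod -> win_mod;
  win_fg : finitely_generated win_mod;
  win_proj : projective win_mod;
  win_Fil_sub : submodule win_Fil;
  win_Phi1D : forall x y, win_Fil x -> win_Fil y ->
    win_Phi1 (x + y) = win_Phi1 x + win_Phi1 y;
  win_Phi1Z : forall a x, win_Fil x ->
    win_Phi1 (a *: x) = fr_phi F a *: win_Phi1 x;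
  win_decomp : exists L N : set win_mod,
    [/\ submodule L, submodule N, direct_sum L N
      & win_Fil = [set m | exists l n,
          [/\ L l, smul_sub (fr_Fil F) N n & m = l + n]]];
  win_Phi1_Phi : forall s m, fr_Fil F s ->
    win_Phi1 (s *: m) = fr_phi1 F s *: win_Phi m;
  win_Phi_Phi1 : forall m, win_Fil m -> win_Phi m = fr_varpi F *: win_Phi1 m;
  win_gen : span ((win_Phi1 @` win_Fil) `|` range win_Phi) = setT
}.

Record window_hom (p : nat) (S : comPzRingType) (F : frame p S)
    (M N : window F) := WindowHom {
  wh_fun :> {linear M -> N};
  wh_Fil : forall m, win_Fil m -> win_Fil (wh_fun m);
  wh_Phi : forall m, wh_fun (win_Phi M m) = win_Phi N (wh_fun m);
  wh_Phi1 : forall m, win_Fil m -> wh_fun (win_Phi1 m) = win_Phi1 (wh_fun m)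
}.

Record category := Category {
  obj :> Type;
  hom : obj -> obj -> Type;
  idm : forall X, hom X X;
  compm : forall X Y Z, hom Y Z -> hom X Y -> hom X Z;
  comp1m : forall X Y (f : hom X Y), compm (idm Y) f = f;
  compm1 : forall X Y (f : hom X Y), compm f (idm X) = f;
  compA : forall X Y Z W (h : hom Z W) (g : hom Y Z) (f : hom X Y),
    compm h (compm g f) = compm (compm h g) f
}.
Arguments idm {c} X.

Record functor (C D : category) := Functor {
  fobj :> C -> D;
  fmap : forall X Y : C, hom X Y -> hom (fobj X) (fobj Y);
  fmap1 : forall X : C, fmap (idm X) = idm (fobj X);
  fmapM : forall (X Y Z : C) (g : hom Y Z) (f : hom X Y),
    fmap (compm g f) = compm (fmap g) (fmap f)
}.
Arguments fmap {C D} _ {X Y} _ : rename.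

Definition functor_id (C : category) : functor C C :=
  @Functor C C id (fun _ _ => id) (fun _ => erefl) (fun _ _ _ _ _ => erefl).

Lemma functor_comp1 (C D E : category) (G : functor D E) (F : functor C D)
  (X : C) : fmap G (fmap F (idm X)) = idm (G (F X)).
Proof. by rewrite !fmap1. Qed.

Lemma functor_compM (C D E : category) (G : functor D E) (F : functor C D)
    (X Y Z : C) (g : hom Y Z) (f : hom X Y) :
  fmap G (fmap F (compm g f)) = compm (fmap G (fmap F g)) (fmap G (fmap F f)).
Proof. by rewrite !fmapM. Qed.

Definition functor_comp (C D E : category) (G : functor D E) (F : functor C D) :
    functor C E :=
  @Functor C E (fun X => G (F X)) (fun X Y f => fmap G (fmap F f))
    (functor_comp1 G F) (functor_compM G F).

Definition is_iso (C : category) (X Y : C) (f : hom X Y) : Prop :=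
  exists g : hom Y X, compm g f = idm X /\ compm f g = idm Y.

Definition nat_iso (C D : category) (F G : functor C D) : Prop :=
  exists t : forall X : C, hom (F X) (G X),
    (forall X, is_iso (t X)) /\
    (forall (X Y : C) (f : hom X Y),
       compm (t Y) (fmap F f) = compm (fmap G f) (t X)).

Definition is_equivalence (C D : category) (F : functor C D) : Prop :=
  exists G : functor D C,
    nat_iso (functor_comp G F) (functor_id C) /\
    nat_iso (functor_comp F G) (functor_id D).

Section WindowCategory.
Variables (p : nat) (S : comPzRingType) (F : frame p S).

Lemma window_hom_eq (M N : window F) (f g : window_hom M N) : f =1 g -> f = g.
Proof.
case: f g => [[f [[Df] [Zf]]] Ff Pf Qf] [[g [[Dg] [Zg]]] Fg Pg Qg] /= /funext efg.
subst g.
rewrite (Prop_irrelevance Dg Df) (Prop_irrelevance Zg Zf) in Fg Pg Qg *.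
by congr WindowHom; apply: Prop_irrelevance.
Qed.

Definition window_id (M : window F) : window_hom M M :=
  @WindowHom _ _ _ M M idfun (fun _ h => h) (fun _ => erefl) (fun _ _ => erefl).

Lemma window_comp_Fil (M N K : window F) (g : window_hom N K)
  (f : window_hom M N) m : win_Fil m -> win_Fil ((g \o f) m).
Proof. by move=> /(wh_Fil f)/(wh_Fil g). Qed.

Lemma window_comp_Phi (M N K : window F) (g : window_hom N K)
  (f : window_hom M N) m : (g \o f) (win_Phi M m) = win_Phi K ((g \o f) m).
Proof. by rewrite /= !wh_Phi. Qed.

Lemma window_comp_Phi1 (M N K : window F) (g : window_hom N K)
  (f : window_hom M N) m :
  win_Fil m -> (g \o f) (win_Phi1 m) = win_Phi1 ((g \o f) m).
Proof. by move=> Fm; rewrite /= (wh_Phi1 f)// (wh_Phi1 g)//; apply: wh_Fil. Qed.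

Definition window_comp (M N K : window F) (g : window_hom N K)
    (f : window_hom M N) : window_hom M K :=
  @WindowHom _ _ _ M K (g \o f)
    (window_comp_Fil g f) (window_comp_Phi g f) (window_comp_Phi1 g f).

Lemma window_comp1m (M N : window F) (f : window_hom M N) :
  window_comp (window_id N) f = f.
Proof. exact: window_hom_eq. Qed.

Lemma window_compm1 (M N : window F) (f : window_hom M N) :
  window_comp f (window_id M) = f.
Proof. exact: window_hom_eq. Qed.

Lemma window_compA (M N K L : window F) (h : window_hom K L)
    (g : window_hom N K) (f : window_hom M N) :
  window_comp h (window_comp g f) = window_comp (window_comp h g) f.
Proof. exact: window_hom_eq. Qed.

Definition Win : category :=
  @Category (window F) (@window_hom p S F) window_id window_comp
    window_comp1m window_compm1 window_compA.

End WindowCategory.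

Section BaseChange.
Variables (p : nat) (S S' : comPzRingType) (F : frame p S) (F' : frame p S').
Variables (c : S') (alpha : {rmorphism S -> S'}).

(* [alpha] is a [c]-homomorphism of frames. *)
Definition frame_hom : Prop :=
  is_unit c /\
  [/\ forall x, fr_phi F' (alpha x) = alpha (fr_phi F x),
      alpha @` fr_Fil F `<=` fr_Fil F',
      forall x, fr_Fil F x -> fr_phi1 F' (alpha x) = c * alpha (fr_phi1 F x)
    & alpha (fr_varpi F) = c * fr_varpi F'].

(* [f] is the map [m |-> 1 (x) m] to [M' = S' (x)_S M], expressed by the      *)
(* universal property of the extension of scalars.                            *)
Definition extension_of_scalars (M : lmodType S) (M' : lmodType S')
    (f : {linear M -> M' | alpha \; *:%R}) : Prop :=
  forall (P : lmodType S') (g : {linear M -> P | alpha \; *:%R}),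
    exists h : {linear M' -> P}, (forall m, h (f m) = g m) /\
      (forall h' : {linear M' -> P}, (forall m, h' (f m) = g m) -> h' =1 h).

Definition is_base_change (M : window F) (M' : window F')
    (f : {linear M -> M' | alpha \; *:%R}) : Prop :=
  [/\ extension_of_scalars f,
      @win_Fil _ _ _ M' =
        span ([set m | exists s x, fr_Fil F' s /\ m = s *: x]
              `|` f @` @win_Fil _ _ _ M),
      forall m, win_Phi M' (f m) = f (win_Phi M m)
    & forall m, win_Fil m -> win_Phi1 (f m) = c *: f (win_Phi1 m)].

(* [T] is a choice of the functor [alpha^*], which is determined up to unique *)
(* natural isomorphism.                                                       *)
Definition is_base_change_functor (T : functor (Win F) (Win F')) : Prop :=
  exists f : forall M : window F, {linear M -> (T M : window F') | alpha \; *:%R},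
    (forall M, is_base_change (f M)) /\
    (forall (M N : window F) (g : window_hom M N) (m : M),
       (fmap T (g : hom (M : Win F) N) : window_hom _ _) (f M m) = f N (g m)).

Definition crystalline : Prop :=
  frame_hom /\
  exists T : functor (Win F) (Win F'),
    is_base_change_functor T /\ is_equivalence T.

End BaseChange.

(* [F'] is [F (x) Z/p^n], where [q : S -> S'] is the quotient map to          *)
(* [S' = S/p^n S]. When [R = S/Fil S] is [p]-torsion free, [Fil S (x) Z/p^n]  *)
(* maps isomorphically onto the ideal [q @` Fil S].                           *)
Definition frame_reduction (p n : nat) (S S' : comPzRingType)
    (F : frame p S) (F' : frame p S') (q : {rmorphism S -> S'}) : Prop :=
  [/\ quotient_map (principal (p%:R ^+ n)) q,
      fr_Fil F' = q @` fr_Fil F,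
      forall x, fr_phi F' (q x) = q (fr_phi F x),
      forall x, fr_Fil F x -> fr_phi1 F' (q x) = q (fr_phi1 F x)
    & fr_varpi F' = q (fr_varpi F)].

(* Main.v *)
Require Import Defs.
From HB Require Import structures.
From mathcomp Require Import all_boot all_algebra ring zify.
From mathcomp Require Import boolp classical_sets.

Set Implicit Arguments.
Unset Strict Implicit.
Unset Printing Implicit Defensive.

Import GRing.Theory.
Import Defs.

Local Open Scope classical_set_scope.
Local Open Scope ring_scope.

(** Why [lambda] is crystalline. Modulo [p] both frames have the same quotient. In
    [A/p] the ideal [(E^2)] is stable under [phi1 (E x) = phi x], which sends [E^k] to
    [E^(p (k - 1))] and so is topologically nilpotent on it because [p >= 3]. In [S/p]
    the ideal of the divided powers [E^i / i!] with [i >= 2] is killed by [phi1],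
    because [p^(i - 1) / i!] is divisible by [p]. The quotients by these ideals are
    both [A/(p, E^2)], and their [phi1] differ by the unit [c]. Windows deform
    uniquely along an ideal on which [phi1] is topologically nilpotent; a devissage
    along the powers of [p] then passes from characteristic [p] to [p^n] and to the
    limit.

    The argument is carried out with matrices. A window is given by an idempotent
    matrix, the projection onto [L + N] from a graded free module, and by the matrix
    of the linear isomorphism [phi^* M -> M] that is [Phi1] on [L] and [Phi] on [N]
    ([window_presentation], [datum_realized]). That this map is an isomorphism and
    not merely surjective rests on [frobenius_idempotent_rank]. Base change acts on
    these data entrywise, and [crystalline_criterion] reduces the theorem to
    statements about matrices.

    Homomorphisms are the fixed points of a semilinear operator [UA] on filtered
    matrices, and the two-term complex [1 - UA] over [A] is compared with its analogue
    over [S]. The comparison is a quasi-isomorphism ([fixed_lam_inj], [lift_fixed],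
    [coker_lam]): modulo [p] this is the contraction described above, and successive
    approximation gives the rest. Since nothing is assumed about the matrices that
    enter [UA], full faithfulness modulo [p^n] follows by lifting them to [A] and [S]
    ([full_red], [faithful_red]).

    For essential surjectivity, the idempotent of a window over [S] modulo [p^n] is
    conjugate to one coming from [A], because [A/(p, E)] is the quotient of [S] by
    [Fil S + p S] ([idempotent_descent]). Its structure matrix is then moved into the
    image of [A] by an isomorphism found by successive approximation
    ([window_descent]).

    The required facts on [S] are collected in [breuil_comparison]. They rest on two
    consequences of the universal property of the divided power envelope [D]: it is
    the sum of the image of [A] and of the divided powers of order at least two
    ([pd_envelope_decomp]), and the latter vanish under a homomorphism from
    [D] to any given [A]-algebra in which [E^2 = 0] ([pd_envelope_sq0]). *)

(** * Ideals, radicals and quotient rings *)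

Section Submodules.
Variables (A : comPzRingType) (M : lmodType A).
Implicit Types (N X : set M).

Lemma submodule0 N : submodule N -> N 0.
Proof. by case. Qed.

Lemma submoduleD N x y : submodule N -> N x -> N y -> N (x + y).
Proof. by case=> _ h _; apply: h. Qed.

Lemma submoduleZ N a x : submodule N -> N x -> N (a *: x).
Proof. by case=> _ _ h; apply: h. Qed.

Lemma submoduleN N x : submodule N -> N x -> N (- x).
Proof. by rewrite -scaleN1r => hN; apply: submoduleZ. Qed.

Lemma submoduleB N x y : submodule N -> N x -> N y -> N (x - y).
Proof. by move=> hN Nx Ny; apply: submoduleD => //; apply: submoduleN. Qed.

Lemma submodule_sum N (I : Type) (r : seq I) (P : pred I) (F : I -> M) :
  submodule N -> (forall i, P i -> N (F i)) -> N (\sum_(i <- r | P i) F i).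
Proof.
by move=> hN h; elim/big_ind: _ => //; [apply: submodule0 | move=> x y; apply: submoduleD].
Qed.

Lemma sub_span X : X `<=` span X.
Proof.
move=> x Xx; exists 1%N, (fun=> 1), (fun=> x); split=> //.
by rewrite big_ord1 scale1r.
Qed.

Lemma span_min X N : submodule N -> X `<=` N -> span X `<=` N.
Proof.
move=> hN XN _ [n [a [x [Xx ->]]]]; apply: submodule_sum => // i _.
by apply: submoduleZ => //; apply: XN.
Qed.

Lemma span_submodule X : submodule (span X).
Proof.
split.
- by exists 0%N, (fun=> 0), (fun=> 0); split; [case|rewrite big_ord0].
- move=> _ _ [n [a [x [Xx ->]]]] [m [b [y [Xy ->]]]].
  exists (n + m)%N, (fun i => match split i with inl j => a j | inr j => b j end).
  exists (fun i => match split i with inl j => x j | inr j => y j end).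
  split; first by move=> i; case: (split i).
  rewrite big_split_ord /=; congr (_ + _); apply: eq_bigr => i _.
    by rewrite -[lshift _ _]/(unsplit (inl i)) unsplitK.
  by rewrite -[rshift _ _]/(unsplit (inr i)) unsplitK.
- move=> b _ [n [a [x [Xx ->]]]]; exists n, (fun i => b * a i), x; split=> //.
  by rewrite scaler_sumr; apply: eq_bigr => i _; rewrite scalerA.
Qed.

End Submodules.

Section Ideals.
Variable A : comPzRingType.
Implicit Types (I : set A) (a b x y : A).

Lemma ideal0 I : ideal I -> I 0. Proof. exact: submodule0. Qed.
Lemma idealD I x y : ideal I -> I x -> I y -> I (x + y).
Proof. exact: submoduleD. Qed.
Lemma idealMl I a x : ideal I -> I x -> I (a * x).
Proof. exact: (@submoduleZ A A^o). Qed.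
Lemma idealMr I a x : ideal I -> I x -> I (x * a).
Proof. by rewrite mulrC; apply: idealMl. Qed.
Lemma idealN I x : ideal I -> I x -> I (- x).
Proof. exact: (@submoduleN A A^o). Qed.
Lemma idealB I x y : ideal I -> I x -> I y -> I (x - y).
Proof. exact: (@submoduleB A A^o). Qed.
Lemma ideal_sum I (T : Type) (r : seq T) (P : pred T) (F : T -> A) :
  ideal I -> (forall i, P i -> I (F i)) -> I (\sum_(i <- r | P i) F i).
Proof. exact: (@submodule_sum A A^o). Qed.

Lemma idealP I : I 0 -> (forall x y, I x -> I y -> I (x + y)) ->
  (forall a x, I x -> I (a * x)) -> ideal I.
Proof. by []. Qed.

Lemma principal_ideal a : ideal (principal a).
Proof.
apply: idealP.
- by exists 0 => //; rewrite mulr0.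
- by move=> _ _ [x _ <-] [y _ <-]; exists (x + y) => //; rewrite mulrDr.
- by move=> b _ [x _ <-]; exists (b * x) => //; rewrite mulrCA.
Qed.

Lemma principalM a x : principal a (a * x). Proof. by exists x. Qed.

Lemma principalP a x : principal a x -> exists y, x = a * y.
Proof. by case=> y _ <-; exists y. Qed.

Definition addI I I' : set A := [set x | exists a b, [/\ I a, I' b & x = a + b]].

Lemma addI_ideal I I' : ideal I -> ideal I' -> ideal (addI I I').
Proof.
move=> hI hI'; apply: idealP.
- by exists 0, 0; rewrite addr0; split=> //; apply: ideal0.
- move=> _ _ [a [b [Ia Ib ->]]] [a' [b' [Ia' Ib' ->]]].
  by exists (a + a'), (b + b'); rewrite addrACA; split=> //; apply: idealD.
- move=> c _ [a [b [Ia Ib ->]]]; exists (c * a), (c * b); rewrite mulrDr.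
  by split=> //; apply: idealMl.
Qed.

Lemma sub_addIl I I' : ideal I' -> I `<=` addI I I'.
Proof. by move=> hI' x Ix; exists x, 0; rewrite addr0; split=> //; apply: ideal0. Qed.

Lemma sub_addIr I I' : ideal I -> I' `<=` addI I I'.
Proof. by move=> hI x Ix; exists 0, x; rewrite add0r; split=> //; apply: ideal0. Qed.

(** Zorn's lemma, with the empty set admitted so that the empty chain has a bound. *)
Lemma maximal_above I : ideal I -> ~ I 1 ->
  exists2 m, maximal_ideal m & I `<=` m.
Proof.
move=> hI nI1.
pose P (J : set A) := J = set0 \/ [/\ ideal J, I `<=` J & ~ J 1].
have [F FP totF|m [Pm mmax]] := @Zorn_bigcup A P.
  have [[X FX XN0]|noX] := pselect (exists2 X, F X & X <> set0); last first.
    left; rewrite -subset0 => x [X FX Xx]; apply: noX; exists X => //.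
    by move=> X0; rewrite X0 in Xx.
  have PX Y : F Y -> Y <> set0 -> [/\ ideal Y, I `<=` Y & ~ Y 1].
    by move=> FY YN0; case: (FP _ FY).
  have PX' Y y : F Y -> Y y -> [/\ ideal Y, I `<=` Y & ~ Y 1].
    by move=> FY Yy; apply: PX => // Y0; rewrite Y0 in Yy.
  have [hX IX X1] := PX _ FX XN0.
  right; split.
  - apply: idealP.
    + by exists X => //; apply: ideal0.
    + move=> x y [Y FY Yx] [Z FZ Zy].
      have [YZ|ZY] := totF _ _ FY FZ.
        exists Z => //; have [hZ _ _] := PX' _ _ FZ Zy.
        by apply: idealD => //; apply: YZ.
      exists Y => //; have [hY _ _] := PX' _ _ FY Yx.
      by apply: idealD => //; apply: ZY.
    + move=> a x [Y FY Yx]; exists Y => //; have [hY _ _] := PX' _ _ FY Yx.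
      exact: idealMl.
  - by move=> x Ix; exists X => //; apply: IX.
  - by move=> [Y FY Y1]; have [_ _] := PX' _ _ FY Y1; apply.
case: Pm => [m0|[hm Im m1]].
  exfalso; apply: (mmax I); last by right; split.
  by rewrite m0; split=> [x []|/(_ 0 (ideal0 hI))].
exists m => //; split=> // J hJ J1 mJ; apply: contrapT => Jm.
apply: (mmax J); last by right; split=> // x /Im/mJ.
by split=> // Jsub; apply: Jm; rewrite eqEsubset.
Qed.

Lemma jacobson_ideal : ideal (@jacobson_radical A).
Proof.
apply: idealP.
- by move=> m [hm _ _]; apply: ideal0.
- by move=> x y Jx Jy m mm; have [hm _ _] := mm; apply: idealD; [|apply: Jx|apply: Jy].
- by move=> a x Jx m mm; have [hm _ _] := mm; apply: idealMl => //; apply: Jx.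
Qed.

(** Otherwise [1 + x] would lie in a maximal ideal, which also contains [x]. *)
Lemma jacobson_unit x : jacobson_radical x -> is_unit (1 + x).
Proof.
move=> Jx; apply: contrapT => nu.
have [|m mm sub] := maximal_above (principal_ideal (1 + x)).
  by move=> [b _ hb]; apply: nu; exists b.
have [hm m1 _] := mm; apply: m1.
have m1x : m (1 + x) by apply: sub; exists 1 => //; rewrite mulr1.
by rewrite -(addrK x 1); apply: idealB => //; apply: Jx.
Qed.

End Ideals.

Section QuotientRing.
Variables (A : comPzRingType) (K : set A) (hK : ideal K).

Let crep (a : A) : A := choose [pred x | `[< K (x - a) >]] a.

Let crepP a : K (crep a - a).
Proof.
have: [pred x | `[< K (x - a) >]] (crep a).
  by apply: chooseP => /=; apply/asboolP; rewrite subrr; apply: ideal0.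
by move=> /= /asboolP.
Qed.

Let crep_eq a b : K (a - b) -> crep a = crep b.
Proof.
move=> Kab; rewrite /crep.
rewrite (@eq_choose _ _ [pred x | `[< K (x - b) >]]); last first.
  move=> x /=; apply/asboolP/asboolP => h.
    by rewrite -(subrKA a); apply: idealD.
  by rewrite -(subrKA b); apply: idealD => //; rewrite -opprB; apply: idealN.
by apply: choose_id => /=; apply/asboolP => //; rewrite subrr; apply: ideal0.
Qed.

(** The elements of [A/K] are represented by one chosen element per class. *)
Definition quot of ideal K := {x : A | crep x == x}.
Notation B := (quot hK).

HB.instance Definition _ := Choice.on B.

Let crepK a : crep (crep a) == crep a.
Proof. by apply/eqP/crep_eq/crepP. Qed.

Definition to_quot (a : A) : B := exist _ (crep a) (crepK a).

Lemma to_quot_val (x : B) : to_quot (val x) = x.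
Proof. by apply: val_inj; case: x => /= a /eqP. Qed.

Lemma to_quotP a b : K (a - b) -> to_quot a = to_quot b.
Proof. by move=> Kab; apply: val_inj; apply: crep_eq. Qed.

Lemma to_quot_eq a b : to_quot a = to_quot b -> K (a - b).
Proof.
move=> /(congr1 val) /= eab; rewrite -(subrKA (crep a)).
apply: idealD => //; last by rewrite eab; apply: crepP.
by rewrite -opprB; apply: idealN => //; apply: crepP.
Qed.

Let valK a : K (val (to_quot a) - a). Proof. exact: crepP. Qed.

Let addB (x y : B) : B := to_quot (val x + val y).
Let oppB (x : B) : B := to_quot (- val x).
Let mulB (x y : B) : B := to_quot (val x * val y).

Let toD a b : addB (to_quot a) (to_quot b) = to_quot (a + b).
Proof. by apply: to_quotP; rewrite opprD addrACA; apply: idealD => //; apply: valK. Qed.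

Let toM a b : mulB (to_quot a) (to_quot b) = to_quot (a * b).
Proof.
apply: to_quotP; set a' := val _; set b' := val _.
have -> : a' * b' - a * b = a' * (b' - b) + b * (a' - a).
  by rewrite !mulrBr [b * a']mulrC [b * a]mulrC addrA subrK.
by apply: idealD => //; apply: idealMl => //; apply: valK.
Qed.

Let toN a : oppB (to_quot a) = to_quot (- a).
Proof. by apply: to_quotP; rewrite -opprD; apply: idealN => //; apply: valK. Qed.

Let quotW (P : B -> Prop) : (forall a, P (to_quot a)) -> forall x, P x.
Proof. by move=> h x; rewrite -(to_quot_val x). Qed.

Let addBA : associative addB.
Proof. by elim/quotW=> a; elim/quotW=> b; elim/quotW=> c; rewrite !toD addrA. Qed.
Let addBC : commutative addB.
Proof. by elim/quotW=> a; elim/quotW=> b; rewrite !toD addrC. Qed.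
Let add0B : left_id (to_quot 0) addB.
Proof. by elim/quotW=> a; rewrite !toD add0r. Qed.
Let addNB : left_inverse (to_quot 0) oppB addB.
Proof. by elim/quotW=> a; rewrite toN !toD addNr. Qed.
Let mulBA : associative mulB.
Proof. by elim/quotW=> a; elim/quotW=> b; elim/quotW=> c; rewrite !toM mulrA. Qed.
Let mulBC : commutative mulB.
Proof. by elim/quotW=> a; elim/quotW=> b; rewrite !toM mulrC. Qed.
Let mul1B : left_id (to_quot 1) mulB.
Proof. by elim/quotW=> a; rewrite !toM mul1r. Qed.
Let mulBD : left_distributive mulB addB.
Proof.
by elim/quotW=> a; elim/quotW=> b; elim/quotW=> c; rewrite !(toD, toM) mulrDl.
Qed.

HB.instance Definition _ := GRing.isZmodule.Build B addBA addBC add0B addNB.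
HB.instance Definition _ :=
  GRing.Zmodule_isComPzRing.Build B mulBA mulBC mul1B mulBD.

Let to_quot_additive : zmod_morphism to_quot.
Proof. by move=> a b; rewrite -toD -toN. Qed.
Let to_quot_monoid : monoid_morphism to_quot.
Proof. by split=> // a b; rewrite -toM. Qed.
HB.instance Definition _ :=
  GRing.isZmodMorphism.Build A B to_quot to_quot_additive.
HB.instance Definition _ :=
  GRing.isMonoidMorphism.Build A B to_quot to_quot_monoid.

Lemma quotient_map_to_quot : quotient_map K (to_quot : {rmorphism A -> B}).
Proof.
split=> [b|a]; first by exists (sval b); apply: to_quot_val.
split=> [|Ka]; last by rewrite -(rmorph0 to_quot); apply: to_quotP; rewrite subr0.
by rewrite -(rmorph0 to_quot) => /to_quot_eq; rewrite subr0.
Qed.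

End QuotientRing.

Section ResidueField.
Variables (A : comPzRingType) (m : set A) (mm : maximal_ideal m).

Let hm : ideal m. Proof. by case: mm. Qed.

Definition residue_field of maximal_ideal m := quot hm.
Notation k := (residue_field mm).

HB.instance Definition _ := GRing.ComPzRing.on k.

Definition to_residue : A -> k := to_quot hm.
HB.instance Definition _ := GRing.RMorphism.on to_residue.

Lemma to_residue_surj (x : k) : exists a, to_residue a = x.
Proof. by case: (quotient_map_to_quot hm) => h _; apply: h. Qed.

Lemma to_residue_eq0 a : to_residue a = 0 <-> m a.
Proof. by case: (quotient_map_to_quot hm) => _ h; apply: h. Qed.

Let one_neq0 : 1 != 0 :> k.
Proof.
apply/eqP; rewrite -(rmorph1 to_residue) => /to_residue_eq0.
by case: mm.
Qed.

HB.instance Definition _ := GRing.PzSemiRing_isNonZero.Build k one_neq0.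

Let inv_ex (x : k) : exists y : k, (x != 0 -> y * x = 1) /\ (x = 0 -> y = 0).
Proof.
have [->|/eqP xN0] := eqVneq x 0; first by exists 0.
have [a ax] := to_residue_surj x.
suff [b [c [mc e]]] : exists b c, m c /\ 1 = c + b * a.
  exists (to_residue b); split=> // _; rewrite -ax -rmorphM.
  have /eqP := congr1 to_residue e; rewrite rmorph1 rmorphD.
  have /to_residue_eq0 h := mc.
  by rewrite [X in _ == X + _]h add0r => /eqP.
have hI := addI_ideal hm (principal_ideal a).
apply: contrapT => no; have [_ _ mmax] := mm.
have me : addI m (principal a) = m.
  apply: mmax => //; last exact: sub_addIl (principal_ideal a).
  by move=> [c [_ [mc [b _ <-] e]]]; apply: no; exists b, c; rewrite mulrC.
apply: xN0; rewrite -ax; apply/to_residue_eq0; rewrite -me.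
move: (principalM a 1); rewrite mulr1; exact: sub_addIr.
Qed.

Let invk (x : k) : k := sval (cid (inv_ex x)).

Let mulVk (x : k) : x != 0 -> invk x * x = 1.
Proof. by rewrite /invk; case: cid => y [h _] /=. Qed.

Let invk0 : invk 0 = 0.
Proof. by rewrite /invk; case: cid => y [_ h] /=; apply: h. Qed.

HB.instance Definition _ := GRing.ComNzRing_isField.Build k mulVk invk0.

Lemma residue_field_exists :
  exists (F : fieldType) (q : {rmorphism A -> F}), forall a, q a = 0 <-> m a.
Proof. by exists k, to_residue; apply: to_residue_eq0. Qed.

End ResidueField.

(** * Matrices with entries in an ideal *)

Section MatrixIdeal.
Variable A : comPzRingType.
Implicit Types (I : set A).

Definition mxin I m n (X : 'M[A]_(m, n)) : Prop := forall i j, I (X i j).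

Section Closure.
Variables (I : set A) (hI : ideal I).

Lemma mxin0 m n : mxin I (0 : 'M_(m, n)).
Proof. by move=> i j; rewrite mxE; apply: ideal0. Qed.

Lemma mxinD m n (X Y : 'M_(m, n)) : mxin I X -> mxin I Y -> mxin I (X + Y).
Proof. by move=> hX hY i j; rewrite mxE; apply: idealD. Qed.

Lemma mxinN m n (X : 'M_(m, n)) : mxin I X -> mxin I (- X).
Proof. by move=> hX i j; rewrite mxE; apply: idealN. Qed.

Lemma mxinB m n (X Y : 'M_(m, n)) : mxin I X -> mxin I Y -> mxin I (X - Y).
Proof. by move=> hX hY; apply: mxinD => //; apply: mxinN. Qed.

Lemma mxinMl m n r (X : 'M_(m, n)) (Y : 'M_(n, r)) : mxin I Y -> mxin I (X *m Y).
Proof. by move=> hY i j; rewrite mxE; apply: ideal_sum => // k _; apply: idealMl. Qed.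

Lemma mxinMr m n r (X : 'M_(m, n)) (Y : 'M_(n, r)) : mxin I X -> mxin I (X *m Y).
Proof. by move=> hX i j; rewrite mxE; apply: ideal_sum => // k _; apply: idealMr. Qed.

Lemma mxinZ m n a (X : 'M_(m, n)) : mxin I X -> mxin I (a *: X).
Proof. by move=> hX i j; rewrite mxE; apply: idealMl. Qed.

End Closure.

Lemma mxin_sub I I' m n (X : 'M_(m, n)) : I `<=` I' -> mxin I X -> mxin I' X.
Proof. by move=> II' hX i j; apply: II'. Qed.

Lemma mxin_principal a m n (X : 'M_(m, n)) :
  mxin (principal a) X -> exists Y : 'M_(m, n), X = a *: Y.
Proof.
move=> hX.
have /choice[f fP] : forall ij : 'I_m * 'I_n, exists y, X ij.1 ij.2 = a * y.
  by move=> [i j]; apply/principalP/hX.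
by exists (\matrix_(i, j) f (i, j)); apply/matrixP => i j; rewrite !mxE -fP.
Qed.

Lemma scale_mxI a m n (X Y : 'M_(m, n)) : (forall x : A, a * x = 0 -> x = 0) ->
  a *: X = a *: Y -> X = Y.
Proof.
move=> ra /matrixP e; apply/matrixP => i j; apply/eqP; rewrite -subr_eq0; apply/eqP.
by apply: ra; have := e i j; rewrite !mxE mulrBr => ->; rewrite subrr.
Qed.

(** Modulo the radical the determinant of [1 + X] is that of the identity, so it is a
    unit. *)
Lemma mx_invertible1 n (X : 'M[A]_n) : mxin (@jacobson_radical A) X ->
  exists Y, (1%:M + X) *m Y = 1%:M /\ Y *m (1%:M + X) = 1%:M.
Proof.
move=> hX; have hJ := @jacobson_ideal A.
pose q : {rmorphism A -> quot hJ} := to_quot hJ.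
have [_ q0] := quotient_map_to_quot hJ.
have detJ : jacobson_radical (\det (1%:M + X) - 1).
  apply/q0; rewrite rmorphB rmorph1 -det_map_mx map_mxD map_mx1.
  rewrite (_ : map_mx _ X = 0) ?addr0 ?det1 ?subrr //.
  by apply/matrixP => i j; rewrite !mxE; apply/q0.
have := jacobson_unit detJ; rewrite addrC subrK => -[b hb].
exists (b *: \adj (1%:M + X)).
by rewrite -scalemxAr -scalemxAl mul_mx_adj mul_adj_mx -mul_scalar_mx -scalar_mxM mulrC hb.
Qed.

(** [1 - X] is invertible and annihilates [X]. *)
Lemma idempotent_rad0 n (X : 'M[A]_n) : mxin (@jacobson_radical A) X ->
  X *m X = X -> X = 0.
Proof.
move=> hX XX; have [Y [_ YX]] := mx_invertible1 (mxinN (@jacobson_ideal A) hX).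
by rewrite -[X]mul1mx -YX -mulmxA mulmxDl mul1mx mulNmx XX subrr mulmx0.
Qed.

End MatrixIdeal.

(** Surjectivity of the linearisation [phi^* M -> M] forces bijectivity: modulo a
    maximal ideal, which contains [p], the idempotent [phi e] is the Frobenius twist
    of [e] and so has the same rank as [e] and [Q *m P]. *)
Lemma frobenius_idempotent_rank p (S : comPzRingType) (phi : {rmorphism S -> S})
    r (e P Q : 'M[S]_r) :
  prime p -> frobenius_lift p phi -> jacobson_radical (p%:R : S) ->
  e *m P = P -> P *m map_mx phi e = P -> map_mx phi e *m Q = Q ->
  e *m e = e -> P *m Q = e -> Q *m P = map_mx phi e.
Proof.
move=> p_pr phi_frob pJ eP Pe eQ ee PQ.
set f := map_mx phi e in Pe eQ *.
have ff : f *m f = f by rewrite /f -map_mxM ee.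
suff h : f - Q *m P = 0 by apply/esym/eqP; rewrite -subr_eq0 h.
have QPf : Q *m P *m f = Q *m P by rewrite -mulmxA Pe.
have fQP : f *m (Q *m P) = Q *m P by rewrite mulmxA eQ.
apply: idempotent_rad0; last first.
  rewrite mulmxBl !mulmxBr ff QPf fQP -mulmxA (mulmxA P) PQ eP.
  by rewrite subrr subr0.
move=> i j m mm; have [k [q q0]] := residue_field_exists mm.
have qp : q p%:R = 0 by apply/q0; exact: pJ.
have ch : p \in [pchar k] by rewrite inE p_pr -(rmorph_nat q) qp eqxx.
have phi_frobk x : q (phi x) = pFrobenius_aut ch (q x).
  rewrite pFrobenius_autE -rmorphXn; apply/eqP; rewrite -subr_eq0 -rmorphB.
  by have [y ->] := principalP (phi_frob x); rewrite rmorphM qp mul0r.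
pose e' := map_mx q e; pose P' := map_mx q P; pose Q' := map_mx q Q.
have f'E : map_mx q f = map_mx (pFrobenius_aut ch) e'.
  by apply/matrixP => a b; rewrite !mxE phi_frobk.
have rf : \rank (map_mx q f) = \rank e' by rewrite f'E mxrank_map.
have PQ' : P' *m Q' = e' by rewrite -map_mxM PQ.
have re : (\rank e' <= \rank (Q' *m P'))%N.
  have <- : P' *m (Q' *m P') *m Q' = e'.
    by rewrite mulmxA PQ' -mulmxA PQ' -map_mxM ee.
  by apply: leq_trans (mxrankM_maxl _ _) (mxrankM_maxr _ _).
have sub : (Q' *m P' <= map_mx q f)%MS.
  by rewrite -map_mxM -QPf map_mxM submxMl.
have : (map_mx q f <= Q' *m P')%MS.
  by rewrite -(mxrank_leqif_sup sub) rf eqn_leq -rf mxrankS //= rf.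
case/submxP => X fX.
have /matrixP/(_ i j) : map_mx q f = map_mx q (Q *m P).
  rewrite -[in RHS]fQP map_mxM fX [in RHS]map_mxM -!mulmxA.
  by rewrite (mulmxA P') PQ' -!map_mxM eP.
rewrite [LHS]mxE [RHS]mxE => fqij; apply/q0.
by rewrite mxE [X in _ + X]mxE rmorphB fqij subrr.
Qed.

(** * Graded matrices over a frame *)

Section FrameBasics.
Variables (p : nat) (S : comPzRingType) (F : frame p S).

Lemma fr_Fil_jac x : fr_Fil F x -> jacobson_radical x.
Proof. by move=> /fr_rad -/(_ 0); rewrite mulr0 addr0. Qed.

Lemma fr_p_jac : jacobson_radical (p%:R : S).
Proof.
by have := @fr_rad _ _ F _ 1 (ideal0 (fr_Fil_ideal F)); rewrite add0r mulr1.
Qed.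

Lemma fr_phi1_0 : fr_phi1 F 0 = 0.
Proof.
have F0 := ideal0 (fr_Fil_ideal F).
by apply: (@addrI _ (fr_phi1 F 0)); rewrite -fr_phi1D // !addr0.
Qed.

Lemma fr_phi1_sum (I : Type) (s : seq I) (f : I -> S) :
  (forall i, fr_Fil F (f i)) ->
  fr_phi1 F (\sum_(i <- s) f i) = \sum_(i <- s) fr_phi1 F (f i).
Proof.
move=> hf; elim: s => [|i s IH]; first by rewrite !big_nil fr_phi1_0.
rewrite !big_cons fr_phi1D ?IH //.
by apply: ideal_sum => //; apply: fr_Fil_ideal.
Qed.

Lemma fr_phi1B x y : fr_Fil F x -> fr_Fil F y ->
  fr_phi1 F (x - y) = fr_phi1 F x - fr_phi1 F y.
Proof.
move=> Fx Fy; apply: (@addIr _ (fr_phi1 F y)).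
rewrite -fr_phi1D ?subrK //; exact: idealB (fr_Fil_ideal F) Fx Fy.
Qed.

(** The matrix calculus of windows: relative to a normal decomposition [L + N], the
    maps preserving [Fil] are the matrices whose block from [L] to [N] has entries in
    [Fil S], and [dag] is the operation on them for which commutation with [Phi] and
    [Phi1] reads [G *m P = P' *m dag G].

    Here [b] is the grade of the row and [b'] that of the column of an entry; [true]
    stands for [L] and [false] for [N]. *)
Definition fil_entry (b b' : bool) (x : S) : Prop := ~~ b -> b' -> fr_Fil F x.

Definition dag_entry (b b' : bool) (x : S) : S :=
  if b == b' then fr_phi F x else
  if b' then fr_phi1 F x else fr_varpi F * fr_phi F x.

Lemma fil_entry_same b x : fil_entry b b x. Proof. by case: b. Qed.

Lemma fil_entryM b1 b2 b3 x y : fil_entry b1 b2 x -> fil_entry b2 b3 y ->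
  fil_entry b1 b3 (x * y).
Proof.
have hF := fr_Fil_ideal F; case: b2 => hx hy h1 h3.
  by apply: idealMr => //; apply: hx.
by apply: idealMl => //; apply: hy.
Qed.

(** The normalisations are chosen so that [dag_entry] respects products. *)
Lemma dag_entryM b1 b2 b3 x y : fil_entry b1 b2 x -> fil_entry b2 b3 y ->
  dag_entry b1 b3 (x * y) = dag_entry b1 b2 x * dag_entry b2 b3 y.
Proof.
rewrite /dag_entry; case: b1; case: b2; case: b3 => hx hy /=;
  rewrite ?rmorphM ?mulrA //.
- by rewrite mulrAC mulrC mulrA.
- by rewrite (fr_phiE (hy isT isT)) mulrCA mulrA.
- by rewrite [x * y]mulrC fr_phi1M ?[fr_phi F y * _]mulrC //; apply: hx.
- by rewrite (fr_phiE (hx isT isT)) [fr_varpi F * _]mulrC.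
- by rewrite fr_phi1M //; apply: hy.
Qed.

Lemma dag_entry0 b b' : dag_entry b b' 0 = 0.
Proof. by rewrite /dag_entry fr_phi1_0 rmorph0 mulr0; case: (_ == _); case: b'. Qed.

Lemma dag_entryD b b' x y : fil_entry b b' x -> fil_entry b b' y ->
  dag_entry b b' (x + y) = dag_entry b b' x + dag_entry b b' y.
Proof.
rewrite /dag_entry /fil_entry rmorphD mulrDr.
by case: b; case: b' => hx hy //=; apply: fr_phi1D; [apply: hx | apply: hy].
Qed.

Lemma dag_entryB b b' x y : fil_entry b b' x -> fil_entry b b' y ->
  dag_entry b b' (x - y) = dag_entry b b' x - dag_entry b b' y.
Proof.
rewrite /dag_entry /fil_entry rmorphB mulrBr.
by case: b; case: b' => hx hy //=; apply: fr_phi1B; [apply: hx | apply: hy].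
Qed.

Section Dag.
Implicit Types (m n r : nat).

Definition filmx m n (gr : 'I_m -> bool) (gc : 'I_n -> bool) (X : 'M[S]_(m, n)) :=
  forall i j, fil_entry (gr i) (gc j) (X i j).

Definition dag m n (gr : 'I_m -> bool) (gc : 'I_n -> bool) (X : 'M[S]_(m, n)) :=
  \matrix_(i, j) dag_entry (gr i) (gc j) (X i j).

Lemma filmx0 m n gr gc : @filmx m n gr gc 0.
Proof. by move=> i j _ _; rewrite mxE; apply: ideal0 (fr_Fil_ideal F). Qed.

Lemma filmxD m n gr gc (X Y : 'M_(m, n)) :
  filmx gr gc X -> filmx gr gc Y -> filmx gr gc (X + Y).
Proof.
move=> hX hY i j b c; rewrite mxE.
by apply: idealD (fr_Fil_ideal F) (hX _ _ b c) (hY _ _ b c).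
Qed.

Lemma filmxZ m n gr gc a (X : 'M_(m, n)) : filmx gr gc X -> filmx gr gc (a *: X).
Proof. by move=> hX i j b c; rewrite mxE; apply: idealMl (fr_Fil_ideal F) (hX _ _ b c). Qed.

Lemma filmxN m n gr gc (X : 'M_(m, n)) : filmx gr gc X -> filmx gr gc (- X).
Proof. by rewrite -scaleN1r; apply: filmxZ. Qed.

Lemma filmxB m n gr gc (X Y : 'M_(m, n)) :
  filmx gr gc X -> filmx gr gc Y -> filmx gr gc (X - Y).
Proof. by move=> hX hY; apply: filmxD => //; apply: filmxN. Qed.

Lemma filmxM m n r gr gk gc (X : 'M_(m, n)) (Y : 'M_(n, r)) :
  filmx gr gk X -> filmx gk gc Y -> filmx gr gc (X *m Y).
Proof.
move=> hX hY i j b c; rewrite mxE; apply: ideal_sum; first exact: fr_Fil_ideal.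
by move=> k _; apply: (fil_entryM (hX i k) (hY k j)).
Qed.

Lemma filmx_in m n gr gc (X : 'M_(m, n)) : mxin (fr_Fil F) X -> filmx gr gc X.
Proof. by move=> hX i j _ _; apply: hX. Qed.

Lemma dagM m n r gr gk gc (X : 'M_(m, n)) (Y : 'M_(n, r)) :
  filmx gr gk X -> filmx gk gc Y ->
  dag gr gc (X *m Y) = dag gr gk X *m dag gk gc Y.
Proof.
move=> hX hY; apply/matrixP => i j; rewrite !mxE.
transitivity (\sum_k dag_entry (gr i) (gc j) (X i k * Y k j)).
  have : forall k, fil_entry (gr i) (gc j) (X i k * Y k j).
    by move=> k; apply: fil_entryM (hX i k) (hY k j).
  rewrite /dag_entry /fil_entry; case: (gr i); case: (gc j) => h /=;
    rewrite ?rmorph_sum ?mulr_sumr //.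
  by apply: fr_phi1_sum => k; apply: h.
by apply: eq_bigr => k _; rewrite !mxE; apply: dag_entryM.
Qed.

Lemma dag0 m n gr gc : @dag m n gr gc 0 = 0.
Proof. by apply/matrixP => i j; rewrite !mxE dag_entry0. Qed.

Lemma dagD m n gr gc (X Y : 'M_(m, n)) : filmx gr gc X -> filmx gr gc Y ->
  dag gr gc (X + Y) = dag gr gc X + dag gr gc Y.
Proof. by move=> hX hY; apply/matrixP => i j; rewrite !mxE dag_entryD. Qed.

Lemma dagB m n gr gc (X Y : 'M_(m, n)) : filmx gr gc X -> filmx gr gc Y ->
  dag gr gc (X - Y) = dag gr gc X - dag gr gc Y.
Proof. by move=> hX hY; apply/matrixP => i j; rewrite !mxE dag_entryB. Qed.

Lemma dagZ m n gr gc a (X : 'M_(m, n)) : filmx gr gc X ->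
  dag gr gc (a *: X) = fr_phi F a *: dag gr gc X.
Proof.
move=> hX; apply/matrixP => i j; rewrite !mxE.
by rewrite (@dag_entryM (gr i) (gr i)) // /dag_entry ?eqxx //; apply: fil_entry_same.
Qed.

Definition blockdiag m n (gr : 'I_m -> bool) (gc : 'I_n -> bool) (X : 'M[S]_(m, n)) :=
  forall i j, gr i != gc j -> X i j = 0.

Lemma blockdiag_filmx m n gr gc (X : 'M_(m, n)) :
  blockdiag gr gc X -> filmx gr gc X.
Proof.
move=> hX i j b c; rewrite hX; last by rewrite c (negbTE b).
exact: ideal0 (fr_Fil_ideal F).
Qed.

Lemma blockdiagM m n r gr gk gc (X : 'M_(m, n)) (Y : 'M_(n, r)) :
  blockdiag gr gk X -> blockdiag gk gc Y -> blockdiag gr gc (X *m Y).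
Proof.
move=> hX hY i j ne; rewrite mxE big1 // => k _.
have [e|ne'] := eqVneq (gr i) (gk k); last by rewrite hX ?mul0r.
by rewrite hY ?mulr0 // -e.
Qed.

Lemma dag_blockdiag m n gr gc (X : 'M_(m, n)) :
  blockdiag gr gc X -> dag gr gc X = map_mx (fr_phi F) X.
Proof.
move=> hX; apply/matrixP => i j; rewrite !mxE /dag_entry.
case: eqVneq => // ne; rewrite hX // rmorph0 mulr0 fr_phi1_0.
by case: ifP.
Qed.

End Dag.
End FrameBasics.

(** * Windows in coordinates *)

Section MakeLinear.
Variables (R : pzRingType) (U : lmodType R) (V : zmodType).
Variables (s : GRing.Scale.law R V) (f : U -> V) (hf : linear_for s f).

Definition linear_fun of linear_for s f : U -> V := f.
HB.instance Definition _ :=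
  GRing.isLinear.Build R U V s (linear_fun hf) hf.
Definition mk_linear : {linear U -> V | s} := linear_fun hf.
Lemma mk_linearE x : mk_linear x = f x. Proof. by []. Qed.
End MakeLinear.

Section Columns.
Variable S : comPzRingType.

Definition dcol n (j : 'I_n) : 'cV[S]_n := delta_mx j 0.

Lemma col_sum n (v : 'cV[S]_n) : v = \sum_j v j 0 *: dcol j.
Proof.
rewrite [LHS]matrix_sum_delta; apply: eq_bigr => j _.
by rewrite big_ord1.
Qed.

Lemma linear_col n (M : lmodType S) (f : {linear 'cV[S]_n -> M}) v :
  f v = \sum_j v j 0 *: f (dcol j).
Proof. by rewrite {1}[v]col_sum linear_sum; apply: eq_bigr => j _; rewrite linearZ. Qed.

Lemma mul_dcol m n (X : 'M[S]_(m, n)) j : X *m dcol j = col j X.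
Proof. by rewrite -colE. Qed.

Definition mx_of_cols m n (f : 'I_n -> 'cV[S]_m) : 'M[S]_(m, n) :=
  \matrix_(i, j) f j i 0.

Lemma mx_of_colsE m n (f : 'I_n -> 'cV[S]_m) v :
  mx_of_cols f *m v = \sum_j v j 0 *: f j.
Proof.
apply/matrixP => i k; rewrite mxE summxE; apply: eq_bigr => j _.
by rewrite !mxE (ord1 k) mulrC.
Qed.

Lemma mx_of_cols_col m n (f : 'I_n -> 'cV[S]_m) j : mx_of_cols f *m dcol j = f j.
Proof. by rewrite mul_dcol; apply/matrixP => i k; rewrite !mxE (ord1 k). Qed.

Lemma mx_col_ext m n (X Y : 'M[S]_(m, n)) :
  (forall j, X *m dcol j = Y *m dcol j) -> X = Y.
Proof.
move=> h; apply/matrixP => i j; have := h j; rewrite !mul_dcol => /matrixP/(_ i 0).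
by rewrite !mxE.
Qed.

Definition comb n (M : lmodType S) (x : 'I_n -> M) (v : 'cV[S]_n) : M :=
  \sum_j v j 0 *: x j.

Lemma comb_linear n (M : lmodType S) (x : 'I_n -> M) : linear (comb x).
Proof.
move=> a u v; rewrite /comb scaler_sumr -big_split; apply: eq_bigr => j _ /=.
by rewrite !mxE scalerDl scalerA.
Qed.

Definition combl n (M : lmodType S) (x : 'I_n -> M) : {linear 'cV[S]_n -> M} :=
  mk_linear (comb_linear x).

Lemma comblE n (M : lmodType S) (x : 'I_n -> M) v :
  combl x v = \sum_j v j 0 *: x j.
Proof. by []. Qed.

Lemma comb_dcol n (M : lmodType S) (x : 'I_n -> M) j : combl x (dcol j) = x j.
Proof.
rewrite comblE (bigD1 j) //= mxE !eqxx scale1r big1 ?addr0 // => k ne.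
by rewrite mxE (negbTE ne) scale0r.
Qed.

End Columns.

(** A vector of a window is a column of grade [N]; a vector of its filtration may
    also be regarded as a column of grade [L]. Then [dag] computes [Phi] in the first
    case and [Phi1] in the second. *)
Notation colL := (fun _ : 'I_1 => true).
Notation colN := (fun _ : 'I_1 => false).

Section WindowData.
Variables (p : nat) (S : comPzRingType) (F : frame p S).
Local Notation phi := (fr_phi F).

(** The coordinates of a window: [M] is the image of the idempotent [we] acting on a
    free module whose basis vectors are marked as belonging to [L] ([true]) or to [N],
    and [wP] is the matrix of the linear isomorphism [phi^* M -> M] given by [Phi1] on
    [L] and [Phi] on [N], with inverse [wQ]. *)
Record wdatum := WDatum {
  wr : nat;
  wgr : 'I_wr -> bool;
  we : 'M[S]_wr;
  wP : 'M[S]_wr;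
  wQ : 'M[S]_wr;
  we_idem : we *m we = we;
  we_block : blockdiag wgr wgr we;
  weP : we *m wP = wP;
  wPe : wP *m map_mx phi we = wP;
  weQ : map_mx phi we *m wQ = wQ;
  wQe : wQ *m we = wQ;
  wPQ : wP *m wQ = we;
  wQP : wQ *m wP = map_mx phi we
}.

Record presents (M : window F) (X : wdatum) (i : {linear M -> 'cV[S]_(wr X)})
    (s : {linear 'cV[S]_(wr X) -> M}) : Prop := Presents {
  pr_si : forall m, s (i m) = m;
  pr_is : forall v, i (s v) = we X *m v;
  pr_Fil : forall m, win_Fil m <-> filmx F (@wgr X) colL (i m);
  pr_Phi : forall m, i (win_Phi M m) = wP X *m dag F (@wgr X) colN (i m);
  pr_Phi1 : forall m, win_Fil m ->
    i (win_Phi1 m) = wP X *m dag F (@wgr X) colL (i m)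
}.

(** The last condition expresses compatibility with both [Phi] and [Phi1], column by
    column according to the grade. *)
Record dhom (X Y : wdatum) (G : 'M[S]_(wr Y, wr X)) : Prop := DHom {
  dh_l : we Y *m G = G;
  dh_r : G *m we X = G;
  dh_fil : filmx F (@wgr Y) (@wgr X) G;
  dh_P : G *m wP X = wP Y *m dag F (@wgr Y) (@wgr X) G
}.

Lemma fil_dcol n (gr : 'I_n -> bool) j (b : bool) : (b -> gr j) ->
  filmx F gr (fun _ : 'I_1 => b) (dcol S j).
Proof.
move=> bj i k hi hb; rewrite mxE; have [ij|_] := eqVneq i j.
  by rewrite -ij in bj; rewrite (bj hb) in hi.
exact: ideal0 (fr_Fil_ideal F).
Qed.

Lemma dag_dcol n (gr : 'I_n -> bool) j :
  dag F gr (fun _ : 'I_1 => gr j) (dcol S j) = dcol S j.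
Proof.
apply/matrixP => i k; rewrite !mxE (ord1 k) andbT /dag_entry.
have [->|_] := eqVneq i j; first by rewrite eqxx rmorph1.
exact: (dag_entry0 F).
Qed.

(** The columns of [wP] are the images of the basis vectors under [Phi1] or [Phi]. *)
Lemma wP_dcol (X : wdatum) j :
  wP X *m dcol S j
  = wP X *m dag F (@wgr X) (fun _ : 'I_1 => wgr j) (we X *m dcol S j).
Proof.
rewrite (dagM (blockdiag_filmx F (@we_block X))); last exact: fil_dcol.
by rewrite dag_dcol dag_blockdiag ?mulmxA ?wPe //; apply: we_block.
Qed.

Lemma pr_inj M X i s (h : @presents M X i s) : injective i.
Proof. by move=> m m' e; rewrite -(pr_si h m) e (pr_si h). Qed.

Lemma pr_ei M X i s (h : @presents M X i s) m : we X *m i m = i m.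
Proof. by rewrite -(pr_is h) (pr_si h). Qed.

Section HomMatrix.
Variables (M N : window F) (X Y : wdatum).
Variables (iM : {linear M -> 'cV[S]_(wr X)}) (sM : {linear 'cV[S]_(wr X) -> M}).
Variables (iN : {linear N -> 'cV[S]_(wr Y)}) (sN : {linear 'cV[S]_(wr Y) -> N}).
Hypotheses (hM : presents iM sM) (hN : presents iN sN).

Definition hom_mx (h : M -> N) : 'M[S]_(wr Y, wr X) :=
  mx_of_cols (fun j => iN (h (sM (dcol S j)))).

Lemma hom_mxE (h : {linear M -> N}) v : hom_mx h *m v = iN (h (sM v)).
Proof.
rewrite mx_of_colsE [v in RHS]col_sum !linear_sum.
by apply: eq_bigr => j _; rewrite !linearZ.
Qed.

Lemma hom_mx_i (h : {linear M -> N}) m : hom_mx h *m iM m = iN (h m).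
Proof. by rewrite hom_mxE (pr_si hM). Qed.

Lemma hom_mx_dhom (h : window_hom M N) : dhom (hom_mx h).
Proof.
have er : hom_mx h *m we X = hom_mx h.
  apply: mx_col_ext => j; rewrite -mulmxA -(pr_is hM) hom_mx_i.
  by rewrite -hom_mxE.
split=> //.
- by apply: mx_col_ext => j; rewrite -mulmxA !hom_mxE (pr_ei hN).
- move=> a j na gj; have : win_Fil (h (sM (dcol S j))).
    apply: wh_Fil; apply/(pr_Fil hM); rewrite (pr_is hM).
    by apply: filmxM (blockdiag_filmx F (@we_block X)) _; apply: fil_dcol.
  by rewrite (pr_Fil hN) => /(_ a 0 na isT); rewrite !mxE.
- apply: mx_col_ext => j; rewrite -mulmxA wP_dcol -(pr_is hM) -[RHS]mulmxA.
  set G := hom_mx h; set m := sM (dcol S j).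
  have Gm : iN (h m) = G *m dcol S j by rewrite hom_mxE.
  have fG : filmx F (@wgr Y) (@wgr X) G.
    move=> a k na gk; have : win_Fil (h (sM (dcol S k))).
      apply: wh_Fil; apply/(pr_Fil hM); rewrite (pr_is hM).
      by apply: filmxM (blockdiag_filmx F (@we_block X)) _; apply: fil_dcol.
    by rewrite (pr_Fil hN) => /(_ a 0 na isT); rewrite !mxE.
  have dG : dag F (@wgr Y) (@wgr X) G *m dcol S j
      = dag F (@wgr Y) (fun _ : 'I_1 => wgr j) (iN (h m)).
    by rewrite Gm (dagM fG) ?dag_dcol //; apply: fil_dcol.
  rewrite dG; case gj: (wgr j).
    have Fm : win_Fil m.
      apply/(pr_Fil hM); rewrite (pr_is hM).
      apply: filmxM (blockdiag_filmx F (@we_block X)) _; apply: fil_dcol.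
      by rewrite gj.
    rewrite -(pr_Phi1 hM) // -(pr_Phi1 hN); last exact: wh_Fil.
    by rewrite /G hom_mx_i wh_Phi1.
  by rewrite -(pr_Phi hM) -(pr_Phi hN) /G hom_mx_i wh_Phi.
Qed.

Lemma hom_of_mx G : dhom G -> exists h : window_hom M N,
  forall m, iN (h m) = G *m iM m.
Proof.
case=> el er fG GP.
have lh : linear (fun m => sN (G *m iM m)).
  by move=> a u v; rewrite !linearP.
pose h := mk_linear lh.
have hE m : iN (h m) = G *m iM m.
  by rewrite mk_linearE (pr_is hN) mulmxA el.
have hF m : win_Fil m -> win_Fil (h m).
  by move=> /(pr_Fil hM) Fm; apply/(pr_Fil hN); rewrite hE; apply: filmxM fG Fm.
have hPhi m : h (win_Phi M m) = win_Phi N (h m).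
  apply: (pr_inj hN); rewrite hE (pr_Phi hM) (pr_Phi hN) hE mulmxA GP.
  by rewrite (dagM fG) ?mulmxA.
have hPhi1 m : win_Fil m -> h (win_Phi1 m) = win_Phi1 (h m).
  move=> Fm; apply: (pr_inj hN); rewrite hE (pr_Phi1 hM) // (pr_Phi1 hN); last exact: hF.
  by rewrite hE mulmxA GP (dagM fG) ?mulmxA //; apply/(pr_Fil hM).
by exists (WindowHom hF hPhi hPhi1).
Qed.

End HomMatrix.

(** As [wP] is invertible relative to the idempotents, compatibility with [Phi] and
    [Phi1] becomes a fixed point equation, which makes sense for arbitrary matrices
    in place of [wP] and [wQ]. *)
Lemma dhom_fix (X Y : wdatum) G : @dhom X Y G ->
  G = wP Y *m dag F (@wgr Y) (@wgr X) G *m wQ X.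
Proof. by case=> _ er _ GP; rewrite -GP -mulmxA wPQ er. Qed.

Lemma fix_dhom (X Y : wdatum) G : filmx F (@wgr Y) (@wgr X) G ->
  G = wP Y *m dag F (@wgr Y) (@wgr X) G *m wQ X -> @dhom X Y G.
Proof.
move=> fG e.
have el : we Y *m G = G by rewrite e !mulmxA weP.
have er : G *m we X = G by rewrite e -mulmxA wQe.
split=> //; rewrite {1}e -[LHS]mulmxA wQP -mulmxA; congr (_ *m _).
rewrite -(dag_blockdiag F (@we_block X)) -(dagM fG) ?er //.
exact/blockdiag_filmx/we_block.
Qed.

End WindowData.

Arguments hom_mx_i {p S F M N X Y iM sM iN} hM h m.

Section Projection.
Variables (S : comPzRingType) (M : lmodType S) (L N : set M).
Hypotheses (hL : submodule L) (hN : submodule N) (LN : direct_sum L N).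

Lemma direct_sum_proj : exists q : {linear M -> M},
  [/\ forall m, L (q m), forall m, N (m - q m), forall l, L l -> q l = l
    & forall n, N n -> q n = 0].
Proof.
case: LN => dec cap.
have uniq l n l' n' : L l -> N n -> L l' -> N n' -> l + n = l' + n' -> l = l'.
  move=> Ll Nn Ll' Nn' e; apply/eqP; rewrite -subr_eq0; apply/eqP.
  have : (L `&` N) (l - l').
    split; first exact: submoduleB.
    have -> : l - l' = n' - n by apply/eqP; rewrite subr_eq addrAC eq_sym subr_eq addrC -e addrC.
    exact: submoduleB.
  by rewrite cap.
have /choice[f fP] m : exists l, L l /\ N (m - l).
  by have [l [n [Ll Nn ->]]] := dec m; exists l; rewrite addrC addKr.
have fu m l : L l -> N (m - l) -> f m = l.
  move=> Ll Nl; have [Lf Nf] := fP m.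
  by apply: (uniq _ _ _ _ Lf Nf Ll Nl); rewrite ![_ + (m - _)]addrC !subrK.
have lf : linear f.
  move=> a u v; apply: fu.
    by apply: submoduleD => //; [apply: submoduleZ|]; have [] := fP v; have [] := fP u.
  have [_ Nu] := fP u; have [_ Nv] := fP v.
  rewrite opprD addrACA -scalerBr.
  by apply: submoduleD => //; apply: submoduleZ.
exists (mk_linear lf); split=> x; rewrite /= ?mk_linearE.
- by have [] := fP x.
- by have [] := fP x.
- by move=> Lx; apply: fu => //; rewrite subrr; apply: submodule0.
- by move=> Nx; apply: fu; rewrite ?subr0 //; apply: submodule0.
Qed.

End Projection.

Section PresentationExists.
Variables (p : nat) (p_pr : prime p) (S : comPzRingType) (F : frame p S).
Local Notation phi := (fr_phi F).

Lemma win_Phi1_sum (M : window F) (I : Type) (r : seq I) (x : I -> M) :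
  (forall i, win_Fil (x i)) ->
  win_Fil (\sum_(i <- r) x i) /\
  win_Phi1 (\sum_(i <- r) x i) = \sum_(i <- r) win_Phi1 (x i).
Proof.
move=> hx; have hF := win_Fil_sub M.
elim: r => [|i r [IH1 IH2]].
  rewrite !big_nil; split; first exact: submodule0.
  have F0 := submodule0 hF.
  by apply: (@addrI _ (win_Phi1 (0 : M))); rewrite -win_Phi1D // !addr0.
by rewrite !big_cons win_Phi1D // IH2; split=> //; apply: submoduleD.
Qed.

Lemma win_Fil_smul (M : window F) a (m : M) : fr_Fil F a -> win_Fil (a *: m).
Proof.
move=> Fa; have [L [N [hL hN [dec _] ->]]] := win_decomp M.
have [l [n [Ll Nn ->]]] := dec m.
exists (a *: l), (a *: n); rewrite scalerDr; split=> //; first exact: submoduleZ.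
by apply: sub_span; exists a, n.
Qed.

(** Generators of [M], projected to [L] and to [N], give a surjection from a graded
    free module. It splits by projectivity, and the conditions on [Phi] and [Phi1] say
    that the linearisation is surjective, hence bijective. *)
Lemma window_presentation (M : window F) :
  exists X i s, @presents p S F M X i s.
Proof.
have [L [N [hL hN LN FilE]]] := win_decomp M.
have [n [gen genE]] := win_fg M.
have [q [Lq Nq qL qN]] := direct_sum_proj hL hN LN.
pose r := (n + n)%N.
pose gr (k : 'I_r) : bool := if split k is inl _ then true else false.
pose x (k : 'I_r) : M :=
  match split k with inl j => q (gen j) | inr j => gen j - q (gen j) end.
have xL k : gr k -> L (x k) by rewrite /gr /x; case: (split k).
have xN k : ~~ gr k -> N (x k) by rewrite /gr /x; case: (split k).
pose s : {linear 'cV[S]_r -> M} := combl x.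
have ssurj m : exists v, s v = m.
  have : span (range gen) m by rewrite genE.
  move=> [k [a [y [hy ->]]]].
  suff h j : exists v, s v = y j.
    have {h} /choice[v vE] := h; exists (\sum_j a j *: v j).
    by rewrite linear_sum; apply: eq_bigr => j _; rewrite linearZ vE.
  have [l _ <-] := hy j; exists (dcol S (lshift n l) + dcol S (rshift n l)).
  rewrite linearD !comb_dcol /x.
  have -> : split (lshift n l) = inl l :> 'I_n + 'I_n.
    by rewrite -[lshift _ _]/(unsplit (inl l)) unsplitK.
  have -> : split (rshift n l) = inr l :> 'I_n + 'I_n.
    by rewrite -[rshift _ _]/(unsplit (inr l)) unsplitK.
  by rewrite addrC subrK.
have [sec secE] := @win_proj _ _ _ M _ _ s idfun ssurj.
(* restricting to the coordinates of one grade makes the section graded *)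
pose D (b : bool) (v : 'cV[S]_r) : 'cV[S]_r := \col_k (if gr k == b then v k 0 else 0).
have DE b a u v : D b (a *: u + v) = a *: D b u + D b v.
  by apply/matrixP => k l; rewrite !mxE; case: ifP => _ //; rewrite mulr0 addr0.
have qs v : q (s v) = s (D true v).
  rewrite !comblE linear_sum; apply: eq_bigr => k _; rewrite linearZ mxE.
  case gk: (gr k) => /=; first by rewrite (qL _ (xL _ gk)).
  by rewrite (qN _ (xN _ (negbT gk))) scaler0 scale0r.
have Dsum v : D true v + D false v = v.
  by apply/matrixP => k l; rewrite !mxE (ord1 l); case: (gr k); rewrite ?addr0 ?add0r.
pose i0 (m : M) := D true (sec (q m)) + D false (sec (m - q m)).
have li : linear i0.
  move=> a u v; rewrite /i0 scalerDr addrACA -!DE -!linearP /=.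
  by rewrite linearP /= opprD addrACA -scalerBr.
have [i iE] : exists i : {linear M -> 'cV[S]_r}, forall m, i m = i0 m.
  by exists (mk_linear li).
have sDf v : s (D false v) = s v - q (s v).
  by rewrite qs -{2}[v]Dsum linearD addrC addKr.
have qq m : q (q m) = q m by apply: qL.
have si m : s (i m) = m.
  rewrite iE /i0 linearD -qs sDf !secE /= qq linearB /= qq subrr subr0.
  by rewrite addrC subrK.
have iL m k : L m -> ~~ gr k -> i m k 0 = 0.
  move=> Lm gk; rewrite iE /i0 (qL _ Lm) subrr linear0 !mxE.
  by rewrite (negbTE gk) /= addr0.
have iN m k : N m -> gr k -> i m k 0 = 0.
  by move=> Nm gk; rewrite iE /i0 (qN _ Nm) linear0 !mxE gk /= addr0.
pose e : 'M[S]_r := mx_of_cols (fun j => i (x j)).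
have eE v : e *m v = i (s v).
  by rewrite mx_of_colsE comblE linear_sum; apply: eq_bigr => k _; rewrite linearZ.
have ee : e *m e = e by apply: mx_col_ext => j; rewrite -mulmxA !eE si.
have eb : blockdiag gr gr e.
  move=> a b ne; rewrite mxE; case gb: (gr b) ne; case ga: (gr a) => // _.
    by apply: iL; rewrite ?ga //; apply: xL.
  by apply: iN => //; apply: xN; rewrite gb.
have FilP m : win_Fil m <-> filmx F gr colL (i m).
  have hF := fr_Fil_ideal F; split=> [|fm].
    rewrite FilE => -[l [u [Ll Nu ->]]] a c na _; rewrite (ord1 c) linearD mxE.
    rewrite (iL _ _ Ll na) add0r; case: Nu => k [b [y [hy ->]]].
    rewrite linear_sum summxE; apply: ideal_sum => // j _.
    have [f [z [Ff Nz ->]]] := hy j.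
    by rewrite !linearZ !mxE; apply: idealMl => //; apply: idealMr.
  rewrite -(si m) comblE.
  apply: submodule_sum; first exact: win_Fil_sub.
  move=> k _; case gk: (gr k).
    apply: submoduleZ; first exact: win_Fil_sub.
    rewrite FilE; exists (x k), 0; rewrite addr0; split=> //; first exact: xL.
    exact: submodule0 (span_submodule _).
  by apply: win_Fil_smul; apply: (fm k 0); rewrite ?gk.
have xFil k : gr k -> win_Fil (x k).
  move=> gk; rewrite FilE; exists (x k), 0; rewrite addr0; split=> //.
    exact: xL.
  exact: submodule0 (span_submodule _).
pose P : 'M[S]_r :=
  mx_of_cols (fun k => i (if gr k then win_Phi1 (x k) else win_Phi M (x k))).
have PPhi m : i (win_Phi M m) = P *m dag F gr colN (i m).
  rewrite -{1}(si m) comblE mx_of_colsE !linear_sum; apply: eq_bigr => k _.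
  rewrite linearZ /= linearZ mxE /dag_entry.
  case gk: (gr k) => //=.
  by rewrite win_Phi_Phi1; [rewrite linearZ scalerA mulrC | exact: xFil].
have PPhi1 m : win_Fil m -> i (win_Phi1 m) = P *m dag F gr colL (i m).
  move=> /FilP fm; rewrite -{1}(si m) comblE mx_of_colsE.
  have ht k : win_Fil (i m k 0 *: x k).
    case gk: (gr k); first by apply: submoduleZ (win_Fil_sub M) (xFil _ gk).
    by apply: win_Fil_smul; apply: (fm k 0); rewrite ?gk.
  have [_ ->] := win_Phi1_sum (index_enum 'I_r) ht.
  rewrite linear_sum; apply: eq_bigr => k _; rewrite mxE /dag_entry.
  case gk: (gr k) => /=; first by rewrite win_Phi1Z ?linearZ //; apply: xFil.
  by rewrite win_Phi1_Phi ?linearZ //; apply: (fm k 0); rewrite ?gk.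
have eP : e *m P = P by apply: mx_col_ext => j; rewrite -mulmxA mx_of_cols_col eE si.
have Pe : P *m map_mx phi e = P.
  rewrite -(dag_blockdiag F eb); apply: mx_col_ext => j.
  have fe := blockdiag_filmx F eb.
  have -> : P *m dag F gr gr e *m dcol S j
      = P *m dag F gr (fun _ : 'I_1 => gr j) (i (x j)).
    rewrite -mulmxA; congr (_ *m _); rewrite -(mx_of_cols_col (fun j => i (x j))).
    by rewrite (dagM fe) ?dag_dcol //; apply: fil_dcol.
  rewrite mx_of_cols_col; case gj: (gr j); last by rewrite -PPhi.
  by rewrite -PPhi1 //; apply: xFil.
have Psurj m : exists v, s (P *m v) = m.
  have [f0 f1] : (forall m, exists v, P *m v = i (win_Phi M m)) /\
      (forall m, win_Fil m -> exists v, P *m v = i (win_Phi1 m)).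
    by split=> [m'|m' /PPhi1 ->]; [rewrite PPhi|]; eexists.
  have : span ((@win_Phi1 _ _ _ M @` @win_Fil _ _ _ M) `|` range (win_Phi M)) m.
    by rewrite win_gen.
  move=> [k [a [y [hy ->]]]].
  have /choice[v vE] : forall j, exists v, s (P *m v) = y j.
    move=> j; case: (hy j) => [[m' Fm' <-]|[m' _ <-]].
      by have [v vE] := f1 _ Fm'; exists v; rewrite vE si.
    by have [v vE] := f0 m'; exists v; rewrite vE si.
  exists (\sum_j a j *: v j); rewrite mulmx_sumr linear_sum.
  by apply: eq_bigr => j _; rewrite -scalemxAr linearZ vE.
have lP : linear (fun v : 'cV[S]_r => s (P *m v)).
  by move=> a u v; rewrite mulmxDr -scalemxAr linearP.
have [t tE] := @win_proj _ _ _ M _ _ (mk_linear lP) idfun Psurj.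
pose Q0 : 'M[S]_r := mx_of_cols (fun j => t (x j)).
have PQ0 : P *m Q0 = e.
  apply: mx_col_ext => j; rewrite -mulmxA !mx_of_cols_col.
  have := tE (x j); rewrite mk_linearE => /(congr1 i).
  by rewrite -eE mulmxA eP.
pose Q := map_mx phi e *m Q0 *m e.
have PQ : P *m Q = e by rewrite /Q !mulmxA Pe PQ0 ee.
have ff : map_mx phi e *m map_mx phi e = map_mx phi e by rewrite -map_mxM ee.
have eQ : map_mx phi e *m Q = Q by rewrite /Q !mulmxA ff.
have Qe : Q *m e = Q by rewrite /Q -!mulmxA ee.
have QP : Q *m P = map_mx phi e.
  by apply: (frobenius_idempotent_rank p_pr (@fr_phi_frob _ _ F) (fr_p_jac F)).
exists (WDatum ee eb eP Pe eQ Qe PQ QP), i, s.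
by split=> //= v; rewrite eE.
Qed.

End PresentationExists.

Section ImageModule.
Variables (S : comPzRingType) (r : nat) (e : 'M[S]_r).

Definition fixed_cols : {pred 'cV[S]_r} := [pred v | e *m v == v].

Let fixed_cols_closed : submod_closed fixed_cols.
Proof.
split=> [|a u v]; rewrite !inE ?mulmx0 // => /eqP eu /eqP ev.
by rewrite mulmxDr -scalemxAr eu ev.
Qed.
HB.instance Definition _ :=
  GRing.isSubmodClosed.Build S 'cV[S]_r fixed_cols
    (GRing.submod_closed_semi fixed_cols_closed).

Definition image_module := {v : 'cV[S]_r | v \in fixed_cols}.
HB.instance Definition _ := SubChoice.on image_module.
HB.instance Definition _ := [SubChoice_isSubLmodule of image_module by <:].

End ImageModule.

Section Realize.
Variables (p : nat) (S : comPzRingType) (F : frame p S) (X : wdatum F).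
Local Notation r := (wr X).
Local Notation gr := (@wgr _ _ _ X).
Local Notation e := (we X).
Local Notation M := (image_module e).

Lemma im_fix (m : M) : e *m \val m = \val m.
Proof. by case: m => v /= /eqP. Qed.

Lemma to_im_fix (v : 'cV[S]_r) : e *m v \in fixed_cols e.
Proof. by rewrite inE mulmxA we_idem. Qed.

Definition of_im (m : M) : 'cV[S]_r := \val m.
Definition to_im (v : 'cV[S]_r) : M := Sub (e *m v) (to_im_fix v).

Lemma of_im_linear : linear of_im.
Proof. by move=> a u v; rewrite /of_im linearP. Qed.
Lemma to_im_linear : linear to_im.
Proof.
move=> a u v; apply: val_inj; rewrite linearP /= mulmxDr -scalemxAr.
by [].
Qed.

Let i : {linear M -> 'cV[S]_r} := mk_linear of_im_linear.
Let s : {linear 'cV[S]_r -> M} := mk_linear to_im_linear.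

Let iinj : injective i. Proof. exact: val_inj. Qed.
Let isE v : i (s v) = e *m v. Proof. by []. Qed.
Let siE m : s (i m) = m. Proof. by apply: iinj; rewrite isE; apply: im_fix. Qed.
Let iE m : e *m i m = i m. Proof. exact: im_fix. Qed.

Definition im_Fil : set M := [set m | filmx F gr colL (i m)].
Definition im_Phi (m : M) : M := s (wP X *m dag F gr colN (i m)).
Definition im_Phi1 (m : M) : M := s (wP X *m dag F gr colL (i m)).

Let iPhi m : i (im_Phi m) = wP X *m dag F gr colN (i m).
Proof. by rewrite isE mulmxA weP. Qed.
Let iPhi1 m : i (im_Phi1 m) = wP X *m dag F gr colL (i m).
Proof. by rewrite isE mulmxA weP. Qed.

Let im_Phi_linear : linear_for (fr_phi F \; *:%R) im_Phi.
Proof.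
move=> a u v; apply: iinj; rewrite [RHS]linearD [X in _ = X + _]linearZ !iPhi linearP /=.
by rewrite dagD // dagZ // mulmxDr -scalemxAr.
Qed.

Let im_fg : @finitely_generated S M.
Proof.
exists r, (fun j => s (dcol S j)); rewrite -subTset => m _.
exists r, (fun j => i m j 0), (fun j => s (dcol S j)).
by split=> [j|]; [exists j | rewrite -linear_col siE].
Qed.

Let im_proj : @projective S M.
Proof.
move=> P Q g f gsurj.
have /choice[x xE] j : exists x, g x = f (s (dcol S j)) by [].
have lh : linear (fun m => combl x (i m)) by move=> a u v; rewrite !linearP.
exists (mk_linear lh) => m; rewrite mk_linearE comblE linear_sum.
rewrite -[in RHS](siE m) (linear_col s) linear_sum.
by apply: eq_bigr => j _; rewrite !linearZ /= xE.
Qed.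

Let im_Fil_sub : submodule im_Fil.
Proof.
split; rewrite /im_Fil /=.
- by rewrite linear0; apply: filmx0.
- by move=> x y hx hy; rewrite linearD; apply: filmxD.
- by move=> a x hx; rewrite linearZ; apply: filmxZ.
Qed.

Let im_Phi1D x y : im_Fil x -> im_Fil y -> im_Phi1 (x + y) = im_Phi1 x + im_Phi1 y.
Proof.
move=> hx hy; apply: iinj.
by rewrite [RHS]linearD !iPhi1 linearD (dagD hx hy) mulmxDr.
Qed.

Let im_Phi1Z a x : im_Fil x -> im_Phi1 (a *: x) = fr_phi F a *: im_Phi1 x.
Proof.
move=> hx; apply: iinj.
by rewrite [RHS]linearZ !iPhi1 linearZ (dagZ _ hx) /= -scalemxAr.
Qed.

Let im_decomp : exists L N : set M,
    [/\ submodule L, submodule N, direct_sum L N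
      & im_Fil = [set m | exists l n,
          [/\ L l, smul_sub (fr_Fil F) N n & m = l + n]]].
Proof.
pose H (b : bool) : set M := [set m | forall k, gr k != b -> i m k 0 = 0].
have hH b : submodule (H b).
  split; rewrite /H /=.
  - by move=> k _; rewrite linear0 mxE.
  - by move=> x y hx hy k kb; rewrite linearD mxE hx ?hy ?addr0.
  - by move=> a x hx k kb; rewrite linearZ mxE hx ?mulr0.
pose D (b : bool) (m : M) : M := s (\col_k (if gr k == b then i m k 0 else 0)).
have iD b m k : i (D b m) k 0 = if gr k == b then i m k 0 else 0.
  rewrite isE mxE; case: eqVneq => gk.
    rewrite -{2}(iE m) mxE; apply: eq_bigr => j _; rewrite mxE.
    by case: eqVneq => // gj; rewrite we_block ?mul0r // gk eq_sym.
  apply: big1 => j _; rewrite mxE; case: eqVneq => gj; last by rewrite mulr0.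
  by rewrite we_block ?mul0r // gj.
have HD b m : H b (D b m) by move=> k kb; rewrite iD (negbTE kb).
have Dsum m : m = D true m + D false m.
  apply: iinj; apply/matrixP => k l; rewrite (ord1 l) linearD mxE !iD.
  by case: (gr k); rewrite ?addr0 ?add0r.
exists (H true), (H false); split=> //.
  split; first by move=> m; exists (D true m), (D false m).
  apply/seteqP; split=> [m [h1 h0]|_ ->]; last by split; apply: submodule0.
  apply: iinj; rewrite linear0; apply/matrixP => k l; rewrite (ord1 l) [RHS]mxE.
  by case gk: (gr k); [apply: h0 | apply: h1]; rewrite gk.
apply/seteqP; split=> m.
  move=> fm; exists (D true m), (D false m); split=> //.
  rewrite -(siE (D false m)) linear_col.
  exists r, (fun=> 1), (fun j => i (D false m) j 0 *: s (dcol S j)).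
  split; last by apply: eq_bigr => j _; rewrite scale1r.
  move=> j; case gj: (gr j).
    exists 0, 0; split; [exact: ideal0 (fr_Fil_ideal F) | exact: submodule0 |].
    by rewrite iD gj /= scale0r scaler0.
  exists (i (D false m) j 0), (s (dcol S j)); split=> //.
    by rewrite iD gj; apply: fm; rewrite ?gj.
  move=> k gk; rewrite isE mul_dcol mxE we_block // gj.
  by case: (gr k) gk.
have hF := fr_Fil_ideal F.
move=> [l [n [hl hn ->]]] k c gk _; rewrite (ord1 c) linearD mxE.
rewrite (hl k) ?add0r; last by case: (gr k) gk.
case: hn => q [a [y [hy ->]]]; rewrite linear_sum summxE; apply: ideal_sum => // j _.
have [f [z [Ff Hz ->]]] := hy j; rewrite !linearZ !mxE.
by apply: idealMl => //; apply: idealMr.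
Qed.

Let im_Phi1_Phi a m : fr_Fil F a -> im_Phi1 (a *: m) = fr_phi1 F a *: im_Phi m.
Proof.
move=> Fa; apply: iinj; rewrite [RHS]linearZ /= iPhi iPhi1 linearZ /=.
have -> : a *: i m = i m *m (a%:M : 'M_1) by rewrite mul_mx_scalar.
rewrite (dagM (gk := colN)) //; last by move=> ? ? _ _; rewrite !ord1 mxE eqxx.
rewrite mulmxA (_ : dag _ _ _ a%:M = (fr_phi1 F a)%:M) ?mul_mx_scalar //.
by apply/matrixP => ? ?; rewrite !mxE !ord1 /= /dag_entry.
Qed.

Let im_Phi_Phi1 m : im_Fil m -> im_Phi m = fr_varpi F *: im_Phi1 m.
Proof.
move=> Fm; apply: iinj; rewrite [RHS]linearZ /= iPhi iPhi1.
rewrite -[i m in LHS]mulmx1 (dagM (gk := colL)) //.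
rewrite mulmxA (_ : dag _ _ _ 1%:M = (fr_varpi F)%:M) ?mul_mx_scalar //.
by apply/matrixP => ? ?; rewrite !mxE !ord1 /= /dag_entry /= rmorph1 mulr1.
Qed.

Let im_gen : span ((im_Phi1 @` im_Fil) `|` range im_Phi) = setT.
Proof.
rewrite -subTset => m _.
have -> : m = \sum_j (wQ X *m i m) j 0 *: s (wP X *m dcol S j).
  apply: iinj; have h : i m = wP X *m (wQ X *m i m) by rewrite mulmxA wPQ iE.
  rewrite [LHS]h [wQ X *m _ in LHS]col_sum.
  rewrite mulmx_sumr linear_sum; apply: eq_bigr => j _.
  by rewrite [RHS]linearZ isE mulmxA weP -scalemxAr.
exists r, (fun j => (wQ X *m i m) j 0), (fun j => s (wP X *m dcol S j)).
split=> // j; rewrite wP_dcol.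
case gj: (gr j); [left; exists (s (dcol S j)) | right; exists (s (dcol S j))] => //.
rewrite /im_Fil /= isE.
by apply: filmxM (blockdiag_filmx F (@we_block _ _ _ X)) _; apply: fil_dcol.
Qed.

Definition im_window : window F :=
  @Window p S F M im_Fil (mk_linear im_Phi_linear) im_Phi1 im_fg im_proj im_Fil_sub
    im_Phi1D im_Phi1Z im_decomp im_Phi1_Phi im_Phi_Phi1 im_gen.

(** The window is the image of the idempotent in the free module. *)
Lemma datum_realized : exists (W : window F) i s, @presents p S F W X i s.
Proof. by exists im_window, i, s; split. Qed.

End Realize.

(** * Base change in coordinates and a criterion for crystallinity *)

Section Equivalence.
Variables (C D : category) (T : functor C D).
Hypothesis faithful : forall (X Y : C) (f g : hom X Y), fmap T f = fmap T g -> f = g.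
Hypothesis full : forall (X Y : C) (g : hom (T X) (T Y)), exists f : hom X Y, fmap T f = g.
Hypothesis ess_surj : forall Y : D, exists (X : C) (f : hom (T X) Y), is_iso f.

Let iso_data (Y : D) : { X : C & { f : hom (T X) Y & { g : hom Y (T X) |
  compm g f = idm (T X) /\ compm f g = idm Y } } }.
Proof.
have /cid[X /cid[f fiso]] := ess_surj Y.
by have [g fg] := cid fiso; exists X, f, g.
Qed.

Let G0 (Y : D) : C := projT1 (iso_data Y).
Let u (Y : D) : hom (T (G0 Y)) Y := projT1 (projT2 (iso_data Y)).
Let v (Y : D) : hom Y (T (G0 Y)) := sval (projT2 (projT2 (iso_data Y))).
Let vu Y : compm (v Y) (u Y) = idm (T (G0 Y)).
Proof. by case: (svalP (projT2 (projT2 (iso_data Y)))). Qed.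
Let uv Y : compm (u Y) (v Y) = idm Y.
Proof. by case: (svalP (projT2 (projT2 (iso_data Y)))). Qed.

Let pre (X Y : C) (g : hom (T X) (T Y)) : hom X Y := sval (cid (full g)).
Let preE (X Y : C) (g : hom (T X) (T Y)) : fmap T (pre g) = g.
Proof. by rewrite /pre; case: cid. Qed.

Let Gm (X Y : D) (f : hom X Y) : hom (G0 X) (G0 Y) :=
  pre (compm (v Y) (compm f (u X))).

Let G1 X : Gm (idm X) = idm (G0 X).
Proof. by apply: faithful; rewrite preE fmap1 comp1m vu. Qed.

Let GM (X Y Z : D) (g : hom Y Z) (f : hom X Y) :
  Gm (compm g f) = compm (Gm g) (Gm f).
Proof.
apply: faithful; rewrite fmapM !preE -!compA; congr compm; congr compm.
by rewrite (compA (u Y)) uv comp1m.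
Qed.

Lemma equivalence_of_ff_es : is_equivalence T.
Proof.
exists (@Functor D C G0 Gm G1 GM); split.
  exists (fun X => pre (u (T X))); split.
    move=> X; exists (pre (v (T X))); split; apply: faithful.
      by rewrite fmapM !preE vu fmap1.
    by rewrite fmapM !preE uv fmap1.
  move=> X Y f; apply: faithful; rewrite !fmapM !preE /=.
  by rewrite compA uv comp1m.
exists u; split; first by move=> Y; exists (v Y); split; [exact: vu | exact: uv].
by move=> X Y f /=; rewrite preE compA uv comp1m.
Qed.

End Equivalence.

Section BaseChangeData.
Variables (p : nat) (S S' : comPzRingType) (F : frame p S) (F' : frame p S').
Variables (c : S') (alpha : {rmorphism S -> S'}).
Hypothesis alphaP : frame_hom F F' c alpha.
Variable ci : S'.
Hypothesis cci : c * ci = 1.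

(** Base change multiplies [Phi1] by [c] and leaves [Phi] unchanged: the columns of
    [wP] of grade [L] are multiplied by [c]. *)
Definition tw_entry (a : S') (b : bool) : S' := if b then a else 1.

Definition tw (a : S') n (gr : 'I_n -> bool) : 'M[S']_n :=
  diag_mx (\row_i tw_entry a (gr i)).

Lemma twE a n m (gr : 'I_n -> bool) (X : 'M_(n, m)) i j :
  (tw a gr *m X) i j = tw_entry a (gr i) * X i j.
Proof. by rewrite mul_diag_mx !mxE. Qed.

Lemma Etw a n m (gr : 'I_n -> bool) (X : 'M_(m, n)) i j :
  (X *m tw a gr) i j = X i j * tw_entry a (gr j).
Proof. by rewrite mul_mx_diag !mxE. Qed.

Lemma twK a b n (gr : 'I_n -> bool) : a * b = 1 -> tw a gr *m tw b gr = 1%:M.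
Proof.
move=> ab; apply/matrixP => i j; rewrite twE !mxE /tw_entry.
by case: eqVneq => [->|]; rewrite ?mulr0n ?mulr0 // ?mulr1n; case: (gr _); rewrite ?mul1r.
Qed.

Lemma twKl n (gr : 'I_n -> bool) : tw c gr *m tw ci gr = 1%:M.
Proof. exact: twK. Qed.
Lemma twKr n (gr : 'I_n -> bool) : tw ci gr *m tw c gr = 1%:M.
Proof. by apply: twK; rewrite mulrC. Qed.

Lemma map_filmx m n gr gc (X : 'M_(m, n)) :
  filmx F gr gc X -> filmx F' gr gc (map_mx alpha X).
Proof.
case: alphaP => _ [_ hF _ _] hX i j bi bj; rewrite mxE.
by apply: hF; exists (X i j) => //; apply: hX.
Qed.

(** The constant [c] is absorbed by conjugation with the diagonal matrices [tw c]. *)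
Lemma dag_map m n gr gc (X : 'M_(m, n)) : filmx F gr gc X ->
  tw c gr *m dag F' gr gc (map_mx alpha X) = map_mx alpha (dag F gr gc X) *m tw c gc.
Proof.
case: alphaP => _ [hphi hF hphi1 hvarpi] hX; apply/matrixP => i j.
rewrite twE Etw !mxE; have := hX i j; rewrite /tw_entry /dag_entry /fil_entry.
case: (gr i); case: (gc j) => h /=; rewrite ?mulr1 ?mul1r ?hphi //.
- exact: mulrC.
- by rewrite rmorphM hvarpi mulrA.
- by rewrite hphi1 1?mulrC //; apply: h.
Qed.

Lemma map_phi m n (X : 'M_(m, n)) :
  map_mx (fr_phi F') (map_mx alpha X) = map_mx alpha (map_mx (fr_phi F) X).
Proof. by case: alphaP => _ [hphi _ _ _]; apply/matrixP => i j; rewrite !mxE hphi. Qed.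

Section OneDatum.
Variable X : wdatum F.
Local Notation gr := (@wgr _ _ _ X).

Let e' := map_mx alpha (we X).
Let P' := map_mx alpha (wP X) *m tw c gr.
Let Q' := tw ci gr *m map_mx alpha (wQ X).

Let eb' : blockdiag gr gr e'.
Proof. by move=> i j ne; rewrite mxE we_block // rmorph0. Qed.

Let tw_phie : tw c gr *m map_mx (fr_phi F') e' = map_mx (fr_phi F') e' *m tw c gr.
Proof.
rewrite -[in LHS](dag_blockdiag F' eb') dag_map; last first.
  exact/blockdiag_filmx/we_block.
by rewrite dag_blockdiag ?map_phi //; apply: we_block.
Qed.

Let tw_phie' : map_mx (fr_phi F') e' *m tw ci gr = tw ci gr *m map_mx (fr_phi F') e'.
Proof.
rewrite -[LHS]mul1mx -(twKr gr) -mulmxA; congr (_ *m _).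
by rewrite mulmxA tw_phie -mulmxA twKl mulmx1.
Qed.

Let ee' : e' *m e' = e'. Proof. by rewrite -map_mxM we_idem. Qed.
Let eP' : e' *m P' = P'. Proof. by rewrite mulmxA -map_mxM weP. Qed.
Let Pe' : P' *m map_mx (fr_phi F') e' = P'.
Proof. by rewrite -mulmxA tw_phie mulmxA map_phi -map_mxM wPe. Qed.
Let eQ' : map_mx (fr_phi F') e' *m Q' = Q'.
Proof. by rewrite mulmxA tw_phie' -mulmxA map_phi -map_mxM weQ. Qed.
Let Qe' : Q' *m e' = Q'. Proof. by rewrite -mulmxA -map_mxM wQe. Qed.
Let PQ' : P' *m Q' = e'.
Proof. by rewrite -mulmxA (mulmxA (tw c gr)) twKl mul1mx -map_mxM wPQ. Qed.
Let QP' : Q' *m P' = map_mx (fr_phi F') e'.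
Proof.
rewrite -mulmxA (mulmxA (map_mx alpha (wQ X))) -map_mxM wQP -map_phi.
by rewrite mulmxA -tw_phie' -mulmxA twKr mulmx1.
Qed.

Definition bc : wdatum F' := WDatum ee' eb' eP' Pe' eQ' Qe' PQ' QP'.
End OneDatum.

Lemma bc_dhom X Y G : @dhom _ _ F X Y G -> @dhom _ _ F' (bc X) (bc Y) (map_mx alpha G).
Proof.
case=> el er fG GP; split.
- by rewrite -map_mxM el.
- by rewrite -map_mxM er.
- exact: map_filmx.
- by rewrite /= mulmxA -map_mxM GP map_mxM -!mulmxA (dag_map fG).
Qed.

Hypothesis p_pr : prime p.

Let pres (M : window F) : { X : wdatum F &
  { i : {linear M -> 'cV[S]_(wr X)} &
  { s : {linear 'cV[S]_(wr X) -> M} | presents i s } } }.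
Proof. by have /cid[X /cid[i /cid[s h]]] := window_presentation p_pr M; exists X, i, s. Qed.

Let wX (M : window F) := projT1 (pres M).
Let wi (M : window F) : {linear M -> 'cV[S]_(wr (wX M))} := projT1 (projT2 (pres M)).
Let ws (M : window F) : {linear 'cV[S]_(wr (wX M)) -> M} := sval (projT2 (projT2 (pres M))).
Let wpres (M : window F) : presents (@wi M) (@ws M).
Proof. exact: svalP (projT2 (projT2 (pres M))). Qed.

Let real (X : wdatum F') : { M : window F' &
  { i : {linear M -> 'cV[S']_(wr X)} &
  { s : {linear 'cV[S']_(wr X) -> M} | presents i s } } }.
Proof. by have /cid[M /cid[i /cid[s h]]] := datum_realized X; exists M, i, s. Qed.

Let T0 (M : window F) : window F' := projT1 (real (bc (wX M))).
Let ti (M : window F) : {linear T0 M -> 'cV[S']_(wr (wX M))} := projT1 (projT2 (real (bc (wX M)))).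
Let ts (M : window F) : {linear 'cV[S']_(wr (wX M)) -> T0 M} :=
  sval (projT2 (projT2 (real (bc (wX M))))).
Let tpres (M : window F) : @presents _ _ F' (T0 M) (bc (wX M)) (@ti M) (@ts M).
Proof. exact: svalP (projT2 (projT2 (real (bc (wX M))))). Qed.

Let Tm (M N : window F) (h : window_hom M N) : window_hom (T0 M) (T0 N) :=
  sval (cid (hom_of_mx (tpres M) (tpres N) (bc_dhom (hom_mx_dhom (wpres M) (wpres N) h)))).

Let TmE (M N : window F) (h : window_hom M N) m :
  @ti N (Tm h m) = map_mx alpha (hom_mx (@ws M) (@wi N) h) *m @ti M m.
Proof. by rewrite /Tm; case: cid. Qed.

Let T1 (M : window F) : Tm (window_id M) = window_id (T0 M).
Proof.
apply: window_hom_eq => m; apply: (pr_inj (tpres M)); rewrite TmE.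
rewrite (_ : hom_mx _ _ _ = we (wX M)); first exact: (pr_ei (tpres M)).
apply: mx_col_ext => j; rewrite mx_of_cols_col; exact: (pr_is (wpres M)).
Qed.

Let TM (M N K : window F) (g : window_hom N K) (f : window_hom M N) :
  Tm (window_comp g f) = window_comp (Tm g) (Tm f).
Proof.
apply: window_hom_eq => m; apply: (pr_inj (tpres K)); rewrite TmE /= !TmE.
rewrite mulmxA -map_mxM; congr (map_mx alpha _ *m _).
apply: mx_col_ext => j; rewrite -mulmxA !mx_of_cols_col.
by rewrite (hom_mx_i (wpres N)).
Qed.

Let T : functor (Win F) (Win F') := @Functor (Win F) (Win F') T0 Tm T1 TM.

Let f_fun (M : window F) (m : M) : T0 M := @ts M (map_mx alpha (@wi M m)).

Let f_linear (M : window F) : linear_for (alpha \; *:%R) (@f_fun M).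
Proof.
by move=> a u v; rewrite /f_fun linearP map_mxD map_mxZ linearP.
Qed.

Let f (M : window F) : {linear M -> T0 M | alpha \; *:%R} := mk_linear (@f_linear M).

Let fE (M : window F) m : @ti M (f M m) = map_mx alpha (@wi M m).
Proof.
by rewrite mk_linearE (pr_is (tpres M)) -map_mxM (pr_ei (wpres M)).
Qed.

Let f_dcol (M : window F) j : f M (@ws M (dcol S j)) = @ts M (dcol S' j).
Proof.
apply: (pr_inj (tpres M)); rewrite fE (pr_is (wpres M)) (pr_is (tpres M)).
rewrite map_mxM; congr (_ *m _); apply/matrixP => a b.
by rewrite !mxE rmorph_nat.
Qed.

Let t_dcol (M : window F) m : m = \sum_j @ti M m j 0 *: @ts M (dcol S' j).
Proof. by rewrite -linear_col (pr_si (tpres M)). Qed.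

Let f_ext (M : window F) : extension_of_scalars (f M).
Proof.
move=> P g; have lh : linear (fun m => combl (fun j => g (@ws M (dcol S j))) (@ti M m)).
  by move=> a u v; rewrite !linearP.
exists (mk_linear lh); split=> [m|h' hE m].
  rewrite mk_linearE fE comblE -{2}(pr_si (wpres M) m) (linear_col (@ws M)).
  by rewrite linear_sum; apply: eq_bigr => j _; rewrite linearZ mxE.
rewrite mk_linearE comblE [in LHS](t_dcol m) linear_sum.
by apply: eq_bigr => j _; rewrite linearZ -f_dcol hE.
Qed.

Let f_Fil (M : window F) : @win_Fil _ _ _ (T0 M) =
  span ([set m | exists s x, fr_Fil F' s /\ m = s *: x] `|` f M @` @win_Fil _ _ _ M).
Proof.
apply/seteqP; split=> m.
  move=> /(pr_Fil (tpres M)) fm; rewrite (t_dcol m).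
  apply: submodule_sum => [|j _]; first exact: span_submodule.
  case gj: (@wgr _ _ _ (wX M) j).
    apply: submoduleZ; first exact: span_submodule.
    apply: sub_span; right; exists (@ws M (dcol S j)); last exact: f_dcol.
    apply/(pr_Fil (wpres M)); rewrite (pr_is (wpres M)).
    by apply: filmxM (blockdiag_filmx F (@we_block _ _ _ _)) _; apply: fil_dcol.
  apply: sub_span; left; exists (@ti M m j 0), (@ts M (dcol S' j)); split=> //.
  by apply: (fm j 0); rewrite //= gj.
apply: span_min; first exact: win_Fil_sub.
move=> {}m [[a [x [Fa ->]]]|[x Fx <-]]; first exact: win_Fil_smul.
apply/(pr_Fil (tpres M)); rewrite fE; apply: map_filmx.
exact/(pr_Fil (wpres M)).
Qed.

Let f_Phi (M : window F) m : win_Phi (T0 M) (f M m) = f M (win_Phi M m).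
Proof.
apply: (pr_inj (tpres M)); rewrite (pr_Phi (tpres M)) !fE (pr_Phi (wpres M)) /=.
rewrite -mulmxA dag_map // map_mxM; congr (_ *m _).
by rewrite (_ : tw c colN = 1%:M) ?mulmx1 //; apply/matrixP => a b; rewrite !mxE.
Qed.

Let f_Phi1 (M : window F) m : win_Fil m -> win_Phi1 (f M m) = c *: f M (win_Phi1 m).
Proof.
move=> Fm; have Fm' := Fm; move/(pr_Fil (wpres M)): Fm' => fm.
apply: (pr_inj (tpres M)); rewrite [RHS]linearZ (pr_Phi1 (tpres M)); last first.
  by apply/(pr_Fil (tpres M)); rewrite fE; apply: map_filmx.
rewrite !fE (pr_Phi1 (wpres M)) //= -mulmxA dag_map // map_mxM scalemxAr; congr (_ *m _).
rewrite (_ : tw c colL = c%:M) ?mul_mx_scalar //.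
by apply/matrixP => a b; rewrite !mxE.
Qed.

Let f_nat (M N : window F) (g : window_hom M N) m : Tm g (f M m) = f N (g m).
Proof.
apply: (pr_inj (tpres N)); rewrite TmE !fE -map_mxM; congr map_mx.
exact: (hom_mx_i (wpres M)).
Qed.

Hypothesis full : forall X Y G', @dhom _ _ F' (bc X) (bc Y) G' ->
  exists2 G, @dhom _ _ F X Y G & map_mx alpha G = G'.
Hypothesis faithful : forall X Y G1 G2, @dhom _ _ F X Y G1 -> @dhom _ _ F X Y G2 ->
  map_mx alpha G1 = map_mx alpha G2 -> G1 = G2.
Hypothesis ess_surj : forall Y : wdatum F', exists X G G',
  [/\ @dhom _ _ F' (bc X) Y G, @dhom _ _ F' Y (bc X) G',
      G *m G' = we Y & G' *m G = we (bc X)].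

Let T_faithful (M N : window F) (g h : window_hom M N) : Tm g = Tm h -> g = h.
Proof.
move=> e; suff e' : hom_mx (@ws M) (@wi N) g = hom_mx (@ws M) (@wi N) h.
  apply: window_hom_eq => m; apply: (pr_inj (wpres N)).
  by rewrite -!(hom_mx_i (wpres M)) e'.
apply: faithful; [exact: hom_mx_dhom..|].
apply: mx_col_ext => j.
have hr (k : window_hom M N) : map_mx alpha (hom_mx (@ws M) (@wi N) k) *m dcol S' j = @ti N (Tm k (@ts M (dcol S' j))).
  have [_ er _ _] := bc_dhom (hom_mx_dhom (wpres M) (wpres N) k).
  by rewrite TmE (pr_is (tpres M)) mulmxA er.
by rewrite !hr e.
Qed.

Let T_full (M N : window F) (g : window_hom (T0 M) (T0 N)) :
  exists h : window_hom M N, Tm h = g.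
Proof.
have [G dG GE] := full (hom_mx_dhom (tpres M) (tpres N) g).
have [h hE] := hom_of_mx (wpres M) (wpres N) dG.
exists h; apply: window_hom_eq => m; apply: (pr_inj (tpres N)).
rewrite TmE (_ : hom_mx _ _ h = G); last first.
  case: dG => _ er _ _; apply: mx_col_ext => j.
  by rewrite mx_of_cols_col hE (pr_is (wpres M)) mulmxA er.
rewrite GE; exact: (hom_mx_i (tpres M)).
Qed.

Let T_es (N : window F') : exists (M : window F) (g : hom (T M) (N : Win F')), is_iso g.
Proof.
have [Y [iN [sN hN]]] := window_presentation p_pr N.
have [X [G [G' [dG dG' GG' G'G]]]] := ess_surj Y.
have [M [iM [sM hM]]] := datum_realized X.
(* the coordinates chosen for M may differ from those given by X *)
pose V := hom_mx sM (@wi M) idfun; pose V' := hom_mx (@ws M) iM idfun.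
have dV : dhom V := hom_mx_dhom hM (wpres M) (window_id M).
have dV' : dhom V' := hom_mx_dhom (wpres M) hM (window_id M).
have VV' : V *m V' = we (wX M).
  apply: mx_col_ext => j; rewrite -mulmxA mx_of_cols_col /= (hom_mx_i hM).
  exact: (pr_is (wpres M)).
have V'V : V' *m V = we X.
  apply: mx_col_ext => j; rewrite -mulmxA mx_of_cols_col /= (hom_mx_i (wpres M)).
  exact: (pr_is hM).
have comp (A B C : wdatum F') H K : @dhom _ _ F' B C H -> @dhom _ _ F' A B K ->
    @dhom _ _ F' A C (H *m K).
  move=> [hl hr hf hP] [kl kr kf kP]; split.
  - by rewrite mulmxA hl.
  - by rewrite -mulmxA kr.
  - exact: filmxM hf kf.
  - by rewrite -mulmxA kP mulmxA hP -mulmxA -(dagM hf kf).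
have [W [W' [dW dW' WW' W'W]]] : exists W W',
    [/\ @dhom _ _ F' (bc X) (bc (wX M)) W, @dhom _ _ F' (bc (wX M)) (bc X) W',
        W *m W' = we (bc (wX M)) & W' *m W = we (bc X)].
  exists (map_mx alpha V), (map_mx alpha V').
  split; [exact: bc_dhom | exact: bc_dhom | |].
    by rewrite -map_mxM VV'.
  by rewrite -map_mxM V'V.
have dH := comp _ _ _ _ _ dG dW'.
have dK := comp _ _ _ _ _ dW dG'.
have [h hE] := hom_of_mx (tpres M) hN dH.
have [k kE] := hom_of_mx hN (tpres M) dK.
have [_ Wr _ _] := dW; have [_ Gr _ _] := dG.
exists M, h, k; split; apply: window_hom_eq => m /=.
  apply: (pr_inj (tpres M)); rewrite kE hE mulmxA -(mulmxA W) (mulmxA G') G'G.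
  by rewrite (mulmxA W) Wr WW'; apply: (pr_ei (tpres M)).
apply: (pr_inj hN); rewrite hE kE mulmxA -(mulmxA G) (mulmxA W') W'W.
by rewrite (mulmxA G) Gr GG'; apply: (pr_ei hN).
Qed.

(** The base change of a window is the realisation of the base change of coordinates,
    with [m |-> alpha (coordinates of m)] as the universal semilinear map; hence [alpha]
    is crystalline as soon as the functor on coordinates is an equivalence. *)
Lemma crystalline_criterion : crystalline F F' c alpha.
Proof.
split=> //; exists T; split.
  exists f; split=> [M|M N g m]; first by split; [exact: f_ext | exact: f_Fil | exact: f_Phi | exact: f_Phi1].
  exact: f_nat.
by apply: equivalence_of_ff_es; [exact: T_faithful | exact: T_full | exact: T_es].
Qed.

End BaseChangeData.

(** * Complete rings *)

Section IdealPowers.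
Variables (A : comPzRingType) (I : set A) (hI : ideal I).

Lemma ideal_gen_ideal (X : set A) : ideal (ideal_gen X).
Proof. exact: span_submodule. Qed.

Lemma sub_ideal_gen (X : set A) : X `<=` ideal_gen X.
Proof. exact: (@sub_span A A^o). Qed.

Lemma ideal_gen_min (X J : set A) : ideal J -> X `<=` J -> ideal_gen X `<=` J.
Proof. exact: (@span_min A A^o). Qed.

Lemma ideal_pow_ideal n : ideal (ideal_pow I n).
Proof. exact: ideal_gen_ideal. Qed.

Lemma ideal_powMS n x y : I x -> ideal_pow I n y -> ideal_pow I n.+1 (x * y).
Proof.
move=> Ix; move: y.
apply: (@ideal_gen_min _ [set y | ideal_pow I n.+1 (x * y)]).
  have h := ideal_pow_ideal n.+1; apply: idealP => [|y z|a y] /=.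
  - by rewrite mulr0; apply: ideal0.
  - by rewrite mulrDr; apply: idealD.
  - by rewrite mulrCA; apply: idealMl.
move=> _ [f [If ->]]; apply: sub_ideal_gen.
exists (fun i => if unlift ord0 i is Some j then f j else x); split.
  by move=> i; case: unliftP => [j _|_] //; apply: If.
rewrite big_ord_recl unlift_none; congr (_ * _).
by apply: eq_bigr => i _; rewrite liftK.
Qed.

Lemma ideal_powS n x : ideal_pow I n.+1 x -> ideal_pow I n x.
Proof.
move: x; apply: ideal_gen_min; first exact: ideal_pow_ideal.
move=> _ [f [If ->]]; rewrite big_ord_recl; apply: idealMl; first exact: ideal_pow_ideal.
by apply: sub_ideal_gen; exists (fun i => f (lift ord0 i)).
Qed.

Lemma ideal_pow_sub n x : ideal_pow I n.+1 x -> I x.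
Proof.
move: x; apply: ideal_gen_min => // _ [f [If ->]].
by rewrite big_ord_recl; apply: idealMr.
Qed.

Lemma ideal_pow0 x : ideal_pow I 0 x.
Proof.
rewrite -[x]mulr1; apply: idealMl; first exact: ideal_pow_ideal.
by apply: sub_ideal_gen; exists (fun=> 0); split; [case|rewrite big_ord0].
Qed.

Lemma ideal_powX n x : I x -> ideal_pow I n (x ^+ n).
Proof.
move=> Ix; elim: n => [|n IH]; first exact: ideal_pow0.
by rewrite exprS; apply: ideal_powMS.
Qed.

End IdealPowers.

Section RegularSequence.
Variables (A : comPzRingType) (a b : A).
Local Notation I := (ideal_gen [set a; b]).
Hypothesis complete : adic_complete I.
Hypothesis a_reg : forall x, a * x = 0 -> x = 0.
Hypothesis b_reg : forall x, principal a (b * x) -> principal a x.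

Lemma gen2a : I a. Proof. by apply: sub_ideal_gen; left. Qed.
Lemma gen2b : I b. Proof. by apply: sub_ideal_gen; right. Qed.

Lemma gen2P x : I x -> exists u v, x = a * u + b * v.
Proof.
move: x; apply: ideal_gen_min; last first.
  move=> x [->|->]; [exists 1, 0 | exists 0, 1]; by rewrite !mulr0 mulr1 ?addr0 ?add0r.
apply: idealP.
- by exists 0, 0; rewrite !mulr0 addr0.
- by move=> _ _ [u [v ->]] [u' [v' ->]]; exists (u + u'), (v + v'); rewrite !mulrDr addrACA.
- by move=> c _ [u [v ->]]; exists (c * u), (c * v); rewrite mulrDr !(mulrCA c).
Qed.

(** A product of [m] elements [a u + b v] is congruent to a multiple of [b^m]. *)
Lemma gen2_pow_sub m x : ideal_pow I m x -> exists u v, x = a * u + b ^+ m * v.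
Proof.
move: x; apply: ideal_gen_min.
  apply: idealP.
  - by exists 0, 0; rewrite !mulr0 addr0.
  - move=> _ _ [u [v ->]] [u' [v' ->]]; exists (u + u'), (v + v').
    by rewrite !mulrDr addrACA.
  - by move=> c _ [u [v ->]]; exists (c * u), (c * v); rewrite mulrDr !(mulrCA c).
move=> _ [f [If ->]]; elim: m f If => [|m IH] f If.
  by exists 0, 1; rewrite big_ord0 mulr0 add0r mulr1.
rewrite big_ord_recl.
have [u [v ->]] := IH (fun i => f (lift ord0 i)) (fun i => If _).
have [u' [v' ->]] := gen2P (If ord0).
exists (u' * (a * u + b ^+ m * v) + b * v' * u), (v' * v).
by rewrite exprS; ring.
Qed.

Lemma gen2_sep x : (forall n, ideal_pow I n x) -> x = 0.
Proof.
move=> hx; have [|z [_ zu]] := complete (x := fun=> 0).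
  by move=> n; rewrite subrr; apply: ideal0 (ideal_pow_ideal _ _).
rewrite -(zu x) ?(zu 0) // => n; rewrite subr0 //.
exact: ideal0 (ideal_pow_ideal _ _).
Qed.

Lemma gen2_lim (t : nat -> A) (s : A) : I s ->
  exists x, forall n, ideal_pow I n (x - \sum_(i < n) s ^+ i * t i).
Proof.
move=> Is; have [|x [xE _]] := complete (x := fun n => \sum_(i < n) s ^+ i * t i).
  move=> n /=; rewrite big_ord_recr /=. rewrite addrAC subrr add0r.
  by apply: idealMr (ideal_pow_ideal _ _) _; apply: ideal_powX.
by exists x.
Qed.

Lemma b_pow_reg n x : principal a (b ^+ n * x) -> principal a x.
Proof.
elim: n => [|n IH]; first by rewrite expr0 mul1r.
by rewrite exprS -mulrA => /b_reg.
Qed.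

(** The quotient [A/a] is [b]-adically separated: the quotients [u m] in
    [x = a (u0 m) + b^m (u m)] are compatible modulo [a], so that the [u0 m] converge
    after division by [a]. *)
Lemma quotient_sep x : (forall m, exists u v, x = a * u + b ^+ m * v) -> principal a x.
Proof.
move=> hx; have /choice[u0 h0] := hx; have /choice[u uE] := h0 => {hx h0}.
have /choice[t tE] m : exists t, u m = b * u m.+1 + a * t.
  have : principal a (b ^+ m * (u m - b * u m.+1)).
    exists (u0 m.+1 - u0 m) => //.
    have /eqP := uE m.+1; rewrite {1}(uE m) exprS -subr_eq0 => /eqP e.
    by apply/eqP; rewrite -subr_eq0 -oppr0 -e; apply/eqP; ring.
  by move=> /b_pow_reg/principalP[t e]; exists t; rewrite -e addrC subrK.
have u0E m : u0 m.+1 = u0 m + b ^+ m * t m.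
  apply/eqP; rewrite -subr_eq0; apply/eqP; apply: a_reg.
  have /eqP := uE m.+1; rewrite (uE m) tE exprS -subr_eq0 => /eqP e.
  by rewrite -oppr0 -e; ring.
have u0S m : u0 m = u0 0%N + \sum_(i < m) b ^+ i * t i.
  elim: m => [|m IH]; first by rewrite big_ord0 addr0.
  by rewrite u0E IH big_ord_recr /= addrA.
have [v vE] := gen2_lim t gen2b.
suff -> : x = a * (u0 0%N + v) by exists (u0 0%N + v).
apply/eqP; rewrite -subr_eq0; apply/eqP/gen2_sep => n.
rewrite {1}(uE n) u0S.
have -> : a * (u0 0%N + \sum_(i < n) b ^+ i * t i) + b ^+ n * u n - a * (u0 0%N + v)
    = b ^+ n * u n - a * (v - \sum_(i < n) b ^+ i * t i) by ring.
apply: idealB (ideal_pow_ideal _ _) _ _.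
  by apply: idealMr (ideal_pow_ideal _ _) _; apply: ideal_powX gen2b.
exact: idealMl (ideal_pow_ideal _ _) (vE n).
Qed.

Lemma a_sep x : (forall n, principal (a ^+ n) x) -> x = 0.
Proof.
move=> hx; apply: gen2_sep => n; have [y ->] := principalP (hx n).
by apply: idealMr (ideal_pow_ideal _ _) _; apply: ideal_powX gen2a.
Qed.

(** The [(a, b)]-adic limit is [a]-adic, because the tail of the series divided by
    [a^n] converges as well. *)
Lemma a_lim (t : nat -> A) : exists x, forall n, principal (a ^+ n) (x - \sum_(i < n) a ^+ i * t i).
Proof.
have [x xE] := gen2_lim t gen2a.
exists x => n; have [y yE] := gen2_lim (fun i => t (n + i)%N) gen2a.
suff -> : x - \sum_(i < n) a ^+ i * t i = a ^+ n * y by exact: principalM.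
apply/eqP; rewrite -subr_eq0; apply/eqP/gen2_sep => m.
have h : forall k, ideal_pow I (m + k) `<=` ideal_pow I m.
  by elim=> [|k IH] z; rewrite ?addn0 // addnS => /ideal_powS/IH.
have -> : x - \sum_(i < n) a ^+ i * t i - a ^+ n * y
    = (x - \sum_(i < m + n) a ^+ i * t i) - a ^+ n * (y - \sum_(i < m) a ^+ i * t (n + i)%N).
  rewrite (addnC m) big_split_ord /= mulrBr mulr_sumr.
  under [X in _ = _ - (_ - X)]eq_bigr do rewrite mulrA -exprD.
  by ring.
apply: idealB (ideal_pow_ideal _ _) _ _; first exact: h (xE _).
exact: idealMl (ideal_pow_ideal _ _) (yE m).
Qed.

Lemma b_reg_strong x : b * x = 0 -> x = 0.
Proof.
move=> bx; apply: a_sep => n; elim: n x bx => [|n IH] x bx.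
  by exists x => //; rewrite expr0 mul1r.
have [|y xy] := principalP (b_reg (x := x) _).
  by rewrite bx; exists 0 => //; rewrite mulr0.
have [|z yz] := principalP (IH y _); last first.
  by exists z; rewrite // exprS -mulrA -yz.
by apply: a_reg; rewrite mulrCA -xy.
Qed.

Lemma a_reg_mod_b x : principal b (a * x) -> principal b x.
Proof.
move=> /principalP[y axy].
have [|z yz] := principalP (b_reg (x := y) _); first by exists x.
exists z => //; apply/eqP; rewrite -subr_eq0; apply/eqP/a_reg.
by rewrite mulrBr axy yz; ring.
Qed.

End RegularSequence.

Lemma gen2C (A : comPzRingType) (a b : A) :
  ideal_gen [set a; b] = ideal_gen [set b; a].
Proof.
by congr ideal_gen; apply/seteqP; split=> x [|]; by [left|right].
Qed.

Section PAdicCompletion.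
Variables (p : nat) (D S : comPzRingType) (iota : {rmorphism D -> S}).
Hypothesis SP : adic_completion (principal p%:R) iota.

Lemma pow_principal (A : comPzRingType) (a : A) n :
  ideal_pow (principal a) n `<=` principal (a ^+ n).
Proof.
apply: ideal_gen_min; first exact: principal_ideal.
move=> _ [f [fI ->]].
have /choice[g gE] i : exists y, f i = a * y by apply/principalP/fI.
under eq_bigr do rewrite gE.
by rewrite big_split /= prodr_const card_ord; apply: principalM.
Qed.

Lemma principal_pow (A : comPzRingType) (a : A) n :
  principal (a ^+ n) `<=` ideal_pow (principal a) n.
Proof.
move=> _ [x _ <-]; apply: idealMr (ideal_pow_ideal _ _) _.
by apply: ideal_powX; move: (principalM a 1); rewrite mulr1.
Qed.


Lemma completion_sep (x : S) : (forall n, principal (p%:R ^+ n) x) -> x = 0.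
Proof.
case: SP => Q [q [pr [qP prq comp uniq]]] hx.
have p0 n : p%:R ^+ n = 0 :> Q n.
  rewrite -(rmorph_nat (q n)) -rmorphXn; apply/(qP n).2.
  by apply: principal_pow; move: (principalM (p%:R ^+ n : D) 1); rewrite mulr1.
have prx n : pr n x = 0.
  by have [y ->] := principalP (hx n); rewrite rmorphM rmorphXn rmorph_nat p0 mul0r.
have [|z [_ zu]] := uniq (fun n => pr n 0); first exact: comp.
rewrite -(zu x) ?(zu 0) // => n; by rewrite prx rmorph0.
Qed.

Lemma completion_lim (t : nat -> S) :
  exists x, forall n, principal (p%:R ^+ n) (x - \sum_(i < n) p%:R ^+ i * t i).
Proof.
case: SP => Q [q [pr [qP prq comp uniq]]].
have p0 n : p%:R ^+ n = 0 :> Q n.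
  rewrite -(rmorph_nat (q n)) -rmorphXn; apply/(qP n).2.
  by apply: principal_pow; move: (principalM (p%:R ^+ n : D) 1); rewrite mulr1.
pose X (t : nat -> S) n := \sum_(i < n) p%:R ^+ i * t i.
have lim t' : exists x, forall n, pr n x = pr n (X t' n).
  have [|x [xE _]] := uniq (fun n => pr n (X t' n)); last by exists x.
  move=> n a qa; rewrite (comp _ _ _ qa) /X big_ord_recr /= rmorphD rmorphM.
  by rewrite rmorphXn rmorph_nat p0 mul0r addr0.
have [x xE] := lim t; exists x => n.
have [y yE] := lim (fun i => t (n + i)%N).
suff -> : x - X t n = p%:R ^+ n * y by exact: principalM.
have [|z [_ zu]] := uniq (fun m => pr m (x - X t n)); first exact: comp.
have eqz u : (forall m, pr m u = pr m (x - X t n)) -> u = x - X t n.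
  by move=> h; rewrite -(zu u h) -(zu (x - X t n)).
apply/esym/eqz => m.
rewrite rmorphM (yE m) -rmorphM rmorphB (xE m) -rmorphB.
have -> : p%:R ^+ n * X (fun i => t (n + i)%N) m = X t (m + n)%N - X t n.
  rewrite /X mulr_sumr (addnC m) big_split_ord /= addrAC subrr add0r.
  by apply: eq_bigr => i _; rewrite mulrA -exprD.
have Xm : forall k, pr m (X t (m + k)%N) = pr m (X t m).
  elim=> [|k IH]; first by rewrite addn0.
  rewrite addnS /X big_ord_recr /= rmorphD IH rmorphM rmorphXn rmorph_nat.
  by rewrite exprD p0 !mul0r addr0.
by rewrite !rmorphB Xm.
Qed.

Lemma completion_surj (s : S) : exists d s', s = iota d + p%:R * s'.
Proof.
case: SP => Q [q [pr [qP prq comp uniq]]].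
have /choice[d dE] n : exists d, q n d = pr n s by case: (qP n) => h _; apply: h.
have /choice[u uE] n : exists u, d n.+1 = d n + p%:R ^+ n * u.
  have : principal (p%:R ^+ n) (d n.+1 - d n).
    apply: pow_principal; apply/(qP n).2; rewrite rmorphB (dE n).
    by rewrite (comp _ _ _ (dE n.+1)) subrr.
  by move=> /principalP[u e]; exists u; rewrite -e addrC subrK.
have [s' s'E] := completion_lim (fun i => iota (u i.+1)).
exists (d 1%N), s'; have [|z [_ zu]] := uniq (fun m => pr m s); first exact: comp.
rewrite -(zu s) // (zu (iota (d 1%N) + p%:R * s')) // => n.
have [y yE] := principalP (s'E n).
have p0 : p%:R ^+ n = 0 :> Q n.
  rewrite -(rmorph_nat (q n)) -rmorphXn; apply/(qP n).2.
  by apply: principal_pow; move: (principalM (p%:R ^+ n : D) 1); rewrite mulr1.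
have dS : forall k, d k.+1 = d 1%N + p%:R * \sum_(i < k) p%:R ^+ i * u i.+1.
  elim=> [|k IH]; first by rewrite big_ord0 mulr0 addr0.
  by rewrite uE IH big_ord_recr /= exprS; ring.
have -> : s' = iota (\sum_(i < n) p%:R ^+ i * u i.+1) + p%:R ^+ n * y.
  rewrite -yE rmorph_sum addrC -addrA [X in _ = _ + X]addrC.
  under [X in _ = _ + (X - _)]eq_bigr do rewrite rmorphM rmorphXn rmorph_nat.
  by rewrite subrr addr0.
have -> : iota (d 1%N) + p%:R * (iota (\sum_(i < n) p%:R ^+ i * u i.+1) + p%:R ^+ n * y)
    = iota (d n.+1) + p%:R ^+ n * (p%:R * y).
  by rewrite (dS n) rmorphD rmorphM rmorph_nat; ring.
rewrite rmorphD rmorphM rmorphXn rmorph_nat p0 mul0r addr0 prq.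
by rewrite (comp _ _ _ (dE n.+1)).
Qed.

Lemma completion_inj d : principal p%:R (iota d) -> principal p%:R d.
Proof.
case: SP => Q [q [pr [qP prq comp uniq]]] /principalP[y yE].
have : ideal_pow (principal p%:R) 1 d.
  apply/(qP 1%N).2; rewrite -prq yE rmorphM rmorph_nat.
  suff -> : p%:R = 0 :> Q 1%N by rewrite mul0r.
  rewrite -(rmorph_nat (q 1%N)); apply/(qP 1%N).2; apply: principal_pow.
  by move: (principalM (p%:R : D) 1); rewrite mulr1 expr1.
by move=> /pow_principal; rewrite expr1.
Qed.

End PAdicCompletion.

(** * The comparison complex *)

(** Dependent choice, in the form used for successive approximation: each step
    produces an output and a new state. *)
Lemma iterate_step (T O : Type) (inv : T -> Prop) (rel : T -> O -> T -> Prop) t0 :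
  inv t0 -> (forall t, inv t -> exists o t', inv t' /\ rel t o t') ->
  exists (o : nat -> O) (t : nat -> T), t 0%N = t0 /\
    forall n, inv (t n) /\ rel (t n) (o n) (t n.+1).
Proof.
move=> i0 step.
have /choice[f fP] (t : {t | inv t}) : exists ot : O * {t | inv t},
    rel (sval t) ot.1 (sval ot.2).
  case: t => t it; have [o [t' [it' r]]] := step t it.
  by exists (o, exist _ t' it').
pose t := fix t n := if n is n'.+1 then (f (t n')).2 else exist _ t0 i0.
exists (fun n => (f (t n)).1), (fun n => sval (t n)); split=> // n.
by split; [apply: svalP | apply: fP].
Qed.

Ltac mx_ring := apply/matrixP => ? ?; rewrite !mxE; ring.

Section MatrixLimits.
Variables (B : comPzRingType) (p : nat).
Hypothesis B_sep : forall x : B, (forall n, principal (p%:R ^+ n) x) -> x = 0.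
Hypothesis B_lim : forall t : nat -> B, exists x, forall n,
  principal (p%:R ^+ n) (x - \sum_(i < n) p%:R ^+ i * t i).

Lemma mx_sep m n (X : 'M[B]_(m, n)) :
  (forall k, exists Y, X = p%:R ^+ k *: Y) -> X = 0.
Proof.
move=> h; apply/matrixP => i j; rewrite mxE; apply: B_sep => k.
by have [Y ->] := h k; rewrite mxE; apply: principalM.
Qed.

Lemma mx_lim m n (t : nat -> 'M[B]_(m, n)) : exists X, forall k, exists Y,
  X = \sum_(i < k) p%:R ^+ i *: t i + p%:R ^+ k *: Y.
Proof.
have /choice[x xE] (ij : 'I_m * 'I_n) := B_lim (fun k => t k ij.1 ij.2).
exists (\matrix_(i, j) x (i, j)) => k.
have [|Y YE] := @mxin_principal B (p%:R ^+ k) m n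
    (\matrix_(i, j) x (i, j) - \sum_(i < k) p%:R ^+ i *: t i).
  move=> i j; rewrite !mxE summxE; under eq_bigr do rewrite mxE.
  exact: xE (i, j) k.
by exists Y; rewrite -YE addrC subrK.
Qed.

End MatrixLimits.

(** What the deformation argument needs from [A -> S]. The ideal [Fil2] plays the part
    of the divided powers of order at least two: modulo [p] it is killed by [phi1] and
    the quotient of [S] by it is that of [A] by [E^2]. The other conditions
    say that both rings are [p]-torsion free and [p]-adically complete, that [A/p] is
    [E]-adically complete, and that [Fil] is [p]-saturated and [p]-adically closed. *)
Record comparison (p : nat) (A S : comPzRingType) (FA : frame p A) (FS : frame p S)
    (lam : {rmorphism A -> S}) (c : S) (E : A) (Fil2 : set S) : Prop := Comparison {
  cm_hom : frame_hom FA FS c lam;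
  cm_complete : adic_complete (ideal_gen [set (p%:R : A); E]);
  cm_A_reg : forall x : A, p%:R * x = 0 -> x = 0;
  cm_A_sep : forall x : A, (forall n, principal (p%:R ^+ n) x) -> x = 0;
  cm_A_lim : forall t : nat -> A, exists x, forall n,
    principal (p%:R ^+ n) (x - \sum_(i < n) p%:R ^+ i * t i);
  cm_E_lim : forall t : nat -> A, exists x, forall m, exists u v,
    x - \sum_(i < m) E ^+ i * t i = p%:R * u + E ^+ m * v;
  cm_E_sep : forall x, (forall m, exists u v, x = p%:R * u + E ^+ m * v) ->
    principal p%:R x;
  cm_A_Fil : fr_Fil FA = principal E;
  cm_A_phi1 : forall x, fr_phi1 FA (E * x) = fr_phi FA x;
  cm_A_Fil_p : forall x, fr_Fil FA (p%:R * x) -> fr_Fil FA x;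
  cm_A_Fil_closed : forall x,
    (forall n, exists f y, fr_Fil FA f /\ x = f + p%:R ^+ n * y) -> fr_Fil FA x;
  cm_S_reg : forall x : S, p%:R * x = 0 -> x = 0;
  cm_S_sep : forall x : S, (forall n, principal (p%:R ^+ n) x) -> x = 0;
  cm_S_lim : forall t : nat -> S, exists x, forall n,
    principal (p%:R ^+ n) (x - \sum_(i < n) p%:R ^+ i * t i);
  cm_S_varpi : fr_varpi FS = p%:R;
  cm_S_Fil_p : forall x, fr_Fil FS (p%:R * x) -> fr_Fil FS x;
  cm_S_Fil_closed : forall x,
    (forall n, exists f y, fr_Fil FS f /\ x = f + p%:R ^+ n * y) -> fr_Fil FS x;
  cm_Fil2_ideal : ideal Fil2;
  cm_Fil2_Fil : forall z, Fil2 z -> fr_Fil FS z;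
  cm_Fil2_phi1 : forall z, Fil2 z -> principal p%:R (fr_phi1 FS z);
  cm_Fil2_decomp : forall s, exists a z, Fil2 z /\ s = lam a + z;
  cm_Fil2_decomp_Fil : forall s, fr_Fil FS s ->
    exists a z, [/\ Fil2 z, fr_Fil FA a & s = lam a + z];
  cm_Fil2_E2 : forall a, Fil2 (lam (E ^+ 2 * a));
  cm_lam_Fil2 : forall a z s, Fil2 z -> lam a = z + p%:R * s ->
    exists u v, a = p%:R * u + E ^+ 2 * v
}.

Section Complex.
Variables (p : nat) (p_ge3 : (3 <= p)%N).
Variables (A S : comPzRingType) (FA : frame p A) (FS : frame p S).
Variables (lam : {rmorphism A -> S}) (c ci : S) (E : A) (Fil2 : set S).
Hypothesis cmp : comparison FA FS lam c E Fil2.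
Hypothesis cci : c * ci = 1.

Lemma A_reg n (x : A) : p%:R ^+ n * x = 0 -> x = 0.
Proof.
elim: n => [|n IH]; first by rewrite mul1r.
by rewrite exprS -mulrA => /(cm_A_reg cmp).
Qed.

Lemma S_reg n (x : S) : p%:R ^+ n * x = 0 -> x = 0.
Proof.
elim: n => [|n IH]; first by rewrite mul1r.
by rewrite exprS -mulrA => /(cm_S_reg cmp).
Qed.

Lemma filmxA_p n m1 m2 gr gc (X : 'M[A]_(m1, m2)) :
  filmx FA gr gc (p%:R ^+ n *: X) -> filmx FA gr gc X.
Proof.
move=> h i j bi bj; have := h i j bi bj; rewrite mxE; move: (X i j) => x {h}.
elim: n x => [|n IH] x; first by rewrite mul1r.
by rewrite exprSr -mulrA => /IH/(cm_A_Fil_p cmp).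
Qed.

Lemma filmxS_p n m1 m2 gr gc (X : 'M[S]_(m1, m2)) :
  filmx FS gr gc (p%:R ^+ n *: X) -> filmx FS gr gc X.
Proof.
move=> h i j bi bj; have := h i j bi bj; rewrite mxE; move: (X i j) => x {h}.
elim: n x => [|n IH] x; first by rewrite mul1r.
by rewrite exprSr -mulrA => /IH/(cm_S_Fil_p cmp).
Qed.

Lemma map_lam_filmx m n gr gc (X : 'M_(m, n)) :
  filmx FA gr gc X -> filmx FS gr gc (map_mx lam X).
Proof. exact: map_filmx (cm_hom cmp) _ _ _ _ _. Qed.

(** [dag] conjugated by [tw c], so that it extends [dag] along [lam] without any
    constant. *)
Definition ddag m n gr gc (X : 'M[S]_(m, n)) : 'M[S]_(m, n) :=
  tw c gr *m dag FS gr gc X *m tw ci gc.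

Lemma ddag_map m n gr gc (X : 'M_(m, n)) : filmx FA gr gc X ->
  ddag gr gc (map_mx lam X) = map_mx lam (dag FA gr gc X).
Proof.
move=> hX; rewrite /ddag (dag_map (cm_hom cmp) hX) -mulmxA.
by rewrite (twKl cci) mulmx1.
Qed.

Lemma ddagD m n gr gc (X Y : 'M_(m, n)) : filmx FS gr gc X -> filmx FS gr gc Y ->
  ddag gr gc (X + Y) = ddag gr gc X + ddag gr gc Y.
Proof. by move=> hX hY; rewrite /ddag dagD // mulmxDr mulmxDl. Qed.

Lemma ddagB m n gr gc (X Y : 'M_(m, n)) : filmx FS gr gc X -> filmx FS gr gc Y ->
  ddag gr gc (X - Y) = ddag gr gc X - ddag gr gc Y.
Proof. by move=> hX hY; rewrite /ddag dagB // mulmxBr mulmxBl. Qed.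

Lemma ddagZ m n k gr gc (X : 'M_(m, n)) : filmx FS gr gc X ->
  ddag gr gc (p%:R ^+ k *: X) = p%:R ^+ k *: ddag gr gc X.
Proof. by move=> hX; rewrite /ddag dagZ // rmorphXn rmorph_nat -scalemxAr -scalemxAl. Qed.

Lemma Fil2_filmx m n gr gc (X : 'M_(m, n)) : mxin Fil2 X -> filmx FS gr gc X.
Proof. by move=> hX; apply/filmx_in/(mxin_sub (cm_Fil2_Fil cmp)). Qed.

Lemma ddag_Fil2 m n gr gc (X : 'M_(m, n)) : mxin Fil2 X ->
  exists Y, ddag gr gc X = p%:R *: Y.
Proof.
move=> hX; apply: mxin_principal; have hp := @principal_ideal S p%:R.
apply: mxinMr => //; apply: mxinMl => // i j; rewrite mxE /dag_entry.
have Fz := cm_Fil2_Fil cmp (hX i j); have pz := cm_Fil2_phi1 cmp (hX i j).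
have phiz : principal p%:R (fr_phi FS (X i j)).
  by rewrite fr_phiE // (cm_S_varpi cmp); apply: principalM.
by do 2 case: ifP => _ //; apply: idealMl.
Qed.

Lemma mx_decomp m n gr gc (X : 'M[S]_(m, n)) : filmx FS gr gc X ->
  exists h z, [/\ filmx FA gr gc h, mxin Fil2 z & X = map_mx lam h + z].
Proof.
move=> hX.
have /choice[f fP] (ij : 'I_m * 'I_n) : exists az : A * S,
    [/\ fil_entry FA (gr ij.1) (gc ij.2) az.1, Fil2 az.2 & X ij.1 ij.2 = lam az.1 + az.2].
  have := hX ij.1 ij.2; rewrite /fil_entry.
  have gen : exists az : A * S, Fil2 az.2 /\ X ij.1 ij.2 = lam az.1 + az.2.
    by have [a [z [Zz ->]]] := cm_Fil2_decomp cmp (X ij.1 ij.2); exists (a, z).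
  case: (gr _); case: (gc _) => h; try by have [az [? ?]] := gen; exists az; split.
  have [a [z [Zz Fa ->]]] := cm_Fil2_decomp_Fil cmp (h isT isT).
  by exists (a, z).
exists (\matrix_(i, j) (f (i, j)).1), (\matrix_(i, j) (f (i, j)).2); split.
- by move=> i j; rewrite mxE; have [] := fP (i, j).
- by move=> i j; rewrite mxE; have [] := fP (i, j).
- by apply/matrixP => i j; rewrite !mxE; have [_ _ ->] := fP (i, j).
Qed.

Lemma mx_decomp_any m n (X : 'M[S]_(m, n)) :
  exists h z, mxin Fil2 z /\ X = map_mx lam h + z.
Proof.
have [|h [z [_ Zz ->]]] := @mx_decomp m n (fun=> true) (fun=> false) X; first by [].
by exists h, z.
Qed.

Definition pE_ideal m : set A := addI (principal p%:R) (principal (E ^+ m)).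

Lemma pE_ideal_ideal m : ideal (pE_ideal m).
Proof. by apply: addI_ideal; apply: principal_ideal. Qed.

Lemma pE_idealP m x : pE_ideal m x <-> exists u v, x = p%:R * u + E ^+ m * v.
Proof.
split=> [[_ [_ [[u _ <-] [v _ <-] ->]]]|[u [v ->]]]; first by exists u, v.
by exists (p%:R * u), (E ^+ m * v); split=> //; apply: principalM.
Qed.

Lemma pE_ideal_p m u : pE_ideal m (p%:R * u).
Proof. by apply/pE_idealP; exists u, 0; rewrite mulr0 addr0. Qed.

Lemma pE_ideal_E m n u : (m <= n)%N -> pE_ideal m (E ^+ n * u).
Proof.
by move=> mn; apply/pE_idealP; exists 0, (E ^+ (n - m) * u); rewrite mulr0 add0r mulrA -exprD subnKC.
Qed.

Lemma pE_ideal_le m n x : (m <= n)%N -> pE_ideal n x -> pE_ideal m x.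
Proof.
move=> mn /pE_idealP[u [v ->]]; apply: idealD (pE_ideal_ideal m) (pE_ideal_p _ _) _.
exact: pE_ideal_E.
Qed.

Lemma mx_pE m n k (X : 'M[A]_(m, n)) : mxin (pE_ideal k) X ->
  exists U V, X = p%:R *: U + E ^+ k *: V.
Proof.
move=> hX.
have /choice[f fP] (ij : 'I_m * 'I_n) : exists uv : A * A,
    X ij.1 ij.2 = p%:R * uv.1 + E ^+ k * uv.2.
  by have /pE_idealP[u [v ->]] := hX ij.1 ij.2; exists (u, v).
exists (\matrix_(i, j) (f (i, j)).1), (\matrix_(i, j) (f (i, j)).2).
by apply/matrixP => i j; rewrite !mxE -fP.
Qed.

Lemma mx_pE_sep m n (X : 'M[A]_(m, n)) : (forall k, mxin (pE_ideal k) X) ->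
  exists Y, X = p%:R *: Y.
Proof.
move=> h; apply: mxin_principal => i j; apply: (cm_E_sep cmp) => k.
by apply/pE_idealP/h.
Qed.

Lemma phiE_pow m n : (n <= p * m)%N -> pE_ideal n (fr_phi FA E ^+ m).
Proof.
move=> nm; have [e eE] := principalP (@fr_phi_frob _ _ FA E).
have -> : fr_phi FA E = E ^+ p + p%:R * e by rewrite -eE addrC subrK.
suff h : forall k, exists u, (E ^+ p + p%:R * e) ^+ k = E ^+ (p * k) + p%:R * u.
  have [u ->] := h m; apply: idealD (pE_ideal_ideal n) _ (pE_ideal_p _ _).
  by rewrite -[E ^+ _]mulr1; apply: pE_ideal_E.
elim=> [|k [u IH]]; first by exists 0; rewrite muln0 mulr0 addr0.
exists (u * E ^+ p + e * (E ^+ (p * k) + p%:R * u)).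
by rewrite exprSr IH mulnS [(p + _)%N]addnC exprD; ring.
Qed.

(** This is where multiplication by [E^2] becomes contracting: [phi1] lowers the
    exponent by one before Frobenius multiplies it by [p >= 3]. *)
Lemma dag_pE m n k gr gc (X : 'M[A]_(m, n)) :
  mxin (pE_ideal k.+3) (dag FA gr gc (E ^+ k.+2 *: X)).
Proof.
move=> i j; rewrite !mxE; set x := X i j.
have h : pE_ideal k.+3 (fr_phi FA (E ^+ k.+2 * x)).
  rewrite rmorphM rmorphXn; apply: idealMr; first exact: pE_ideal_ideal.
  by apply: phiE_pow; nia.
rewrite /dag_entry; case: ifP => _ //; case: ifP => _; last first.
  by apply: idealMl => //; apply: pE_ideal_ideal.
rewrite exprS -mulrA (cm_A_phi1 cmp) rmorphM rmorphXn.
apply: idealMr; first exact: pE_ideal_ideal.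
by apply: phiE_pow; nia.
Qed.

Lemma E_filmx m n k gr gc (X : 'M[A]_(m, n)) : filmx FA gr gc (E ^+ k.+1 *: X).
Proof.
move=> i j _ _; rewrite mxE (cm_A_Fil cmp) exprS -mulrA; exact: principalM.
Qed.

Section Operators.
Variables (r r' : nat) (gr : 'I_r -> bool) (gr' : 'I_r' -> bool).
Variables (P : 'M[A]_r') (Q : 'M[A]_r).

(** The differential of the complex computing homomorphisms and extensions of two
    windows over [A] is [h |-> h - UA h], from the filtered matrices to all matrices;
    [US] is its base change to [S]. The results below say that the comparison map is
    a quasi-isomorphism. As no relation is imposed on [P] and [Q], they can be lifted
    freely from the reductions modulo [p^n]. *)
Definition UA (h : 'M[A]_(r', r)) := P *m dag FA gr' gr h *m Q.
Definition US (g : 'M[S]_(r', r)) := map_mx lam P *m ddag gr' gr g *m map_mx lam Q.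

Local Notation filA := (filmx FA gr' gr).
Local Notation filS := (filmx FS gr' gr).

Lemma US_map h : filA h -> US (map_mx lam h) = map_mx lam (UA h).
Proof. by move=> fh; rewrite /US ddag_map // !map_mxM. Qed.

Lemma USD X Y : filS X -> filS Y -> US (X + Y) = US X + US Y.
Proof. by move=> hX hY; rewrite /US ddagD // mulmxDr mulmxDl. Qed.

Lemma USB X Y : filS X -> filS Y -> US (X - Y) = US X - US Y.
Proof. by move=> hX hY; rewrite /US ddagB // mulmxBr mulmxBl. Qed.

Lemma USZ k X : filS X -> US (p%:R ^+ k *: X) = p%:R ^+ k *: US X.
Proof. by move=> hX; rewrite /US ddagZ // -scalemxAr -scalemxAl. Qed.

Lemma UAD X Y : filA X -> filA Y -> UA (X + Y) = UA X + UA Y.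
Proof. by move=> hX hY; rewrite /UA dagD // mulmxDr mulmxDl. Qed.

Lemma UAB X Y : filA X -> filA Y -> UA (X - Y) = UA X - UA Y.
Proof. by move=> hX hY; rewrite /UA dagB // mulmxBr mulmxBl. Qed.

Lemma UAZ k X : filA X -> UA (p%:R ^+ k *: X) = p%:R ^+ k *: UA X.
Proof.
by move=> hX; rewrite /UA dagZ // rmorphXn rmorph_nat -scalemxAr -scalemxAl.
Qed.

Lemma US_Fil2 X : mxin Fil2 X -> exists Y, US X = p%:R *: Y.
Proof.
move=> /ddag_Fil2-/(_ gr' gr)[Y YE]; exists (map_mx lam P *m Y *m map_mx lam Q).
by rewrite /US YE -scalemxAr -scalemxAl.
Qed.

Lemma UA_pE k X : filA X -> mxin (pE_ideal k.+2) X -> mxin (pE_ideal k.+3) (UA X).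
Proof.
move=> fX /mx_pE[U [V XE]].
have fEV : filA (E ^+ k.+2 *: V) by apply: E_filmx.
have fU : filA U.
  apply: (@filmxA_p 1); rewrite expr1 -[_ *: U](addrK (E ^+ k.+2 *: V)) -XE.
  exact: filmxB.
rewrite XE -[p%:R]expr1 UAD //; last exact: filmxZ.
rewrite UAZ // expr1; apply: (mxinD (pE_ideal_ideal _)).
  by move=> i j; rewrite mxE; apply: pE_ideal_p.
apply: (mxinMr (pE_ideal_ideal _)); apply: (mxinMl (pE_ideal_ideal _)).
exact: dag_pE.
Qed.

(** A Neumann series solves the equation, as [UA] raises the power of [E] dividing its
    argument modulo [p]. *)
Lemma UA_solve (w : 'M[A]_(r', r)) : exists x y,
  E ^+ 2 *: x - UA (E ^+ 2 *: x) = E ^+ 2 *: w + p%:R *: y.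
Proof.
have /choice[f fP] (kw : nat * 'M[A]_(r', r)) : exists w' : 'M[A]_(r', r), exists u,
    UA (E ^+ kw.1.+2 *: kw.2) = p%:R *: u + E ^+ kw.1.+3 *: w'.
  have [|u [v ->]] := @mx_pE r' r kw.1.+3 (UA (E ^+ kw.1.+2 *: kw.2)).
    apply: UA_pE; first exact: E_filmx.
    by move=> i j; rewrite mxE; apply: pE_ideal_E.
  by exists v, u.
pose W := fix W n := if n is n'.+1 then f (n', W n') else w.
have WE n : exists u, UA (E ^+ n.+2 *: W n) = p%:R *: u + E ^+ n.+3 *: W n.+1.
  exact: fP (n, W n).
pose X m := \sum_(i < m) E ^+ i.+2 *: W i.
have fE k Y : filA (E ^+ k.+1 *: Y) by apply: E_filmx.
have fX m : filA (X m).
  rewrite /X; elim/big_ind: _ => [|? ? ? ?|i _]; first exact: filmx0.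
    exact: filmxD.
  exact: fE.
have XU m : exists y, X m - UA (X m) = E ^+ 2 *: w - E ^+ m.+2 *: W m + p%:R *: y.
  elim: m => [|m [y IH]].
    exists 0; rewrite /X big_ord0 /UA dag0 mulmx0 mul0mx !subr0 scaler0 addr0.
    by rewrite subrr.
  have [u uE] := WE m; exists (y - u).
  rewrite /X big_ord_recr /= -/(X m) UAD // uE scalerBr.
  have -> : forall a b c' d d' : 'M[A]_(r', r),
      a + b - (c' + (d + d')) = (a - c') + (b - (d + d')) by move=> *; mx_ring.
  by rewrite IH; mx_ring.
have /choice[x0 x0E] (ij : 'I_r' * 'I_r) := cm_E_lim cmp (fun k => W k ij.1 ij.2).
pose x := \matrix_(i, j) x0 (i, j).
exists x.
pose e := E ^+ 2 *: x - UA (E ^+ 2 *: x) - E ^+ 2 *: w.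
have [m|y yE] := @mx_pE_sep _ _ e; last by exists y; rewrite -yE /e [RHS]addrC subrK.
have dX : mxin (pE_ideal m.+2) (E ^+ 2 *: x - X m).
  move=> i j; have [u [v uv]] := x0E (i, j) m; apply/pE_idealP.
  exists (E ^+ 2 * u), v; rewrite !mxE summxE.
  under eq_bigr do rewrite mxE -addn2 addnC exprD -mulrA.
  by rewrite -mulr_sumr -mulrBr uv -(addn2 m) exprD; ring.
have fd : filA (E ^+ 2 *: x - X m) by apply: filmxB.
have [y yE] := XU m.
have -> : e = (E ^+ 2 *: x - X m) - UA (E ^+ 2 *: x - X m)
    - E ^+ m.+2 *: W m + p%:R *: y.
  rewrite UAB // /e.
  have -> : forall a b c' d d' d'' : 'M[A]_(r', r),
      a - b - (c' - d) - d' + d'' = a - c' - (b - d) - d' + d'' by move=> *; mx_ring.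
  by rewrite yE; move: (UA _) => ?; mx_ring.
have hI := pE_ideal_ideal m.
apply: (mxinD hI); last by move=> i j; rewrite mxE; apply: pE_ideal_p.
apply: (mxinB hI); last by move=> i j; rewrite mxE; apply: pE_ideal_E; lia.
apply: (mxinB hI).
  by move=> i j; apply: pE_ideal_le (dX i j); lia.
by move=> i j; apply: pE_ideal_le (UA_pE fd dX i j); lia.
Qed.

Lemma US_pZ X : filS X -> US (p%:R *: X) = p%:R *: US X.
Proof. by move=> fX; rewrite -[p%:R]expr1 USZ. Qed.

Lemma UA_pZ X : filA X -> UA (p%:R *: X) = p%:R *: UA X.
Proof. by move=> fX; rewrite -[p%:R]expr1 UAZ. Qed.

Lemma map_lamZ k m n (X : 'M[A]_(m, n)) :
  map_mx lam (p%:R ^+ k *: X) = p%:R ^+ k *: map_mx lam X.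
Proof. by rewrite map_mxZ rmorphXn rmorph_nat. Qed.

Lemma map_lam_pZ m n (X : 'M[A]_(m, n)) :
  map_mx lam (p%:R *: X) = p%:R *: map_mx lam X.
Proof. by rewrite map_mxZ rmorph_nat. Qed.

Lemma scaleS_I k m n (X Y : 'M[S]_(m, n)) : p%:R ^+ k *: X = p%:R ^+ k *: Y -> X = Y.
Proof. by apply: scale_mxI => x; apply: S_reg. Qed.

Lemma scaleA_I k m n (X Y : 'M[A]_(m, n)) : p%:R ^+ k *: X = p%:R ^+ k *: Y -> X = Y.
Proof. by apply: scale_mxI => x; apply: A_reg. Qed.

Lemma mx_lam_Fil2 m n (X : 'M[A]_(m, n)) z Y : mxin Fil2 z ->
  map_mx lam X = z + p%:R *: Y -> mxin (pE_ideal 2) X.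
Proof.
move=> Zz /matrixP e i j; apply/pE_idealP; apply: (cm_lam_Fil2 cmp (Zz i j) (s := Y i j)).
by have := e i j; rewrite !mxE.
Qed.

(** Modulo [p] write [g = lam h0 + z0] with [z0] in [Fil2]. Since [US z0] vanishes, the
    defect of [h0] maps to [z0] and is therefore divisible by [E^2], so [h0] can be
    corrected by a Neumann series to [h]; then [g - lam h] is a solution of the
    homogeneous equation lying in [Fil2], hence zero. *)
Lemma lift_fixed_mod_p g k : filS g -> g - US g = map_mx lam k ->
  exists hk : 'M[A]_(r', r) * 'M[A]_(r', r), exists g1,
    [/\ filA hk.1, filS g1, g = map_mx lam hk.1 + p%:R *: g1,
        k = hk.1 - UA hk.1 + p%:R *: hk.2 & g1 - US g1 = map_mx lam hk.2].
Proof.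
move=> fg gk; have [h0 [z0 [fh0 Zz0 gE]]] := mx_decomp fg.
have fz0 : filS z0 by apply: Fil2_filmx.
have fl0 := map_lam_filmx fh0.
pose d0 := k + UA h0 - h0.
have d0E : map_mx lam d0 = z0 - US z0.
  rewrite /d0 map_mxB map_mxD -gk gE USD // US_map //.
  by move: (US z0) (map_mx lam (UA h0)) => *; mx_ring.
have [t tE] := US_Fil2 Zz0.
have [|u [w0 d0w]] := @mx_pE r' r 2 d0.
  by apply: (mx_lam_Fil2 Zz0 (Y := - t)); rewrite d0E tE scalerN.
have [x [y xE]] := UA_solve w0.
set X := E ^+ 2 *: x in xE.
have fX : filA X by apply: E_filmx.
have ZX : mxin Fil2 (map_mx lam X).
  by move=> i j; rewrite !mxE; apply: (cm_Fil2_E2 cmp).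
have fh : filA (h0 + X) by apply: filmxD.
pose k1 := u - y.
have kE : k = (h0 + X) - UA (h0 + X) + p%:R *: k1.
  have -> : k = d0 + h0 - UA h0 by rewrite /d0; move: (UA h0) => *; mx_ring.
  have -> : d0 = p%:R *: u + (X - UA X - p%:R *: y) by rewrite xE addrK.
  by rewrite UAD // /k1; move: (UA h0) (UA X) => *; mx_ring.
pose z := z0 - map_mx lam X.
have Zz : mxin Fil2 z by apply: (mxinB (cm_Fil2_ideal cmp)).
have fz : filS z by apply: Fil2_filmx.
have gz : g = map_mx lam (h0 + X) + z.
  by rewrite gE map_mxD /z; mx_ring.
have [t' t'E] := US_Fil2 Zz.
have zk : z - US z = p%:R *: map_mx lam k1.
  have : g - US g = map_mx lam ((h0 + X) - UA (h0 + X)) + (z - US z).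
    rewrite gz USD // ?US_map // ?map_mxB; last exact: map_lam_filmx.
    by move: (US z) (map_mx lam (UA _)) => *; mx_ring.
  rewrite gk {1}kE map_mxD map_lam_pZ => /addrI <-.
  by [].
have zE : z = p%:R *: (map_mx lam k1 + t').
  by rewrite scalerDr -zk -t'E subrK.
have fg1 : filS (map_mx lam k1 + t').
  by apply: (@filmxS_p 1); rewrite expr1 -zE.
exists (h0 + X, k1), (map_mx lam k1 + t'); split=> //=; first by rewrite -zE.
apply: (@scaleS_I 1); rewrite expr1 scalerBr -US_pZ // -zE.
exact: zk.
Qed.

(** Injectivity on [H^0]: a fixed point in the kernel is divisible modulo [p] by [E^2],
    hence by every power of [E]; so it is divisible by [p], and one iterates. *)
Lemma fixed_lam_inj h : filA h -> UA h = h -> map_mx lam h = 0 -> h = 0.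
Proof.
move=> fh Uh lh.
have step h' : filA h' -> UA h' = h' -> map_mx lam h' = 0 -> exists h1,
    [/\ filA h1, UA h1 = h1, map_mx lam h1 = 0 & h' = p%:R *: h1].
  move=> fh' Uh' lh'.
  have hI m : mxin (pE_ideal m.+2) h'.
    elim: m => [|m IH]; last by rewrite -Uh'; apply: UA_pE.
    have Z0 : mxin Fil2 (0 : 'M[S]_(r', r)) by apply: (mxin0 (cm_Fil2_ideal cmp)).
    apply: (mx_lam_Fil2 Z0 (Y := 0)).
    by rewrite lh' scaler0 addr0.
  have [|h1 h1E] := @mx_pE_sep _ _ h'.
    by move=> m i j; apply: pE_ideal_le (hI m i j); lia.
  have fh1 : filA h1 by apply: (@filmxA_p 1); rewrite expr1 -h1E.
  exists h1; split=> //.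
    by apply: (@scaleA_I 1); rewrite expr1 -UA_pZ // -h1E.
  by apply: (@scaleS_I 1); rewrite expr1 -map_lam_pZ -h1E scaler0.
apply: (mx_sep (cm_A_sep cmp)) => k.
suff [h1 [_ _ _ ->]] : exists h1,
    [/\ filA h1, UA h1 = h1, map_mx lam h1 = 0 & h = p%:R ^+ k *: h1] by exists h1.
elim: k => [|k [h1 [f1 U1 l1 ->]]]; first by exists h; rewrite scale1r.
have [h2 [f2 U2 l2 ->]] := step h1 f1 U1 l1.
by exists h2; rewrite scalerA -exprSr.
Qed.

Lemma filA_lim (t : nat -> 'M[A]_(r', r)) X :
  (forall n, filA (t n)) ->
  (forall k, exists Y, X = \sum_(i < k) p%:R ^+ i *: t i + p%:R ^+ k *: Y) -> filA X.
Proof.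
move=> ft hX i j bi bj; apply: (cm_A_Fil_closed cmp) => n.
have [Y YE] := hX n.
exists ((\sum_(k < n) p%:R ^+ k *: t k) i j), (Y i j); split.
  suff h : filA (\sum_(k < n) p%:R ^+ k *: t k) by apply: h.
  elim/big_ind: _ => [|? ? ? ?|k _]; first exact: filmx0.
    exact: filmxD.
  exact: filmxZ.
by rewrite {1}YE !mxE.
Qed.

Lemma filS_lim (t : nat -> 'M[S]_(r', r)) X :
  (forall n, filS (t n)) ->
  (forall k, exists Y, X = \sum_(i < k) p%:R ^+ i *: t i + p%:R ^+ k *: Y) -> filS X.
Proof.
move=> ft hX i j bi bj; apply: (cm_S_Fil_closed cmp) => n.
have [Y YE] := hX n.
exists ((\sum_(k < n) p%:R ^+ k *: t k) i j), (Y i j); split.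
  suff h : filS (\sum_(k < n) p%:R ^+ k *: t k) by apply: h.
  elim/big_ind: _ => [|? ? ? ?|k _]; first exact: filmx0.
    exact: filmxD.
  exact: filmxZ.
by rewrite {1}YE !mxE.
Qed.

Lemma eq_mod_all_S m n (X Y : 'M[S]_(m, n)) :
  (forall k, exists W, X = Y + p%:R ^+ k *: W) -> X = Y.
Proof.
move=> h; apply/eqP; rewrite -subr_eq0; apply/eqP/(mx_sep (cm_S_sep cmp)) => k.
by have [W ->] := h k; exists W; rewrite addrC addKr.
Qed.

Lemma eq_mod_all_A m n (X Y : 'M[A]_(m, n)) :
  (forall k, exists W, X = Y + p%:R ^+ k *: W) -> X = Y.
Proof.
move=> h; apply/eqP; rewrite -subr_eq0; apply/eqP/(mx_sep (cm_A_sep cmp)) => k.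
by have [W ->] := h k; exists W; rewrite addrC addKr.
Qed.

(** Surjectivity on [H^0] and injectivity on [H^1], by iterating
    [lift_fixed_mod_p]. *)
Lemma lift_fixed g k : filS g -> g - US g = map_mx lam k ->
  exists h, [/\ filA h, h - UA h = k & map_mx lam h = g].
Proof.
move=> fg gk.
pose inv (s : 'M[S]_(r', r) * 'M[A]_(r', r)) :=
  filS s.1 /\ s.1 - US s.1 = map_mx lam s.2.
pose rel (s : 'M[S]_(r', r) * 'M[A]_(r', r)) h (s' : 'M[S]_(r', r) * 'M[A]_(r', r)) :=
  [/\ filA h, s.1 = map_mx lam h + p%:R *: s'.1 & s.2 = h - UA h + p%:R *: s'.2].
have [| |h [s [s0 hs]]] := @iterate_step _ _ inv rel (g, k).
- by [].
- move=> [g1 k1] [/= f1 e1]; have [[h k2] [g2 [/= ? ? ? ? ?]]] := lift_fixed_mod_p f1 e1.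
  by exists h, (g2, k2).
pose H n := \sum_(i < n) p%:R ^+ i *: h i.
have fh n : filA (h n) by have [_ []] := hs n.
have fH n : filA (H n).
  rewrite /H; elim/big_ind: _ => [|? ? ? ?|i _]; first exact: filmx0.
    exact: filmxD.
  exact: filmxZ.
have HE n : g = map_mx lam (H n) + p%:R ^+ n *: (s n).1 /\
    k = H n - UA (H n) + p%:R ^+ n *: (s n).2.
  elim: n => [|n [gE kE]].
    by rewrite /H big_ord0 s0 !scale1r /UA dag0 mulmx0 mul0mx map_mx0 subr0 !add0r.
  have [_ [_ g2 k2]] := hs n.
  have HS : H n.+1 = H n + p%:R ^+ n *: h n by rewrite /H big_ord_recr.
  split.
    by rewrite {1}gE g2 HS map_mxD map_lamZ scalerDr scalerA -exprSr addrA.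
  rewrite {1}kE k2 HS UAD ?UAZ //; last exact: filmxZ.
  rewrite !scalerDr scalerA -exprSr.
  by move: (UA (H n)) (UA (h n)) => *; mx_ring.
have [X XE] := mx_lim (cm_A_lim cmp) h.
have fX : filA X by apply: filA_lim XE.
exists X; split=> //.
  apply/esym/eq_mod_all_A => n; have [gE kE] := HE n; have [Y] := XE n; rewrite -/(H n) => YE.
  have fY : filA Y.
    apply: (@filmxA_p n); rewrite -[_ *: Y](addKr (H n)) -YE addrC.
    exact: filmxB.
  exists ((s n).2 - (Y - UA Y)).
  rewrite {1}kE {1 2}YE UAD ?UAZ //; last exact: filmxZ.
  by move: (UA (H n)) (UA Y) => *; mx_ring.
apply/esym/eq_mod_all_S => n; have [gE kE] := HE n; have [Y] := XE n; rewrite -/(H n) => YE.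
exists ((s n).1 - map_mx lam Y); rewrite {1}gE {1}YE map_mxD map_lamZ.
by rewrite scalerBr; mx_ring.
Qed.

(** Surjectivity on [H^1]: modulo [p] any matrix is [lam k + z] with
    [z] in [Fil2], and then [US z = 0]. *)
Lemma coker_lam y : exists k z, filS z /\ y = map_mx lam k + (z - US z).
Proof.
pose rel (y : 'M[S]_(r', r)) (kz : 'M[A]_(r', r) * 'M[S]_(r', r)) y' :=
  filS kz.2 /\ y = map_mx lam kz.1 + (kz.2 - US kz.2) + p%:R *: y'.
have [//| |kz [s [s0 hs]]] := @iterate_step _ _ (fun=> True) rel y.
  move=> {}y _; have [k [z [Zz ->]]] := mx_decomp_any y.
  have [t tE] := US_Fil2 Zz; exists (k, z), t; split=> //; split=> /=.
    exact: Fil2_filmx.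
  by rewrite tE addrA subrK.
have [k kE] := mx_lim (cm_A_lim cmp) (fun n => (kz n).1).
have [z zE] := mx_lim (cm_S_lim cmp) (fun n => (kz n).2).
have fkz n : filS (kz n).2 by have [_ []] := hs n.
have fz : filS z by apply: (filS_lim (t := fun n => (kz n).2) fkz zE).
exists k, z; split=> //; apply: eq_mod_all_S => n.
pose K n := \sum_(i < n) p%:R ^+ i *: (kz i).1.
pose Z' n := \sum_(i < n) p%:R ^+ i *: (kz i).2.
have fZ m : filS (Z' m).
  rewrite /Z'; elim/big_ind: _ => [|? ? ? ?|i _]; first exact: filmx0.
    exact: filmxD.
  exact: filmxZ.
have yE : y = map_mx lam (K n) + (Z' n - US (Z' n)) + p%:R ^+ n *: s n.
  elim: n => [|n IH].
    by rewrite /K /Z' !big_ord0 /US /ddag dag0 !(mulmx0, mul0mx) map_mx0 s0 scale1r subr0 !add0r.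
  have [_ [_ sE]] := hs n; rewrite {1}IH {1}sE.
  rewrite /K /Z' !big_ord_recr /= -/(K n) -/(Z' n) USD ?USZ //; last exact: filmxZ.
  rewrite map_mxD map_lamZ exprSr -scalerA.
  by move: (US _) (US _) (map_mx _ _) (map_mx _ _) => *; mx_ring.
have [Y YE] := kE n; have [Y' YE'] := zE n.
have fY : filS Y'.
  apply: (@filmxS_p n); rewrite -[_ *: Y'](addKr (Z' n)) -[Z' n + _]YE' addrC.
  exact: filmxB.
exists (s n - map_mx lam Y - (Y' - US Y')).
rewrite YE YE' -/(K n) -/(Z' n) USD ?USZ //; last exact: filmxZ.
rewrite {1}yE map_mxD map_lamZ.
by move: (US _) (US _) (map_mx _ _) (map_mx _ _) => *; mx_ring.
Qed.

End Operators.
End Complex.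

(** * Lifting idempotents and isomorphisms *)

Section Lifting.
Variable B : comPzRingType.

(** An isomorphism between the images of two idempotents may be tested modulo the
    radical. *)
Lemma invertible_mod_rad r (e f P Q : 'M[B]_r) :
  f *m f = f -> e *m e = e -> e *m P = P -> P *m f = P -> f *m Q = Q -> Q *m e = Q ->
  mxin (@jacobson_radical B) (P *m Q - e) -> mxin (@jacobson_radical B) (Q *m P - f) ->
  exists Q', [/\ f *m Q' = Q', Q' *m e = Q', P *m Q' = e & Q' *m P = f].
Proof.
move=> ff ee eP Pf fQ Qe hx hx'.
have [w [w1 _]] := mx_invertible1 hx; have [w' [_ w'1]] := mx_invertible1 hx'.
have Pw : P *m (Q *m w) = e.
  rewrite mulmxA -[P *m Q](subrK e) addrC.
  have -> : e + (P *m Q - e) = e *m (1%:M + (P *m Q - e)).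
    by rewrite mulmxDr mulmx1 mulmxBr mulmxA eP ee.
  by rewrite -mulmxA w1 mulmx1.
have wP : w' *m Q *m P = f.
  rewrite -mulmxA -[Q *m P](subrK f) addrC.
  have -> : f + (Q *m P - f) = (1%:M + (Q *m P - f)) *m f.
    by rewrite mulmxDl mul1mx mulmxBl -mulmxA Pf ff.
  by rewrite mulmxA w'1 mul1mx.
pose Q' := f *m (Q *m w) *m e.
have PQ' : P *m Q' = e by rewrite /Q' !mulmxA Pf -(mulmxA P) Pw ee.
have fQ' : f *m Q' = Q' by rewrite /Q' !mulmxA ff.
exists Q'; split=> //; first by rewrite /Q' -!mulmxA ee.
by rewrite -fQ' -wP -(mulmxA _ P) PQ' -!mulmxA eP mulmxA wP.
Qed.

Lemma blockdiag_inverse r (gr : 'I_r -> bool) (u v : 'M[B]_r) :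
  blockdiag gr gr u -> u *m v = 1%:M -> v *m u = 1%:M -> blockdiag gr gr v.
Proof.
move=> bu uv vu.
pose v0 := \matrix_(i, j) (if gr i == gr j then v i j else 0).
suff -> : v = v0 by move=> i j ne; rewrite mxE (negbTE ne).
rewrite -[v0]mul1mx -vu -mulmxA (_ : u *m v0 = 1%:M) ?mulmx1 //.
apply/matrixP => i j; have [e|ne] := eqVneq (gr i) (gr j).
  rewrite -uv !mxE; apply: eq_bigr => k _; rewrite mxE.
  have [ik|ik] := eqVneq (gr i) (gr k); last by rewrite bu ?mul0r.
  by rewrite -ik e eqxx.
rewrite [RHS]mxE; have -> : (i == j) = false by apply: contraNF ne => /eqP ->.
rewrite mxE big1 // => k _; rewrite mxE.
have [ik|ik] := eqVneq (gr i) (gr k); last by rewrite bu ?mul0r.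
by rewrite -ik (negbTE ne) mulr0.
Qed.

Lemma blockdiag1 r (gr : 'I_r -> bool) : blockdiag gr gr (1%:M : 'M[B]_r).
Proof. by move=> i j ne; rewrite mxE; case: eqVneq => // ij; rewrite ij eqxx in ne. Qed.

Lemma blockdiagD m n gr gc (X Y : 'M[B]_(m, n)) :
  blockdiag gr gc X -> blockdiag gr gc Y -> blockdiag gr gc (X + Y).
Proof. by move=> hX hY i j ne; rewrite mxE hX ?hY ?addr0. Qed.

Lemma blockdiagN m n gr gc (X : 'M[B]_(m, n)) :
  blockdiag gr gc X -> blockdiag gr gc (- X).
Proof. by move=> hX i j ne; rewrite mxE hX ?oppr0. Qed.

Lemma blockdiag_map (B' : comPzRingType) (q : {rmorphism B -> B'}) m n gr gc
  (X : 'M[B]_(m, n)) : blockdiag gr gc X -> blockdiag gr gc (map_mx q X).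
Proof. by move=> hX i j ne; rewrite mxE hX ?rmorph0. Qed.

Section Newton.
Variables (I : set B) (hI : ideal I) (complete : adic_complete I).

Lemma newton_step r (a : 'M[B]_r) (d := a *m a - a) (f := a + d - 2%:R *: (a *m d)) :
  f *m f - f = 4%:R *: (d *m (d *m d)) - 3%:R *: (d *m d).
Proof.
have aa : a *m a = a + d by rewrite /d addrC subrK.
have da : d *m a = a *m d by rewrite /d mulmxBl mulmxBr mulmxA.
rewrite /f; move: (d) aa da => {f d} d aa da.
set x := a *m d; set y := d *m d; set z := a *m y.
have ax : a *m x = x + y by rewrite mulmxA aa mulmxDl.
have dx : d *m x = z by rewrite mulmxA da -mulmxA.
have xa : x *m a = x + y by rewrite -mulmxA da ax.
have xd : x *m d = z by rewrite -mulmxA.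
have xx : x *m x = z + d *m y by rewrite {1}/x -mulmxA dx /z mulmxA aa mulmxDl.
rewrite !mulmxDl !mulmxDr !mulNmx !mulmxN -!scalemxAl -!scalemxAr.
rewrite aa da ax dx xa xd xx -/y.
by move: (d *m y) => t; mx_ring.
Qed.

(** Newton iteration: [f = 3 a^2 - 2 a^3] squares the defect of idempotence. *)
Lemma lift_idempotent r (gr : 'I_r -> bool) (a : 'M[B]_r) :
  blockdiag gr gr a -> mxin I (a *m a - a) ->
  exists e, [/\ e *m e = e, blockdiag gr gr e & mxin I (e - a)].
Proof.
move=> ba da.
pose f (a : 'M[B]_r) := a + (a *m a - a) - 2%:R *: (a *m (a *m a - a)).
pose s n := iter n f a.
have bf x : blockdiag gr gr x -> blockdiag gr gr (f x).
  move=> bx; have bd : blockdiag gr gr (x *m x - x).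
    exact: (blockdiagD (blockdiagM bx bx) (blockdiagN bx)).
  apply: (blockdiagD (blockdiagD bx bd)); apply: blockdiagN => i j ne; rewrite mxE.
  by rewrite (blockdiagM bx bd) ?mulr0.
have bs n : blockdiag gr gr (s n) by elim: n => [|n IH] //; apply: bf.
have hP n := ideal_pow_ideal I n.
have ds n : mxin (ideal_pow I n.+1) (s n *m s n - s n).
  elim: n => [|n IH].
    move=> i j; rewrite -[X in ideal_pow _ _ X]mulr1.
    by apply: ideal_powMS; [exact: da | exact: ideal_pow0].
  rewrite /s iterS -/(s n) /f newton_step; move: (_ - s n) IH => d hd.
  have dd : mxin (ideal_pow I n.+2) (d *m d).
    move=> i j; rewrite mxE; apply: ideal_sum => // k _.
    by apply: ideal_powMS => //; apply: (ideal_pow_sub hI (hd i k)).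
  apply: (mxinB (hP _)); apply: (mxinZ (hP _)) => //.
  exact: (mxinMl (hP _)).
have ss n : mxin (ideal_pow I n.+1) (s n.+1 - s n).
  have -> : s n.+1 - s n = (s n *m s n - s n) - 2%:R *: (s n *m (s n *m s n - s n)).
    by rewrite /s iterS -/(s n) /f; move: (s n *m _) => ?; mx_ring.
  apply: (mxinB (hP _)); first exact: ds.
  by apply: (mxinZ (hP _)); apply: (mxinMl (hP _)).
have /choice[e0 e0P] (ij : 'I_r * 'I_r) :
    exists e, forall n, ideal_pow I n (e - s n ij.1 ij.2).
  have [|e [eE _]] := complete (x := fun n => s n ij.1 ij.2); last by exists e.
  move=> n; have := ss n ij.1 ij.2; rewrite !mxE; exact: ideal_powS.
pose e := \matrix_(i, j) e0 (i, j).
have es n : mxin (ideal_pow I n) (e - s n).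
  by move=> i j; rewrite !mxE; apply: (e0P (i, j)).
have sep x : (forall n, ideal_pow I n x) -> x = 0.
  move=> hx; have [|z [_ zu]] := complete (x := fun=> 0).
    by move=> n; rewrite subrr; apply: ideal0.
  rewrite -(zu x) ?(zu 0) // => n; rewrite subr0 //.
  exact: ideal0.
exists e; split.
- apply/eqP; rewrite -subr_eq0; apply/eqP/matrixP => i j; rewrite [RHS]mxE.
  apply: sep => n; suff h : mxin (ideal_pow I n) (e *m e - e) by apply: h.
  have -> : e *m e - e = (e - s n) *m e + s n *m (e - s n) + (s n *m s n - s n) - (e - s n).
    by rewrite mulmxBl mulmxBr; move: (_ *m _) (_ *m _) (_ *m _) => *; mx_ring.
  apply: (mxinB (hP _)) => //; apply: (mxinD (hP _)).
    by apply: (mxinD (hP _)); [apply: (mxinMr (hP _)) | apply: (mxinMl (hP _))].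
  by move=> k l; apply/ideal_powS/ds.
- move=> i j ne; rewrite mxE; apply: sep => n.
  by have := e0P (i, j) n; rewrite bs // subr0.
- have -> : e - a = (e - s 1%N) + (s 1%N - s 0%N) by mx_ring.
  apply: (mxinD hI) => i j.
    exact: (@ideal_pow_sub _ _ hI 0 _ (es 1%N i j)).
  exact: (@ideal_pow_sub _ _ hI 0 _ (ss 0%N i j)).
Qed.

End Newton.
End Lifting.

(** * Descent of windows *)

Section Descent.
Variables (p : nat) (p_ge3 : (3 <= p)%N).
Variables (A S : comPzRingType) (FA : frame p A) (FS : frame p S).
Variables (lam : {rmorphism A -> S}) (c ci : S) (E : A) (Fil2 : set S).
Hypothesis cmp : comparison FA FS lam c E Fil2.
Hypothesis cci : c * ci = 1.
Variables (r : nat) (gr : 'I_r -> bool).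

Local Notation dd := (ddag FS c ci gr gr).
Local Notation filS := (filmx FS gr gr).
Local Notation jacA := (@jacobson_radical A).
Local Notation jacS := (@jacobson_radical S).
Local Notation "X ^l" := (map_mx lam X) (at level 2, format "X ^l").

Lemma ddagM X Y : filS X -> filS Y -> dd (X *m Y) = dd X *m dd Y.
Proof.
move=> hX hY; rewrite /ddag (dagM hX hY) -!mulmxA; congr (_ *m (_ *m _)).
by rewrite !mulmxA (twKr cci) mul1mx.
Qed.

Lemma pE_ideal_jac n : (0 < n)%N -> pE_ideal p E n `<=` jacA.
Proof.
have hJ := @jacobson_ideal A.
move=> n0 _ /pE_idealP[u [v ->]]; apply: (idealD hJ); apply: (idealMr _ hJ).
  exact: fr_p_jac FA.
case: n n0 => // n _; rewrite exprS; apply: (idealMr _ hJ).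
apply: (fr_Fil_jac (F := FA)); rewrite (cm_A_Fil cmp).
by move: (principalM E 1); rewrite mulr1.
Qed.

Lemma Fil2_jac : Fil2 `<=` jacS.
Proof. by move=> z /(cm_Fil2_Fil cmp)/fr_Fil_jac. Qed.

Lemma p_jac (B : comPzRingType) (F : frame p B) m n (X : 'M[B]_(m, n)) :
  mxin (@jacobson_radical B) (p%:R *: X).
Proof.
by move=> i j; rewrite mxE; apply: (idealMr _ (@jacobson_ideal B)); exact: fr_p_jac F.
Qed.

(** The block from [L] to [N] of the inverse is again in [Fil S], because the
    block of [g] on [N] is the identity modulo the radical. *)
Lemma inverse_filmx (F' : frame p S) (e g G : 'M[S]_r) : blockdiag gr gr e ->
  e *m G = G -> g *m G = e -> filmx F' gr gr g -> mxin jacS (g - e) ->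
  filmx F' gr gr G.
Proof.
move=> be eG gG fg ge.
have hF := fr_Fil_ideal F'.
pose Y := \matrix_(i, j) (if ~~ gr i && gr j then G i j else 0).
pose nu := \matrix_(i, j) (if ~~ gr i && ~~ gr j then (g - e) i j else 0).
have jnu : mxin jacS nu.
  move=> i j; rewrite mxE; case: ifP => _; [exact: ge | exact: ideal0 (@jacobson_ideal _)].
have [v [_ v1]] := mx_invertible1 jnu.
suff FY : mxin (fr_Fil F') ((1%:M + nu) *m Y).
  have YE : Y = v *m ((1%:M + nu) *m Y) by rewrite mulmxA v1 mul1mx.
  move=> i j bi bj; have := mxinMl hF v FY i j; rewrite -YE mxE bi bj.
  by [].
move=> i j; case bi: (gr i).
  rewrite mxE big1 => [|k _]; first exact: ideal0.
  rewrite [Y k j]mxE [(1%:M + nu) i k]mxE [nu i k]mxE bi /= addr0 mxE.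
  case: eqVneq => [<-|_]; first by rewrite bi /= mulr0.
  by rewrite mul0r.
case bj: (gr j); last first.
  rewrite mxE big1 => [|k _]; first exact: ideal0.
  by rewrite [Y k j]mxE bj andbF mulr0.
have -> : ((1%:M + nu) *m Y) i j = \sum_(k | ~~ gr k) g i k * G k j.
  rewrite mulmxDl mul1mx mxE [Y i j]mxE bi bj /= -{1}eG mxE [in X in _ + X]mxE.
  rewrite [X in X + _](bigID (fun k => gr k)) /= [X in (X + _) + _]big1 => [|k gk]; last first.
    by rewrite be ?mul0r // bi gk.
  rewrite add0r [X in _ + X](bigID (fun k => gr k)) /= [X in _ + (X + _)]big1 => [|k gk]; last first.
    by rewrite [Y k j]mxE gk /= mulr0.
  rewrite add0r -big_split /=; apply: eq_bigr => k gk.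
  by rewrite [nu i k]mxE [Y k j]mxE bi bj gk /= mxE ?mxE; ring.
have -> : \sum_(k | ~~ gr k) g i k * G k j = - \sum_(k | gr k) g i k * G k j.
  apply/eqP; rewrite -addr_eq0 addrC.
  have : (g *m G) i j = 0 by rewrite gG be // bi bj.
  by rewrite mxE (bigID (fun k => gr k)) /= => /eqP.
apply: idealN => //; apply: ideal_sum => // k gk.
by apply: idealMr => //; apply: fg; rewrite ?bi.
Qed.

Section Core.
Variables (e : 'M[A]_r) (P2 Q2 : 'M[S]_r) (y2 y2' : 'M[S]_r).
Local Notation fe := (map_mx (fr_phi FA) e).
Hypotheses (ee : e *m e = e) (be : blockdiag gr gr e).
Hypotheses (eP2 : e^l *m P2 = P2) (P2e : P2 *m fe^l = P2).
Hypotheses (eQ2 : fe^l *m Q2 = Q2) (Q2e : Q2 *m e^l = Q2).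
Hypotheses (PQ2 : P2 *m Q2 = e^l + p%:R *: y2).
Hypotheses (QP2 : Q2 *m P2 = fe^l + p%:R *: y2').

Let ff : fe *m fe = fe. Proof. by rewrite -map_mxM ee. Qed.
Let eel : e^l *m e^l = e^l. Proof. by rewrite -map_mxM ee. Qed.
Let bel : blockdiag gr gr e^l. Proof. exact: blockdiag_map. Qed.
Let fel : filS e^l. Proof. exact: blockdiag_filmx. Qed.
Let hZ := cm_Fil2_ideal cmp.

Let dde : dd e^l = fe^l.
Proof.
rewrite (ddag_map cmp cci); last exact: blockdiag_filmx.
by rewrite dag_blockdiag.
Qed.

(** As [Fil2] is an ideal, a decomposition may be multiplied by the idempotents. *)
Let sandwich (X : 'M[S]_r) (a b : 'M[A]_r) : a^l *m X = X -> X *m b^l = X ->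
  a *m a = a -> b *m b = b ->
  exists h z, [/\ a *m h = h, h *m b = h, mxin Fil2 z & X = h^l + z] /\
    a^l *m z = z /\ z *m b^l = z.
Proof.
move=> aX Xb aa bb; have [h [z [Zz XE]]] := mx_decomp_any cmp X.
have aal : a^l *m a^l = a^l by rewrite -map_mxM aa.
have bbl : b^l *m b^l = b^l by rewrite -map_mxM bb.
exists (a *m h *m b), (a^l *m z *m b^l); split; last first.
  by split; rewrite ?mulmxA ?aal // -mulmxA bbl.
split; first by rewrite !mulmxA aa.
- by rewrite -mulmxA bb.
- by apply: (mxinMr hZ); apply: (mxinMl hZ).
- by rewrite !map_mxM -{1}Xb -{1}aX XE mulmxDr mulmxDl.
Qed.

(** A matrix [P0] over [A] congruent to [P2] modulo [p] and [Fil2] is invertible, and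
    [P2 *m Q0] is congruent to the identity modulo [Fil2], which [dd] kills modulo
    [p]: it is an isomorphism of windows modulo [p]. *)
Let first_approx : exists P0 Q0 z y,
  [/\ e *m P0 = P0, P0 *m fe = P0, fe *m Q0 = Q0 & Q0 *m e = Q0] /\
  [/\ P0 *m Q0 = e, Q0 *m P0 = fe, mxin Fil2 z, P2 *m Q0^l = e^l + z &
    P2 *m Q0^l *m P0^l - P2 *m dd (P2 *m Q0^l) = p%:R *: y].
Proof.
have [P0 [z [[eP0 P0e Zz P2E] _]]] := sandwich eP2 P2e ee ff.
have [Q0 [z' [[eQ0 Q0e Zz' Q2E] _]]] := sandwich eQ2 Q2e ff ee.
have near (X Y : 'M[S]_r) (a b d : 'M[A]_r) (x x' y : 'M[S]_r) : mxin Fil2 x -> mxin Fil2 x' ->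
    X = a^l + x -> Y = b^l + x' -> X *m Y = d^l + p%:R *: y ->
    mxin jacA (a *m b - d).
  move=> Zx Zx' XE YE XY; apply: (mxin_sub (pE_ideal_jac (isT : (0 < 2)%N))).
  apply: (mx_lam_Fil2 cmp (z := - (a^l *m x' + x *m b^l + x *m x')) (Y := y)).
    apply: (mxinN hZ); apply: (mxinD hZ); last exact: (mxinMl hZ).
    by apply: (mxinD hZ); [apply: (mxinMl hZ) | apply: (mxinMr hZ)].
  rewrite map_mxB map_mxM; have := XY; rewrite XE YE mulmxDl !mulmxDr => h.
  have -> : a^l *m b^l = d^l + p%:R *: y - (a^l *m x' + x *m b^l + x *m x').
    by rewrite -h; move: (_ *m _) (_ *m _) (_ *m _) (_ *m _) => *; mx_ring.
  by move: (_ *m _) (_ *m _) (_ *m _) => *; mx_ring.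
have [|Q [fQ Qe PQ QP]] := invertible_mod_rad ff ee eP0 P0e eQ0 Q0e (near _ _ _ _ _ _ _ _ Zz Zz' P2E Q2E PQ2).
  exact: (near _ _ _ _ _ _ _ _ Zz' Zz Q2E P2E QP2).
have Zw : mxin Fil2 (z *m Q^l) by apply: (mxinMr hZ).
have [y yE] := ddag_Fil2 ci cmp gr gr Zw.
have gE : P2 *m Q^l = e^l + z *m Q^l by rewrite P2E mulmxDl -map_mxM PQ.
exists P0, Q, (z *m Q^l), (- (P2 *m y)); split; split=> //.
rewrite -mulmxA -map_mxM QP P2e gE ddagD //; last exact: (Fil2_filmx cmp).
by rewrite dde yE mulmxDr P2e opprD addNKr -scalemxAr scalerN.
Qed.

Let dd_e g : filS g -> g *m e^l = g -> dd g *m fe^l = dd g.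
Proof. by move=> fg ge; rewrite -dde -ddagM // ge. Qed.

(** The isomorphism modulo [p] is corrected one power of [p] at a time; at each
    stage the error decomposes as [lam k + z], where [k] modifies the matrix over
    [A] and [z], being killed by [dd] modulo [p], modifies the isomorphism. *)
Lemma window_descent : exists P Q g G,
  [/\ e *m P = P, P *m fe = P, fe *m Q = Q & Q *m e = Q] /\
  [/\ P *m Q = e, Q *m P = fe, g *m e^l = g & e^l *m g = g] /\
  [/\ G *m e^l = G, e^l *m G = G, g *m G = e^l & G *m g = e^l] /\
  [/\ filS g, filS G & g *m P^l = P2 *m dd g].
Proof.
have [P0 [Q0 [z1 [y1 [[eP0 P0e eQ0 Q0e] [PQ0 QP0 Zz1]]]]]] := first_approx.
set g1 := P2 *m Q0^l => g1E err1.
have eg1 : e^l *m g1 = g1 by rewrite mulmxA eP2.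
have g1e : g1 *m e^l = g1 by rewrite -mulmxA -map_mxM Q0e.
have fg1 : filS g1 by rewrite g1E; apply: filmxD => //; apply: (Fil2_filmx cmp).
clearbody g1.
have hJ := @jacobson_ideal S.
have jz : mxin jacS z1 by apply: mxin_sub Zz1; exact: Fil2_jac.
have inv_g g W : e^l *m g = g -> g *m e^l = g -> g = g1 + p%:R *: W ->
    exists G, [/\ e^l *m G = G, G *m e^l = G, g *m G = e^l & G *m g = e^l].
  move=> eg ge gW.
  have jg : mxin jacS (g - e^l).
    have -> : g - e^l = z1 + p%:R *: W by rewrite gW g1E; mx_ring.
    by apply: (mxinD hJ) => //; apply: (p_jac FS).
  by apply: (invertible_mod_rad eel eel eg ge eel eel); rewrite ?eg ?ge.
have [G1 [eG1 G1e gG1 Gg1]] : exists G, [/\ e^l *m G = G, G *m e^l = G,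
    g1 *m G = e^l & G *m g1 = e^l].
  by apply: (inv_g g1 0) => //; rewrite scaler0 addr0.
pose T := (nat * ('M[A]_r * 'M[S]_r))%type.
pose inv (t : T) := let: (n, (P, g)) := t in
  [/\ e *m P = P, P *m fe = P, e^l *m g = g & g *m e^l = g] /\
  [/\ filS g, exists K, P = P0 + p%:R *: K, exists W, g = g1 + p%:R *: W
    & exists y, g *m P^l - P2 *m dd g = p%:R ^+ n.+1 *: y].
pose rel (t : T) (kw : 'M[A]_r * 'M[S]_r) (t' : T) :=
  [/\ t'.1 = t.1.+1, t'.2.1 = t.2.1 + p%:R ^+ t.1.+1 *: kw.1,
      t'.2.2 = t.2.2 + p%:R ^+ t.1.+1 *: kw.2 & mxin Fil2 kw.2].
have [||kw [s [s0 hs]]] := @iterate_step _ _ inv rel (0%N, (P0, g1)).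
- split=> //; split=> //.
  + by exists 0; rewrite scaler0 addr0.
  + by exists 0; rewrite scaler0 addr0.
  + by exists y1; rewrite expr1.
- move=> [n [P g]] [[eP Pe eg ge] [fg [K PK] [W gW] [y yE]]].
  have ey : e^l *m y = y.
    apply: (scaleS_I cmp (k := n.+1)).
    by rewrite scalemxAr -yE mulmxBr !mulmxA eg eP2.
  have ye : y *m fe^l = y.
    apply: (scaleS_I cmp (k := n.+1)).
    by rewrite scalemxAl -yE mulmxBl -(mulmxA g) -(mulmxA P2) -map_mxM Pe dd_e.
  have [||k [z [[ek ke Zz kz] [ez ze]]]] := sandwich (X := - (G1 *m y)) _ _ ee ff.
  + by rewrite mulmxN mulmxA eG1.
  + by rewrite mulNmx -mulmxA ye.
  pose w := g1 *m z *m Q0^l.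
  have Zw : mxin Fil2 w by apply: (mxinMr hZ); apply: (mxinMl hZ).
  have fw : filS w := Fil2_filmx cmp Zw.
  have [u uE] := ddag_Fil2 ci cmp gr gr Zw.
  pose q : S := p%:R ^+ n.+1.
  exists (k, w), (n.+1, (P + p%:R ^+ n.+1 *: k, g + q *: w)); split; last by split.
  split; first split.
  + by rewrite mulmxDr -scalemxAr eP ek.
  + by rewrite mulmxDl -scalemxAl Pe ke.
  + by rewrite mulmxDr -scalemxAr eg /w !mulmxA eg1.
  + by rewrite mulmxDl -scalemxAl ge /w -[_ *m Q0^l *m _]mulmxA -map_mxM Q0e.
  split.
  + by apply: filmxD => //; apply: filmxZ.
  + by exists (K + p%:R ^+ n *: k); rewrite PK scalerDr scalerA -exprS addrA.
  + by exists (W + p%:R ^+ n *: w); rewrite gW scalerDr scalerA -exprS addrA.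
  + exists (W *m k^l + w *m K^l + p%:R ^+ n *: (w *m k^l) - P2 *m u).
    rewrite map_mxD map_lamZ -/q ddagD //; last exact: filmxZ.
    rewrite ddagZ // -/q uE.
    have wP0 : w *m P0^l = g1 *m z by rewrite /w -mulmxA -map_mxM QP0 -mulmxA ze.
    have gk : g1 *m k^l = - y - g1 *m z.
      have -> : k^l = - (G1 *m y) - z by rewrite kz addrK.
      by rewrite mulmxBr mulmxN mulmxA gG1 ey.
    have gk' : g *m k^l = - y - g1 *m z + p%:R *: (W *m k^l).
      by rewrite gW mulmxDl gk -scalemxAl.
    have wP : w *m P^l = g1 *m z + p%:R *: (w *m K^l).
      by rewrite PK map_mxD map_lam_pZ mulmxDr wP0 -scalemxAr.
    rewrite !(mulmxDr, mulmxDl) -!scalemxAl -!scalemxAr gk' wP.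
    have -> : g *m P^l = P2 *m dd g + q *: y by rewrite -yE addrC subrK.
    rewrite exprSr -/q /q exprS.
    move: (P2 *m dd g) (g1 *m z) (W *m _) (w *m k^l) (w *m _) (P2 *m u) => *.
    by mx_ring.
have [K KE] := mx_lim (cm_A_lim cmp) (fun n => (kw n).1).
have [W WE] := mx_lim (cm_S_lim cmp) (fun n => (kw n).2).
pose P := P0 + p%:R *: K; pose g := g1 + p%:R *: W.
have sn n : (s n).1 = n.
  by elim: n => [|n IH]; [rewrite s0 | have [_ [-> _ _ _]] := hs n; rewrite IH].
have Zkw n : mxin Fil2 (kw n).2 by have [_ []] := hs n.
have fkw n : filS (kw n).2 := Fil2_filmx cmp (Zkw n).
have fW : filS W := filS_lim (t := fun n => (kw n).2) cmp fkw WE.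
have sP n : (s n).2.1 = P0 + p%:R *: \sum_(i < n) p%:R ^+ i *: (kw i).1.
  elim: n => [|n IH]; first by rewrite s0 big_ord0 scaler0 addr0.
  have [_ [_ -> _ _]] := hs n.
  by rewrite IH sn big_ord_recr /= scalerDr scalerA -exprS addrA.
have sg n : (s n).2.2 = g1 + p%:R *: \sum_(i < n) p%:R ^+ i *: (kw i).2.
  elim: n => [|n IH]; first by rewrite s0 big_ord0 scaler0 addr0.
  have [_ [_ _ -> _]] := hs n.
  by rewrite IH sn big_ord_recr /= scalerDr scalerA -exprS addrA.
have Pn n : exists Y, P = (s n).2.1 + p%:R ^+ n *: Y.
  have [Y YE] := KE n; exists (p%:R *: Y).
  by rewrite sP /P {1}YE scalerDr addrA scalerA [p%:R * _]mulrC -scalerA.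
have gn n : exists Y, filS Y /\ g = (s n).2.2 + p%:R ^+ n *: Y.
  have [Y YE] := WE n; exists (p%:R *: Y).
  have gE : g = (s n).2.2 + p%:R ^+ n *: (p%:R *: Y).
    by rewrite sg /g {1}YE scalerDr addrA scalerA [p%:R * _]mulrC -scalerA.
  split=> //; apply: (filmxS_p cmp (n := n)).
  rewrite -[_ *: _](addKr (s n).2.2) -gE addrC; apply: filmxB.
    by apply: filmxD => //; apply: filmxZ.
  by have [] := hs n; case: (s n) => m [P' g'] [_ []].
have snE n : s n = (n, ((s n).2.1, (s n).2.2)).
  by rewrite -{2}(sn n); case: (s n) => ? [].
have invn n : inv (n, ((s n).2.1, (s n).2.2)) by rewrite -snE; have [] := hs n.
have eP : e *m P = P.
  apply: (eq_mod_all_A cmp) => n; have [Y YE] := Pn n; have [[h _ _ _] _] := invn n.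
  by exists (e *m Y - Y); rewrite YE mulmxDr h -scalemxAr; move: (_ *m Y) => ?; mx_ring.
have Pe : P *m fe = P.
  apply: (eq_mod_all_A cmp) => n; have [Y YE] := Pn n; have [[_ h _ _] _] := invn n.
  by exists (Y *m fe - Y); rewrite YE mulmxDl h -scalemxAl; move: (Y *m _) => ?; mx_ring.
have eg : e^l *m g = g.
  apply: (eq_mod_all_S cmp) => n; have [Y [_ YE]] := gn n; have [[_ _ h _] _] := invn n.
  by exists (e^l *m Y - Y); rewrite YE mulmxDr h -scalemxAr; move: (_ *m Y) => ?; mx_ring.
have ge : g *m e^l = g.
  apply: (eq_mod_all_S cmp) => n; have [Y [_ YE]] := gn n; have [[_ _ _ h] _] := invn n.
  by exists (Y *m e^l - Y); rewrite YE mulmxDl h -scalemxAl; move: (Y *m _) => ?; mx_ring.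
have fg : filS g by apply: filmxD => //; apply: filmxZ.
have gP : g *m P^l = P2 *m dd g.
  apply: (eq_mod_all_S cmp) => n; have [Y [fY YE]] := gn n; have [Y' YE'] := Pn n.
  have [_ [fs _ _ [y yE]]] := invn n.
  exists (Y *m P^l + (s n).2.2 *m Y'^l + p%:R *: y - P2 *m dd Y).
  rewrite {1 2}YE mulmxDl -scalemxAl ddagD //; last exact: filmxZ.
  rewrite ddagZ // mulmxDr -scalemxAr {1}YE' map_mxD map_lamZ mulmxDr -scalemxAr.
  have -> : (s n).2.2 *m (s n).2.1^l = P2 *m dd (s n).2.2 + p%:R ^+ n.+1 *: y.
    by rewrite -yE addrC subrK.
  rewrite exprSr; move: (P2 *m _) (P2 *m _) (Y *m _) (_ *m Y'^l) => *.
  by mx_ring.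
have [G [eG Ge gG Gg]] := inv_g g W eg ge (erefl _).
have [||Q [fQ Qe PQ QP]] := invertible_mod_rad ff ee eP Pe eQ0 Q0e.
- rewrite /P mulmxDl -scalemxAl PQ0 addrC addKr; exact: (p_jac FA).
- rewrite /P mulmxDr -scalemxAr QP0 addrC addKr; exact: (p_jac FA).
exists P, Q, g, G; split=> //; split=> //; split=> //; split=> //.
apply: (inverse_filmx bel eG gG fg).
have -> : g - e^l = z1 + p%:R *: W by rewrite /g g1E; mx_ring.
by apply: (mxinD hJ) => //; apply: (p_jac FS).
Qed.

End Core.
End Descent.

(** * Reduction modulo powers of [p] *)

(** With [t = 0] and [q] the identity this covers the frames themselves, so that they
    and their reductions modulo [p^n] are treated together. *)
Definition reduction (t p : nat) (S S' : comPzRingType) (F : frame p S)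
    (F' : frame p S') (q : {rmorphism S -> S'}) : Prop :=
  [/\ quotient_map (principal t%:R) q,
      fr_Fil F' = q @` fr_Fil F,
      forall x, fr_phi F' (q x) = q (fr_phi F x),
      forall x, fr_Fil F x -> fr_phi1 F' (q x) = q (fr_phi1 F x)
    & fr_varpi F' = q (fr_varpi F)].

Section Reduction.
Variables (t p : nat) (S S' : comPzRingType) (F : frame p S) (F' : frame p S').
Variable q : {rmorphism S -> S'}.
Hypothesis red : reduction t F F' q.

Lemma red_lift m n (X' : 'M[S']_(m, n)) : exists X, map_mx q X = X'.
Proof.
case: red => [[qs _] _ _ _ _].
have /choice[f fE] (ij : 'I_m * 'I_n) : exists x, q x = X' ij.1 ij.2 by apply: qs.
by exists (\matrix_(i, j) f (i, j)); apply/matrixP => i j; rewrite !mxE fE.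
Qed.

Lemma red_lift_block m n gr gc (X' : 'M[S']_(m, n)) : blockdiag gr gc X' ->
  exists X, blockdiag gr gc X /\ map_mx q X = X'.
Proof.
move=> bX; have [X XE] := red_lift X'.
exists (\matrix_(i, j) (if gr i == gc j then X i j else 0)); split.
  by move=> i j ne; rewrite mxE (negbTE ne).
apply/matrixP => i j; rewrite -XE !mxE; case: eqVneq => // ne.
by rewrite rmorph0; have := bX i j ne; rewrite -XE mxE.
Qed.

Lemma red_lift_fil m n gr gc (X' : 'M[S']_(m, n)) : filmx F' gr gc X' ->
  exists X, filmx F gr gc X /\ map_mx q X = X'.
Proof.
case: red => [[qs _] FE _ _ _] fX.
have /choice[f fE] (ij : 'I_m * 'I_n) : exists x,
    fil_entry F (gr ij.1) (gc ij.2) x /\ q x = X' ij.1 ij.2.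
  have := fX ij.1 ij.2; rewrite /fil_entry FE; have [y yE] := qs (X' ij.1 ij.2).
  case: (gr _); case: (gc _) => h; try by exists y.
  by have [x Fx xE] := h isT isT; exists x.
exists (\matrix_(i, j) f (i, j)); split.
  by move=> i j; rewrite mxE; have [] := fE (i, j).
by apply/matrixP => i j; rewrite !mxE; have [_ ->] := fE (i, j).
Qed.

Lemma red_t m n (Y : 'M[S]_(m, n)) : map_mx q (t%:R *: Y) = 0.
Proof.
case: red => [[_ q0] _ _ _ _]; apply/matrixP => i j; rewrite !mxE.
by apply/q0; apply: principalM.
Qed.

Lemma red_ker m n (X Y : 'M[S]_(m, n)) : map_mx q X = map_mx q Y ->
  exists W, X = Y + t%:R *: W.
Proof.
case: red => [[_ q0] _ _ _ _] e.
have [|W WE] := @mxin_principal _ t%:R m n (X - Y); last first.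
  by exists W; rewrite -WE addrC subrK.
move=> i j; apply/q0; have /matrixP/(_ i j) := e.
by rewrite !mxE rmorphB => ->; rewrite subrr.
Qed.

Lemma red_filmx m n gr gc (X : 'M[S]_(m, n)) :
  filmx F gr gc X -> filmx F' gr gc (map_mx q X).
Proof.
case: red => _ FE _ _ _ fX i j bi bj; rewrite mxE FE.
by exists (X i j) => //; apply: fX.
Qed.

Lemma red_dag m n gr gc (X : 'M[S]_(m, n)) : filmx F gr gc X ->
  dag F' gr gc (map_mx q X) = map_mx q (dag F gr gc X).
Proof.
case: red => _ _ hphi hphi1 hvarpi fX; apply/matrixP => i j; rewrite !mxE.
have := fX i j; rewrite /fil_entry /dag_entry.
case: (gr i); case: (gc j) => h //=; rewrite ?hphi ?hvarpi ?rmorphM //.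
by apply: hphi1; apply: h.
Qed.

Lemma red_phi m n (X : 'M[S]_(m, n)) :
  map_mx (fr_phi F') (map_mx q X) = map_mx q (map_mx (fr_phi F) X).
Proof. by case: red => _ _ hphi _ _; apply/matrixP => i j; rewrite !mxE. Qed.

End Reduction.

(** The matrix [e f + (1 - e)(1 - f)] is invertible and conjugates [f] into [e]. *)
Lemma close_idempotents (B : comPzRingType) r (gr : 'I_r -> bool) (e f : 'M[B]_r) :
  e *m e = e -> f *m f = f -> blockdiag gr gr e -> blockdiag gr gr f ->
  mxin (@jacobson_radical B) (e - f) -> exists a b,
  [/\ blockdiag gr gr a, blockdiag gr gr b, a *m b = e & b *m a = f] /\
  [/\ e *m a = a, a *m f = a, f *m b = b & b *m e = b].
Proof.
move=> ee ff be bf ef; have hJ := @jacobson_ideal B.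
pose u := e *m f + (1%:M - e) *m (1%:M - f).
have uE : u = e *m f + (1%:M - f - (e - e *m f)).
  by rewrite /u mulmxBl mul1mx mulmxBr mulmx1.
have bu : blockdiag gr gr u.
  rewrite uE; have b1 := @blockdiag1 B r gr; have bef := blockdiagM be bf.
  apply: (blockdiagD bef); apply: blockdiagD.
    exact: (blockdiagD b1 (blockdiagN bf)).
  exact: (blockdiagN (blockdiagD be (blockdiagN bef))).
have ju : mxin (@jacobson_radical B) (u - 1%:M).
  have -> : u - 1%:M = 2%:R *: ((e - f) *m f) - (e - f).
    by rewrite uE mulmxBl ff; move: (_ *m _) => *; mx_ring.
  by apply: (mxinB hJ) => //; apply: (mxinZ hJ); apply: (mxinMr hJ).
have [v [uv vu]] := mx_invertible1 ju.
rewrite addrC subrK in uv vu.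
have uf : u *m f = e *m f.
  by rewrite /u mulmxDl -!mulmxA [(1%:M - f) *m f]mulmxBl mul1mx ff subrr mulmx0 addr0.
have eu : e *m u = e *m f.
  by rewrite /u mulmxDr !mulmxA [e *m (1%:M - e)]mulmxBr mulmx1 ee subrr mul0mx addr0.
have ve : v *m e = f *m v.
  by rewrite -[v *m e]mulmx1 -uv mulmxA -(mulmxA v) eu -uf mulmxA vu mul1mx.
have bv := blockdiag_inverse bu uv vu.
exists (e *m f), (f *m v); split; split.
- exact: blockdiagM be bf.
- exact: blockdiagM bf bv.
- by rewrite mulmxA -(mulmxA e) ff -eu -mulmxA uv mulmx1.
- by rewrite -uf -mulmxA (mulmxA v) vu mul1mx ff.
- by rewrite mulmxA ee.
- by rewrite -mulmxA ff.
- by rewrite mulmxA ff.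
- by rewrite -mulmxA ve mulmxA ff.
Qed.

Lemma tw_block (B : comPzRingType) (x : B) r (gr : 'I_r -> bool) (X : 'M[B]_r) :
  blockdiag gr gr X -> tw x gr *m X = X *m tw x gr.
Proof.
move=> bX; apply/matrixP => i j; rewrite twE Etw.
by case: (eqVneq (gr i) (gr j)) => [->|ne]; [rewrite mulrC | rewrite bX // mul0r mulr0].
Qed.

Lemma dhom_inverse p (S : comPzRingType) (F : frame p S) (X Y : wdatum F) G G' :
  @dhom _ _ F X Y G -> we X *m G' = G' -> G' *m we Y = G' ->
  filmx F (@wgr _ _ _ X) (@wgr _ _ _ Y) G' -> G' *m G = we X -> G *m G' = we Y ->
  @dhom _ _ F Y X G'.
Proof.
move=> [_ _ fG GP] eG Ge fG' G'G GG'; split=> //.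
rewrite -[wP Y]wPe -(dag_blockdiag F (@we_block _ _ _ Y)) -GG' (dagM fG fG').
by rewrite (mulmxA (wP Y)) -GP !mulmxA G'G weP.
Qed.

Section Crystalline.
Variables (p : nat) (p_prime : prime p) (p_ge3 : (3 <= p)%N).
Variables (A S : comPzRingType) (FA : frame p A) (FS : frame p S).
Variables (lam : {rmorphism A -> S}) (c ci : S) (E : A) (Fil2 : set S).
Hypothesis cmp : comparison FA FS lam c E Fil2.
Hypothesis cci : c * ci = 1.
Variables (t : nat) (tP : t = 0%N \/ exists n, t = (p ^ n.+1)%N).
Variables (A' S' : comPzRingType) (FA' : frame p A') (FS' : frame p S').
Variables (qA : {rmorphism A -> A'}) (qS : {rmorphism S -> S'}).
Hypotheses (redA : reduction t FA FA' qA) (redS : reduction t FS FS' qS).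
Variable lam' : {rmorphism A' -> S'}.
Hypothesis lamE : forall a, lam' (qA a) = qS (lam a).

Local Notation c' := (qS c).
Local Notation ci' := (qS ci).

Let cci' : c' * ci' = 1. Proof. by rewrite -rmorphM cci rmorph1. Qed.

Lemma lam'E m n (X : 'M[A]_(m, n)) : map_mx lam' (map_mx qA X) = map_mx qS (map_mx lam X).
Proof. by apply/matrixP => i j; rewrite !mxE lamE. Qed.

Lemma frame_hom_red : frame_hom FA' FS' c' lam'.
Proof.
case: redA => [[qAs _] FAE phiA phi1A varpiA].
case: redS => [_ FSE phiS phi1S varpiS].
have [_ [hphi hF hphi1 hvarpi]] := cm_hom cmp.
split; first by exists ci'.
split.
- by move=> x; have [a <-] := qAs x; rewrite lamE phiS hphi phiA lamE.
- rewrite FAE FSE => _ [_ [a Fa <-] <-]; rewrite lamE.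
  by exists (lam a) => //; apply: hF; exists a.
- rewrite FAE => _ [a Fa <-]; rewrite lamE phi1A // lamE phi1S ?hphi1 ?rmorphM //.
  by apply: hF; exists a.
- by rewrite varpiA lamE hvarpi rmorphM varpiS.
Qed.

Lemma tw_red n (gr : 'I_n -> bool) a : map_mx qS (tw a gr) = tw (qS a) gr.
Proof.
apply/matrixP => i j; rewrite !mxE rmorphMn /tw_entry; congr (_ *+ _).
by case: (gr i); rewrite ?rmorph1.
Qed.

Lemma ddag_red m n gr gc (X : 'M[S]_(m, n)) : filmx FS gr gc X ->
  ddag FS' c' ci' gr gc (map_mx qS X) = map_mx qS (ddag FS c ci gr gc X).
Proof. by move=> fX; rewrite /ddag (red_dag redS fX) !map_mxM !tw_red. Qed.

Let bcd := bc frame_hom_red cci'.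

Lemma t_scale_S m n (X : 'M[S]_(m, n)) : exists Y, t%:R *: X = p%:R *: Y.
Proof.
case: tP => [->|[k ->]]; first by exists 0; rewrite scale0r scaler0.
by exists (p%:R ^+ k *: X); rewrite scalerA natrX exprS.
Qed.

(** The matrices of the windows and the homomorphism are lifted to [A] and [S]; the
    lifted equation holds up to [t y], and surjectivity on [H^1] removes the error. *)
Lemma full_red (X Y : wdatum FA') G' : @dhom _ _ FS' (bcd X) (bcd Y) G' ->
  exists2 G, @dhom _ _ FA' X Y G & map_mx lam' G = G'.
Proof.
move=> dG; have := dhom_fix dG; case: dG => _ _ fG' _.
have [P PE] := red_lift redA (wP Y); have [Q QE] := red_lift redA (wQ X).
have [g [fg gE]] := red_lift_fil redS fG'.
pose gX := @wgr _ _ _ X; pose gY := @wgr _ _ _ Y.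
pose U := UA FA gX gY P Q; pose V := US FS lam c ci gX gY P Q.
have VE x : filmx FS gY gX x ->
    map_mx qS (V x) = wP (bcd Y) *m dag FS' gY gX (map_mx qS x) *m wQ (bcd X).
  move=> fx; rewrite /V /US map_mxM map_mxM -(ddag_red fx) /= -PE -QE !lam'E.
  by rewrite /ddag !mulmxA.
rewrite -{1 2}gE -VE // => /(red_ker redS)[y yE].
have [k [z [fz kz]]] := coker_lam ci cmp gX gY P Q y.
pose g2 := g - t%:R *: z.
have ftz : filmx FS gY gX (t%:R *: z) by apply: filmxZ.
have fg2 : filmx FS gY gX g2 by apply: filmxB.
have VtZ : V (t%:R *: z) = t%:R *: V z.
  rewrite /V /US /ddag dagZ // rmorph_nat.
  by rewrite -scalemxAr -scalemxAl -scalemxAr -scalemxAl.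
have g2E : g2 - V g2 = map_mx lam (t%:R *: k).
  rewrite /g2 /V USB // -/V VtZ map_mxZ rmorph_nat {1}yE.
  have -> : map_mx lam k = y - (z - V z) by rewrite kz addrK.
  by move: (V g) (V z) => *; mx_ring.
have [h [fh hk hg]] := lift_fixed p_ge3 cmp cci fg2 g2E.
exists (map_mx qA h); last first.
  by rewrite lam'E hg /g2 map_mxB (red_t redS) subr0.
have fqh : filmx FA' gY gX (map_mx qA h) := red_filmx redA fh.
apply: fix_dhom => //; rewrite (red_dag redA fh) -PE -QE -!map_mxM.
have -> : P *m dag FA gY gX h *m Q = h - t%:R *: k.
  by rewrite -hk /UA; move: (_ *m _) => *; mx_ring.
by rewrite map_mxB (red_t redA) subr0.
Qed.

(** For [t = p^n] a lift of the difference has boundary and image divisible by [t];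
    after division, injectivity on [H^1] shows that it is itself divisible by [t]. *)
Lemma faithful_red (X Y : wdatum FA') G1 G2 : @dhom _ _ FA' X Y G1 ->
  @dhom _ _ FA' X Y G2 -> map_mx lam' G1 = map_mx lam' G2 -> G1 = G2.
Proof.
move=> d1 d2 e12; pose gX := @wgr _ _ _ X; pose gY := @wgr _ _ _ Y.
have f1 : filmx FA' gY gX G1 by case: d1.
have f2 : filmx FA' gY gX G2 by case: d2.
have GE : G1 - G2 = wP Y *m dag FA' gY gX (G1 - G2) *m wQ X.
  by rewrite dagB // mulmxBr mulmxBl -(dhom_fix d1) -(dhom_fix d2).
have [g [fg gE]] := red_lift_fil redA (filmxB f1 f2).
have [P PE] := red_lift redA (wP Y); have [Q QE] := red_lift redA (wQ X).
pose U := UA FA gX gY P Q; pose V := US FS lam c ci gX gY P Q.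
have [k kE] : exists k, g = U g + t%:R *: k.
  apply: (red_ker redA); rewrite gE {1}GE -gE (red_dag redA fg) -PE -QE.
  by rewrite -!map_mxM.
have [s sE] : exists s, map_mx lam g = 0 + t%:R *: s.
  apply: (red_ker redS); rewrite -lam'E gE map_mxB e12 subrr.
  by rewrite map_mx0.
rewrite add0r in sE.
have [h hE] : exists h, g = t%:R *: h.
  case: tP => [t0|[n tE]].
    exists 0; rewrite scaler0; apply: (fixed_lam_inj p_ge3 cmp fg (P := P) (Q := Q)).
      by rewrite {2}kE t0 scale0r addr0.
    by rewrite sE t0 scale0r.
  have tX : t%:R = p%:R ^+ n.+1 :> A by rewrite tE natrX.
  have tXS : t%:R = p%:R ^+ n.+1 :> S by rewrite tE natrX.
  have fs : filmx FS gY gX s.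
    apply: (filmxS_p cmp (n := n.+1)); rewrite -tXS -sE.
    exact: map_lam_filmx cmp _ _ _ _ _ fg.
  have sk : s - V s = map_mx lam k.
    apply: (scaleS_I cmp (k := n.+1)); rewrite scalerBr /V -(USZ _ _ _ _ _ _ fs) -tXS -sE.
    rewrite (US_map cmp cci _ _ fg) -map_mxB -(rmorph_nat lam) -map_mxZ.
    by rewrite {1}kE addrC addKr.
  have [h [fh hk hs]] := lift_fixed p_ge3 cmp cci fs sk.
  exists h; apply/eqP; rewrite -subr_eq0; apply/eqP.
  have fth : filmx FA gY gX (t%:R *: h) by apply: filmxZ.
  apply: (fixed_lam_inj p_ge3 cmp (filmxB fg fth) (P := P) (Q := Q)).
    rewrite UAB // tX UAZ // -tX -/U {2}kE -hk.
    by rewrite -/U; move: (U g) (U h) => *; mx_ring.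
  by rewrite map_mxB sE map_mxZ rmorph_nat hs subrr.
by apply/eqP; rewrite -subr_eq0 -gE hE (red_t redA).
Qed.

Local Notation "X ^l" := (map_mx lam X) (at level 2, format "X ^l").

(** The rings [A'] and [S'] have the same quotient by [p] and [Fil], so idempotents
    over [S'] come from [A] up to conjugation. *)
Lemma idempotent_descent r (gr : 'I_r -> bool) (f : 'M[S']_r) :
  f *m f = f -> blockdiag gr gr f -> exists e : 'M[A]_r,
  [/\ e *m e = e, blockdiag gr gr e
    & mxin (@jacobson_radical S') (f - map_mx qS e^l)].
Proof.
move=> ff bf; have hZ := cm_Fil2_ideal cmp.
have [F0 [bF0 F0E]] := red_lift_block redS bf.
have [y0 y0E] : exists W, F0 *m F0 = F0 + t%:R *: W.
  by apply: (red_ker redS); rewrite map_mxM F0E ff.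
have [y yE] := t_scale_S y0; rewrite yE in y0E.
have [h [z [Zz FE]]] := mx_decomp_any cmp F0.
pose diag (B : comPzRingType) (X : 'M[B]_r) :=
  \matrix_(i, j) (if gr i == gr j then X i j else 0).
pose a := diag A h; pose z0 := diag S z.
have Zz0 : mxin Fil2 z0.
  by move=> i j; rewrite mxE; case: ifP => _; [apply: Zz | apply: ideal0].
have ba : blockdiag gr gr a by move=> i j ne; rewrite mxE (negbTE ne).
have aE : a^l = F0 - z0.
  apply/matrixP => i j; rewrite !mxE; case: eqVneq => [_|ne].
    by rewrite FE !mxE addrK.
  by rewrite rmorph0 subr0 bF0.
have ha : mxin (pE_ideal p E 2) (a *m a - a).
  apply: (mx_lam_Fil2 cmp (Y := y) (z := z0 *m z0 + z0 - F0 *m z0 - z0 *m F0)).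
    apply: (mxinB hZ); last exact: (mxinMr hZ).
    apply: (mxinB hZ); last exact: (mxinMl hZ).
    by apply: (mxinD hZ) => //; apply: (mxinMl hZ).
  rewrite map_mxB map_mxM aE mulmxBl !mulmxBr y0E.
  by move: (_ *m _) (_ *m _) (_ *m _) => *; mx_ring.
have hI := @ideal_gen_ideal A [set p%:R; E].
have [|e [ee be eI]] := lift_idempotent hI (cm_complete cmp) ba.
  apply: mxin_sub ha => _ /pE_idealP[u [v ->]]; apply: (idealD hI).
    by apply: (idealMr _ hI); apply: gen2a.
  by rewrite exprS -mulrA; apply: (idealMr _ hI); apply: gen2b.
exists e; split=> //.
have hJ := @jacobson_ideal S'.
have FilJ x : fr_Fil FS x -> jacobson_radical (qS x).
  move=> Fx; apply: (fr_Fil_jac (F := FS')).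
  by case: redS => _ -> _ _ _; exists x.
have pJ x : jacobson_radical (qS (p%:R * x)).
  by rewrite rmorphM rmorph_nat; apply: (idealMr _ hJ); exact: (fr_p_jac FS').
have EF : fr_Fil FS (lam E).
  have [_ [_ hF _ _]] := cm_hom cmp; apply: hF; exists E => //.
  by rewrite (cm_A_Fil cmp); move: (principalM E 1); rewrite mulr1.
have -> : f - map_mx qS e^l = map_mx qS z0 - map_mx qS (e - a)^l.
  by rewrite -F0E map_mxB map_mxB aE map_mxB; mx_ring.
apply: (mxinB hJ) => i j.
  by rewrite [map_mx qS z0 i j]mxE; apply: FilJ; apply: (cm_Fil2_Fil cmp); apply: Zz0.
rewrite [X in jacobson_radical X]mxE [X in qS X]mxE.
have [u [v ->]] := gen2P (eI i j).
rewrite rmorphD rmorphM rmorph_nat rmorphD; apply: (idealD hJ); first exact: pJ.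
apply: FilJ; rewrite rmorphM; exact: idealMr (fr_Fil_ideal FS) EF.
Qed.

(** After conjugation the idempotent of [Y] comes from [A]. The structure matrix of
    [Y] is lifted to [S] and descended there. *)
Lemma ess_surj_red (Y : wdatum FS') : exists X G G',
  [/\ @dhom _ _ FS' (bcd X) Y G, @dhom _ _ FS' Y (bcd X) G',
      G *m G' = we Y & G' *m G = we (bcd X)].
Proof.
pose gr := @wgr _ _ _ Y.
have [e [ee be ej]] := idempotent_descent (we_idem Y) (@we_block _ _ _ Y).
pose eb := map_mx qS e^l.
have eeb : eb *m eb = eb by rewrite -map_mxM -map_mxM ee.
have beb : blockdiag gr gr eb by do 2 apply: blockdiag_map.
have [a [b [[ba bb ab ba'] [ea ae fb bf]]]] :=
  close_idempotents (we_idem Y) eeb (@we_block _ _ _ Y) beb ej.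
pose fe := map_mx (fr_phi FA) e.
pose phi' := map_mx (fr_phi FS') : 'M[S']_(wr Y) -> 'M[S']_(wr Y).
have phieb : phi' eb = map_mx qS fe^l.
  by rewrite /phi' (red_phi redS) (map_phi (cm_hom cmp)).
have phiM X1 X2 : phi' (X1 *m X2) = phi' X1 *m phi' X2 by rewrite /phi' map_mxM.
have bphi X1 : blockdiag gr gr X1 -> blockdiag gr gr (phi' X1) by apply: blockdiag_map.
pose P1 := b *m wP Y *m phi' a; pose Q1 := phi' b *m wQ Y *m a.
have P1Q1 : P1 *m Q1 = eb.
  rewrite /P1 /Q1 -(mulmxA (phi' b)) mulmxA -(mulmxA (b *m wP Y)) -phiM ab.
  by rewrite -(mulmxA b) wPe -mulmxA (mulmxA (wP Y)) wPQ mulmxA bf ba'.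
have Q1P1 : Q1 *m P1 = phi' eb.
  rewrite /P1 /Q1 -(mulmxA b) mulmxA -(mulmxA _ a) ab -(mulmxA (phi' b)) wQe.
  rewrite -mulmxA (mulmxA (wQ Y)) wQP -/(phi' (we Y)) -phiM ea -phiM.
  by rewrite ba'.
have eP1 : eb *m P1 = P1 by rewrite /P1 !mulmxA fb.
have P1e : P1 *m phi' eb = P1 by rewrite /P1 -mulmxA -phiM ae.
have eQ1 : phi' eb *m Q1 = Q1 by rewrite /Q1 !mulmxA -phiM fb.
have Q1e : Q1 *m eb = Q1 by rewrite /Q1 -mulmxA ae.
have aP1 : a *m P1 = wP Y *m phi' a by rewrite /P1 !mulmxA ab weP.
clearbody P1 Q1.
pose Pt := P1 *m tw ci' gr; pose Qt := tw c' gr *m Q1.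
have eftw x : phi' eb *m tw x gr = tw x gr *m phi' eb.
  by rewrite -(tw_block _ (bphi _ beb)).
have [P20 P20E] := red_lift redS Pt; have [Q20 Q20E] := red_lift redS Qt.
pose P2 := e^l *m P20 *m fe^l; pose Q2 := fe^l *m Q20 *m e^l.
have P2E : map_mx qS P2 = Pt.
  rewrite /P2 map_mxM map_mxM P20E -phieb /Pt -(mulmxA eb) -(mulmxA P1) -eftw.
  by rewrite (mulmxA P1) P1e mulmxA eP1.
have Q2E : map_mx qS Q2 = Qt.
  rewrite /Q2 map_mxM map_mxM Q20E -phieb /Qt (mulmxA (phi' eb)) eftw.
  by rewrite -(mulmxA (tw _ _)) eQ1 -(mulmxA (tw _ _)) Q1e.
have ffe : fe *m fe = fe by rewrite /fe -map_mxM ee.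
have eP2 : e^l *m P2 = P2 by rewrite /P2 !mulmxA -map_mxM ee.
have P2e : P2 *m fe^l = P2 by rewrite /P2 -mulmxA -map_mxM ffe.
have eQ2 : fe^l *m Q2 = Q2 by rewrite /Q2 !mulmxA -map_mxM ffe.
have Q2e : Q2 *m e^l = Q2 by rewrite /Q2 -mulmxA -map_mxM ee.
have [y PQ2] : exists y, P2 *m Q2 = e^l + p%:R *: y.
  have [|W WE] := red_ker redS (X := P2 *m Q2) (Y := e^l).
    rewrite map_mxM P2E Q2E /Pt /Qt -mulmxA (mulmxA (tw ci' gr)) (twKr cci') mul1mx.
    exact: P1Q1.
  by have [y yE] := t_scale_S W; exists y; rewrite WE yE.
have [y' QP2] : exists y, Q2 *m P2 = fe^l + p%:R *: y.
  have [|W WE] := red_ker redS (X := Q2 *m P2) (Y := fe^l).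
    rewrite map_mxM P2E Q2E /Pt /Qt -mulmxA (mulmxA Q1) Q1P1 eftw mulmxA.
    by rewrite (twKl cci') mul1mx.
  by have [y' yE] := t_scale_S W; exists y'; rewrite WE yE.
have [P [Q [g [G [[eP Pe eQ Qe] [[PQ QP ge eg] [[Ge eG gG Gg] [fg fG gP]]]]]]]] :=
  window_descent cmp cci ee be eP2 P2e eQ2 Q2e PQ2 QP2.
pose qm (M : 'M[A]_(wr Y)) := map_mx qA M.
have qM M N : qm M *m qm N = qm (M *m N) by rewrite /qm map_mxM.
have qphi : map_mx (fr_phi FA') (qm e) = qm fe by rewrite /qm (red_phi redA).
have h1 : qm e *m qm e = qm e by rewrite qM ee.
have h2 : blockdiag gr gr (qm e) by apply: blockdiag_map.
have h3 : qm e *m qm P = qm P by rewrite qM eP.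
have h4 : qm P *m map_mx (fr_phi FA') (qm e) = qm P by rewrite qphi qM Pe.
have h5 : map_mx (fr_phi FA') (qm e) *m qm Q = qm Q by rewrite qphi qM eQ.
have h6 : qm Q *m qm e = qm Q by rewrite qM Qe.
have h7 : qm P *m qm Q = qm e by rewrite qM PQ.
have h8 : qm Q *m qm P = map_mx (fr_phi FA') (qm e) by rewrite qphi qM QP.
pose X := WDatum h1 h2 h3 h4 h5 h6 h7 h8.
have weX : we (bcd X) = eb by rewrite /= lam'E.
have wPX : wP (bcd X) = map_mx qS P^l *m tw c' gr by rewrite /= lam'E.
pose G1 := a *m map_mx qS g; pose G2 := map_mx qS G *m b.
have fqg : filmx FS' gr gr (map_mx qS g) := red_filmx redS fg.
have fqG : filmx FS' gr gr (map_mx qS G) := red_filmx redS fG.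
have fa := blockdiag_filmx FS' ba; have fb' := blockdiag_filmx FS' bb.
have G1G2 : G1 *m G2 = we Y.
  by rewrite /G1 /G2 mulmxA -(mulmxA a) -map_mxM gG -/eb ae ab.
have G2G1 : G2 *m G1 = we (bcd X).
  rewrite weX /G1 /G2 mulmxA -(mulmxA _ b) ba' -mulmxA -map_mxM eg.
  by rewrite -map_mxM Gg.
have d1 : @dhom _ _ FS' (bcd X) Y G1.
  split.
  - by rewrite /G1 mulmxA ea.
  - by rewrite weX /G1 -mulmxA -map_mxM ge.
  - exact: filmxM fa fqg.
  - rewrite wPX /G1 mulmxA -(mulmxA a) -map_mxM gP map_mxM P2E -(ddag_red fg).
    rewrite /ddag /Pt -!mulmxA (twKr cci') mulmx1 (mulmxA (tw ci' gr)) (twKr cci') mul1mx.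
    rewrite mulmxA aP1.
    by rewrite -mulmxA (dagM fa fqg) (dag_blockdiag FS' ba).
exists X, G1, G2; split=> //.
apply: dhom_inverse d1 _ _ _ G2G1 G1G2.
- by rewrite weX /G2 mulmxA -map_mxM eG.
- by rewrite /G2 -mulmxA bf.
- exact: filmxM fqG fb'.
Qed.

Theorem crystalline_reduction : crystalline FA' FS' c' lam'.
Proof.
exact: (crystalline_criterion p_prime full_red faithful_red ess_surj_red).
Qed.

End Crystalline.

(** * The divided power envelope of a principal ideal *)

Section SubringOfSet.
Variables (D : comPzRingType) (U : set D).
Hypotheses (U1 : U 1) (UB : forall x y, U x -> U y -> U (x - y))
  (UM : forall x y, U x -> U y -> U (x * y)).

Definition in_set : {pred D} := fun x => `[< U x >].

Let in_set_subring : subring_closed in_set.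
Proof.
split; rewrite /in_set; first exact/asboolP.
  by move=> x y /asboolP hx /asboolP hy; apply/asboolP/UB.
by move=> x y /asboolP hx /asboolP hy; apply/asboolP/UM.
Qed.

Definition set_ring of U 1 & (forall x y, U x -> U y -> U (x - y))
  & (forall x y, U x -> U y -> U (x * y)) := {x : D | x \in in_set}.
Notation D1 := (set_ring U1 UB UM).

HB.instance Definition _ := GRing.isSubringClosed.Build D in_set in_set_subring.
HB.instance Definition _ := SubChoice.on D1.
HB.instance Definition _ := GRing.SubChoice_isSubComPzRing.Build D in_set D1 (GRing.subringClosedP _).

Lemma set_ringP (x : D1) : U (val x).
Proof. by case: x => d /= /asboolP. Qed.

Lemma mem_in_set d : U d -> d \in in_set.
Proof. by move=> ?; apply/asboolP. Qed.

Definition to_set_ring d (Ud : U d) : D1 := Sub d (mem_in_set Ud).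

End SubringOfSet.

Section Envelope.
Variables (A : comPzRingType) (E : A) (D : comPzRingType) (J : set D).
Variables (gam : nat -> D -> D) (eta : {rmorphism A -> D}).
Hypothesis DP : pd_envelope (principal E) J gam eta.

Definition pd_ge2 : set D :=
  ideal_gen [set y | exists i, (2 <= i)%N /\ y = gam i (eta E)].
Local Notation J2 := pd_ge2.

Let pdJ : pd_structure J gam. Proof. by case: DP. Qed.
Let hJ : ideal J. Proof. by case: pdJ. Qed.
Let x0 := eta E.
Lemma pd_envelope_gen : J (eta E).
Proof.
case: DP => _ h _; apply: h; exists E => //.
by move: (principalM E 1); rewrite mulr1.
Qed.
Let Jx0 : J x0 := pd_envelope_gen.

Let g0 x : J x -> gam 0 x = 1. Proof. by case: pdJ => _ [h _ _ _ _] /h[]. Qed.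
Let g1 x : J x -> gam 1 x = x. Proof. by case: pdJ => _ [h _ _ _ _] /h[]. Qed.
Let gJ n x : J x -> (0 < n)%N -> J (gam n x). Proof. by case: pdJ => _ [_ h _ _ _]; apply: h. Qed.
Let gD n x y : J x -> J y -> gam n (x + y) = \sum_(i < n.+1) gam i x * gam (n - i)%N y.
Proof. by case: pdJ => _ [_ _ h _ _]; apply: h. Qed.
Let gZ n a x : J x -> gam n (a * x) = a ^+ n * gam n x.
Proof. by case: pdJ => _ [_ _ _ h _]; apply: h. Qed.
Let gg m n x : J x -> (0 < n)%N ->
  gam m (gam n x) = ((m * n)`! %/ (m`! * n`! ^ m))%:R * gam (m * n)%N x.
Proof. by case: pdJ => _ [_ _ _ _ [_ h]]; apply: h. Qed.
Let gM m n x : J x -> gam m x * gam n x = 'C(m + n, m)%:R * gam (m + n)%N x.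
Proof. by case: pdJ => _ [_ _ _ _ [h _]]; apply: h. Qed.

Lemma pd_ge2_ideal : ideal J2. Proof. exact: ideal_gen_ideal. Qed.
Let hJ2 := pd_ge2_ideal.

Lemma pd_fact n x : J x -> n`!%:R * gam n x = x ^+ n.
Proof.
move=> Jx; elim: n => [|n IH]; first by rewrite g0 // mulr1.
rewrite exprS -IH mulrCA -{2}(g1 Jx) gM // add1n bin1 factS natrM; ring.
Qed.

Let gam_ge2 i : (2 <= i)%N -> J2 (gam i x0).
Proof. by move=> i2; apply: sub_ideal_gen; exists i. Qed.

Lemma pd_ge2_sub : J2 `<=` J.
Proof.
apply: ideal_gen_min => // _ [i [i2 ->]]; apply: gJ => //.
exact: leq_trans i2.
Qed.

Let U : set D := [set d | exists a j, J2 j /\ d = eta a + j].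
Let V : set D := [set d | exists a j, J2 j /\ d = eta (E * a) + j].

Let VU d : V d -> U d.
Proof. by move=> [a [j [Jj ->]]]; exists (E * a), j. Qed.
Let VJ d : V d -> J d.
Proof.
move=> [a [j [Jj ->]]]; apply: idealD (pd_ge2_sub Jj) => //.
by rewrite rmorphM; apply: idealMr.
Qed.
Let J2V d : J2 d -> V d.
Proof. by move=> Jd; exists 0, d; rewrite mulr0 rmorph0 add0r. Qed.
Let VD x y : V x -> V y -> V (x + y).
Proof.
move=> [a [j [Jj ->]]] [b [k [Jk ->]]]; exists (a + b), (j + k).
by split; [apply: idealD | rewrite mulrDr rmorphD; ring].
Qed.
Let UV x y : U x -> V y -> V (x * y).
Proof.
move=> [a [j [Jj ->]]] [b [k [Jk ->]]].
exists (a * b), (eta a * k + j * (eta (E * b) + k)); split.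
  by apply: idealD => //; [apply: idealMl | apply: idealMr].
by rewrite !rmorphM; ring.
Qed.
Let U1 : U 1.
Proof. by exists 1, 0; rewrite rmorph1 addr0; split=> //; apply: ideal0. Qed.
Let UB x y : U x -> U y -> U (x - y).
Proof.
move=> [a [j [Jj ->]]] [b [k [Jk ->]]]; exists (a - b), (j - k).
by split; [apply: idealB | rewrite rmorphB; ring].
Qed.
Let UM x y : U x -> U y -> U (x * y).
Proof.
move=> [a [j [Jj ->]]] [b [k [Jk ->]]].
exists (a * b), (eta a * k + j * (eta b + k)); split.
  by apply: idealD => //; [apply: idealMl | apply: idealMr].
by rewrite !rmorphM; ring.
Qed.
Let V0 : V 0. Proof. by apply: J2V; apply: ideal0. Qed.

Let gV_closed_D x y : J x -> J y -> (forall n, (0 < n)%N -> V (gam n x)) ->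
  (forall n, (0 < n)%N -> V (gam n y)) -> forall n, (0 < n)%N -> V (gam n (x + y)).
Proof.
move=> Jx Jy hx hy n n0; rewrite gD //.
elim/big_ind: _ => // i _.
case: (posnP i) => [->|i0]; first by rewrite g0 // mul1r subn0; apply: hy.
have [e|ne] := eqVneq (i : nat) n.
  by rewrite e subnn g0 // mulr1; apply: hx.
apply: UV; first by apply/VU/hx.
by apply: hy; rewrite subn_gt0 ltn_neqAle ne -ltnS ltn_ord.
Qed.

(* The axioms express the divided powers of a sum, of a multiple of a divided power
   and of [eta E] through divided powers of [eta E]. *)
Let gV x n : V x -> (0 < n)%N -> V (gam n x).
Proof.
move=> [a [_ [[k [c [y [hy ->]]]] ->]]]; move: n; apply: gV_closed_D.
- by rewrite rmorphM; apply: idealMr.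
- by apply: ideal_sum => // i _; apply: idealMl => //; apply: pd_ge2_sub; apply: sub_ideal_gen.
- move=> n n0; rewrite rmorphM mulrC gZ //.
  case: n n0 => [//|[|n]] _; last by apply: J2V; apply: idealMl; last exact: gam_ge2.
  by rewrite expr1 g1 //; exists a, 0; rewrite addr0 rmorphM mulrC; split=> //; apply: ideal0.
have ht i : J (c i *: (y i : D^o)) /\ forall n, (0 < n)%N -> V (gam n (c i *: (y i : D^o))).
  have [l [l2 ->]] := hy i; have l0 : (0 < l)%N by exact: leq_trans l2.
  split; first by apply: idealMl => //; apply: gJ.
  move=> n n0; rewrite [_ *: _]/(c i * _) gZ ?gg //; last exact: gJ.
  apply: J2V; apply: idealMl hJ2 _; apply: idealMl hJ2 _; apply: gam_ge2.
  by rewrite (leq_trans l2) // leq_pmull.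
suff [] : J (\sum_(i < k) c i *: (y i : D^o)) /\
  forall n, (0 < n)%N -> V (gam n (\sum_(i < k) c i *: (y i : D^o))) by [].
elim/big_rec: _ => [|i z _ [Jx hx]].
  split; first exact: ideal0.
  by move=> n n0; rewrite -(mul0r x0) gZ // expr0n gtn_eqF // mul0r.
have [Ji hi] := ht i.
by split; [apply: idealD | apply: gV_closed_D].
Qed.

Notation D1 := (set_ring U1 UB UM).


Let eta1_U a : U (eta a).
Proof. by exists a, 0; rewrite addr0; split=> //; apply: ideal0. Qed.
Let eta1_fun a : D1 := to_set_ring U1 UB UM (eta1_U a).
Let eta1_add : zmod_morphism eta1_fun.
Proof. by move=> a b; apply: val_inj; rewrite raddfB /= rmorphB. Qed.
Let eta1_mul : monoid_morphism eta1_fun.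
Proof.
split=> [|a b]; apply: val_inj; first by rewrite rmorph1 /= rmorph1.
by rewrite rmorphM /= rmorphM.
Qed.
Let eta1 : {rmorphism A -> D1} :=
  HB.pack eta1_fun (GRing.isZmodMorphism.Build A D1 eta1_fun eta1_add)
    (GRing.isMonoidMorphism.Build A D1 eta1_fun eta1_mul).

Let K1 : set D1 := [set x | V (val x)].
Let gam1 n (x : D1) : D1 := insubd (0 : D1) (gam n (val x)).

Let gam1E n x : K1 x -> val (gam1 n x) = gam n (val x).
Proof.
move=> Kx; rewrite /gam1 insubdK //; apply: mem_in_set.
case: n => [|n]; first by rewrite g0; [exact: U1 | exact: VJ].
by apply/VU/gV.
Qed.

Let vD (x y : D1) : val (x + y) = val x + val y. Proof. by []. Qed.
Let vM (x y : D1) : val (x * y) = val x * val y. Proof. by []. Qed.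
Let vX (x : D1) n : val (x ^+ n) = val x ^+ n.
Proof. exact: (rmorphXn (val : {rmorphism D1 -> D})). Qed.
Let vn n : val (n%:R : D1) = n%:R.
Proof. exact: (rmorph_nat (val : {rmorphism D1 -> D})). Qed.
Let vsum n (f : 'I_n -> D1) : val (\sum_(i < n) f i) = \sum_(i < n) val (f i).
Proof. exact: (rmorph_sum (val : {rmorphism D1 -> D})). Qed.

Let pd1 : pd_structure K1 gam1.
Proof.
have hK1 : ideal K1.
  apply: idealP => [|x y|a x].
  - exact: V0.
  - exact: VD.
  - by move=> Vx; apply: UV => //; apply: set_ringP.
have K1g n x : K1 x -> (0 < n)%N -> K1 (gam1 n x).
  by move=> Kx n0; rewrite /K1 /= gam1E //; apply: gV.
split=> //; split; [| |  | |split].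
- by move=> x Kx; split; apply: val_inj; rewrite gam1E ?g0 ?g1 //; apply: VJ.
- by move=> n x Kx n0; apply: K1g.
- move=> n x y Kx Ky; apply: val_inj; rewrite gam1E; last exact: idealD.
  rewrite vD gD; [|exact: VJ..]; rewrite vsum.
  by apply: eq_bigr => i _; rewrite vM !gam1E.
- move=> n a x Kx; apply: val_inj; rewrite gam1E; last exact: idealMl.
  by rewrite !vM gZ ?vX ?gam1E //; apply: VJ.
- move=> m n x Kx; apply: val_inj; rewrite !vM !gam1E // gM ?vn //.
  exact: VJ.
- move=> m n x Kx n0; apply: val_inj; rewrite vM !gam1E //; last exact: K1g.
  by rewrite gg ?vn //; apply: VJ.
Qed.

(** The subring [eta A + J2] with the ideal [V] carries divided powers, so the
    universal property retracts [D] onto it. *)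
Lemma pd_envelope_decomp d : exists a j, pd_ge2 j /\ d = eta a + j.
Proof.
case: (DP) => _ subJ univ.
have [_ [_ [b _ <-] <-]|g [[ge gJK gg1] _]] := univ D1 K1 gam1 eta1 pd1.
  by exists b, 0; rewrite addr0; split=> //; apply: ideal0.
have [h [_ huniq]] := univ D J gam eta pdJ subJ.
pose vg : {rmorphism D -> D} := (val : D1 -> D) \o g.
have vgE : vg =1 idfun.
  move=> x; rewrite (huniq vg) ?(huniq idfun) //.
  split=> [//|_ [z Jz <-] //|//].
  split=> [a|_ [z Jz <-]|n z Jz].
  - by rewrite /vg /= ge.
  - by apply: VJ; apply: gJK; exists z.
  - by rewrite /vg /= gg1 // gam1E //; apply: gJK; exists z.
by rewrite -[d]vgE; exact: (set_ringP (g d)).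
Qed.

Section SquareZero.
Variables (B : comPzRingType) (q : {rmorphism A -> B}).
Hypothesis E2 : q E ^+ 2 = 0.

Let K : set B := principal (q E).
Let del n (x : B) : B := if n is 0 then 1 else if n is 1 then x else 0.

Let KK x y : K x -> K y -> x * y = 0.
Proof.
move=> [a _ <-] [b _ <-]; have -> : q E * a * (q E * b) = q E ^+ 2 * (a * b) by ring.
by rewrite E2 mul0r.
Qed.

(** An ideal of square zero has the divided powers that vanish in degrees above 1. *)
Let pdB : pd_structure K del.
Proof.
have hK : ideal K := @principal_ideal _ _.
split=> //; split; [| | | |split].
- by [].
- by move=> [|[|n]] x Kx _ //=; apply: ideal0.
- move=> [|[|n]] x y Kx Ky /=.
  + by rewrite big_ord1 mulr1.
  + by rewrite big_ord_recl big_ord1 /= mul1r mulr1 addrC.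
  + rewrite big1 // => -[[|[|i]] hi] _ /=; rewrite ?mul0r //.
      by rewrite mulr0.
    rewrite ?subSS ?subn0; case: n hi => [|n] hi /=; rewrite ?mulr0 //.
    exact: KK.
- by move=> [|[|n]] a x Kx /=; rewrite ?expr0 ?mul1r ?expr1 ?mulr0.
- move=> [|[|m]] [|[|n]] x Kx; rewrite ?add0n ?addn0 ?bin0 ?binn /=;
    rewrite ?mul0r ?mulr0 ?mulr1 ?mul1r //; exact: KK.
- move=> [|[|m]] [|[|n]] x Kx // _;
    rewrite ?mul0n ?mul1n ?muln1 ?mulSn ?addSn ?expn0 ?expn1 ?fact0 ?muln1 ?mul1n
      ?divnn ?fact_gt0 /= ?mulr0 ?mul1r //.
Qed.

Lemma pd_envelope_sq0 : exists g : {rmorphism D -> B},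
  (forall a, g (eta a) = q a) /\ (forall j, pd_ge2 j -> g j = 0).
Proof.
case: (DP) => _ _ univ.
have [_ [_ [b _ <-] <-]|g [[ge gJK gg1] _]] := univ B K del q pdB.
  by rewrite rmorphM; apply: principalM.
exists g; split=> //.
apply: (@ideal_gen_min _ _ [set j | g j = 0]).
  apply: idealP => [|x y /= gx gy|a x /= gx] /=.
  - by rewrite rmorph0.
  - by rewrite rmorphD gx gy addr0.
  - by rewrite rmorphM gx mulr0.
by move=> _ [[|[|i]] [// _ ->]] /=; rewrite gg1.
Qed.

End SquareZero.
End Envelope.

(** * The comparison for the divided power envelope *)

(** Legendre's formula, using [n %/ p ^ k >= 3 (n %/ p ^ k.+1)]. *)
Lemma double_logn_fact p n : prime p -> (3 <= p)%N -> (0 < n)%N ->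
  (2 * logn p n`! < n)%N.
Proof.
move=> p_pr p3 n0; rewrite logn_fact //.
suff h m : (2 * (\sum_(1 <= k < m.+1) n %/ p ^ k) + maxn 1 (n %/ p ^ m) <= n)%N.
  by have := h n; lia.
elim: m => [|m IH]; first by rewrite big_geq // expn0 divn1; lia.
rewrite big_nat_recr //=; set s := (\sum_(1 <= k < m.+1) _)%N in IH *.
have : (3 * (n %/ p ^ m.+1) <= n %/ p ^ m)%N.
  rewrite expnSr divnMA; apply: leq_trans (leq_trunc_div _ p).
  by rewrite mulnC leq_mul2l p3 orbT.
by move: IH; lia.
Qed.

Lemma coprime_unit p (A : comPzRingType) u : jacobson_radical (p%:R : A) ->
  (0 < u)%N -> coprime p u -> is_unit (u%:R : A).
Proof.
move=> pJ u0 co; have [k l e _] := egcdnP p u0.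
have [|w hw] := @jacobson_unit A (l%:R * p%:R); first exact: idealMl (@jacobson_ideal A) pJ.
exists (k%:R * w); rewrite mulrA -natrM (mulnC u) e gcdnC (eqP co) -[RHS]hw.
by rewrite natrD natrM; ring.
Qed.

Section DividedPowerComparison.
Variables (p : nat) (p_prime : prime p) (p_ge3 : (3 <= p)%N).
Variables (A : comPzRingType) (E : A).
Hypothesis pE_regular : regular_pair p%:R E.
Hypothesis A_complete : adic_complete (ideal_gen [set p%:R; E]).
Variables (phi : {rmorphism A -> A}).
Variables (R : comPzRingType) (pi : {rmorphism A -> R}).
Hypothesis piP : quotient_map (principal E) pi.
Variables (D : comPzRingType) (J : set D) (gam : nat -> D -> D).
Variables (eta : {rmorphism A -> D}).
Hypothesis DP : pd_envelope (principal E) J gam eta.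
Variables (S : comPzRingType) (iota : {rmorphism D -> S}).
Hypothesis SP : adic_completion (principal p%:R) iota.
Hypothesis S_flat : forall x : S, p%:R * x = 0 -> x = 0.
Variable rho : {rmorphism S -> R}.
Hypothesis rhoP : forall a, rho (iota (eta a)) = pi a.
Variable FA : frame p A.
Hypothesis FA_Fil : fr_Fil FA = principal E.
Hypothesis FA_phi : forall x, fr_phi FA x = phi x.
Hypothesis FA_phi1 : forall x, fr_phi1 FA (E * x) = phi x.
Hypothesis FA_varpi : fr_varpi FA = phi E.
Variable FS : frame p S.
Hypothesis FS_Fil : fr_Fil FS = [set x | rho x = 0].
Hypothesis FS_phi : forall a, fr_phi FS (iota (eta a)) = iota (eta (phi a)).
Hypothesis FS_phi1 : forall x, fr_Fil FS x -> p%:R * fr_phi1 FS x = fr_phi FS x.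
Hypothesis FS_varpi : fr_varpi FS = p%:R.
Variable c : S.
Hypothesis cE : c = fr_phi1 FS (iota (eta E)).
Hypothesis c_unit : is_unit c.

Local Notation lam := (iota \o eta).
Local Notation I := (ideal_gen [set p%:R; E]).

Let pA_reg (x : A) : p%:R * x = 0 -> x = 0.
Proof. by case: pE_regular => h _ _; apply: h. Qed.
Let E_mod_p (x : A) : principal p%:R (E * x) -> principal p%:R x.
Proof. by case: pE_regular => _ h _; apply: h. Qed.

Lemma A_sep (x : A) : (forall n, principal (p%:R ^+ n) x) -> x = 0.
Proof. exact: (a_sep A_complete). Qed.

Lemma A_lim (t : nat -> A) :
  exists x, forall n, principal (p%:R ^+ n) (x - \sum_(i < n) p%:R ^+ i * t i).
Proof. exact: (a_lim A_complete). Qed.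

Lemma E_reg x : E * x = 0 -> x = 0.
Proof. exact: (b_reg_strong A_complete pA_reg E_mod_p). Qed.

Lemma p_mod_E x : principal E (p%:R * x) -> principal E x.
Proof. exact: (a_reg_mod_b pA_reg E_mod_p). Qed.

Lemma E_lim_mod_p (w : nat -> A) : exists x, forall m, exists u v,
  x - \sum_(i < m) E ^+ i * w i = p%:R * u + E ^+ m * v.
Proof.
have [x xE] := gen2_lim A_complete w (gen2b p%:R E).
by exists x => m; apply: gen2_pow_sub (xE m).
Qed.

Lemma E_sep_mod_p x : (forall m, exists u v, x = p%:R * u + E ^+ m * v) ->
  principal p%:R x.
Proof. exact: (quotient_sep A_complete pA_reg E_mod_p). Qed.

Lemma p_sep_mod_E x : (forall m, exists u v, x = E * u + p%:R ^+ m * v) ->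
  principal E x.
Proof.
by apply: (@quotient_sep _ E p%:R); [rewrite gen2C | exact: E_reg | exact: p_mod_E].
Qed.

Lemma FilA_p x : fr_Fil FA (p%:R * x) -> fr_Fil FA x.
Proof. by rewrite FA_Fil; apply: p_mod_E. Qed.

Lemma FilA_closed x :
  (forall n, exists f y, fr_Fil FA f /\ x = f + p%:R ^+ n * y) -> fr_Fil FA x.
Proof.
move=> h; rewrite FA_Fil; apply: p_sep_mod_E => m.
by have [f [y []]] := h m; rewrite FA_Fil => /principalP[u ->] ->; exists u, y.
Qed.

Let pi_surj (r : R) : exists a, pi a = r. Proof. by case: piP => h _; apply: h. Qed.
Let pi0 a : pi a = 0 <-> principal E a. Proof. by case: piP => _; apply. Qed.

Let R_flat (r : R) : p%:R * r = 0 -> r = 0.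
Proof.
have [a <-] := pi_surj r; rewrite -(rmorph_nat pi) -rmorphM => /pi0 h.
by apply/pi0/p_mod_E.
Qed.

Let R_pow_flat n (r : R) : p%:R ^+ n * r = 0 -> r = 0.
Proof.
elim: n => [|n IH]; first by rewrite mul1r.
by rewrite exprS -mulrA => /R_flat.
Qed.

Lemma S_pow_flat n (x : S) : p%:R ^+ n * x = 0 -> x = 0.
Proof.
elim: n => [|n IH]; first by rewrite mul1r.
by rewrite exprS -mulrA => /S_flat.
Qed.

Lemma FilS_p n x : fr_Fil FS (p%:R ^+ n * x) -> fr_Fil FS x.
Proof. by rewrite FS_Fil /= rmorphM rmorphXn rmorph_nat => /R_pow_flat. Qed.

Lemma FilS_closed x :
  (forall n, exists f y, fr_Fil FS f /\ x = f + p%:R ^+ n * y) -> fr_Fil FS x.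
Proof.
rewrite FS_Fil /= => h; have [a e] := pi_surj (rho x); rewrite -e; apply/pi0.
apply: p_sep_mod_E => m; have [f [y [rf xE]]] := h m.
have [b bE] := pi_surj (rho y).
have /pi0/principalP[u uE] : pi (a - p%:R ^+ m * b) = 0.
  by rewrite rmorphB rmorphM rmorphXn rmorph_nat e bE xE rmorphD rmorphM rmorphXn rmorph_nat rf add0r subrr.
by exists u, b; rewrite -uE subrK.
Qed.

Lemma frame_hom_lam : frame_hom FA FS c lam.
Proof.
split=> //; split.
- by move=> x; rewrite /= FS_phi FA_phi.
- move=> _ [x + <-]; rewrite FA_Fil FS_Fil /= => /pi0.
  by rewrite rhoP.
- move=> x; rewrite FA_Fil => /principalP[y ->].
  rewrite FA_phi1 /= mulrC !rmorphM fr_phi1M; last first.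
    by rewrite FS_Fil /= rhoP; apply/pi0; move: (principalM E 1); rewrite mulr1.
  by rewrite -cE FS_phi mulrC.
- rewrite FA_varpi FS_varpi /= -FS_phi cE mulrC FS_phi1 //.
  by rewrite FS_Fil /= rhoP; apply/pi0; move: (principalM E 1); rewrite mulr1.
Qed.

Let hFS := fr_Fil_ideal FS.
Let Ex : D := eta E.
Let JE : J Ex. Proof. exact: pd_envelope_gen DP. Qed.

Let fact_split i : exists u v, [/\ coprime p u, (0 < u)%N & i`! = (u * p ^ v)%N /\ v = logn p i`!].
Proof.
have [u co e] := pfactor_coprime p_prime (fact_gt0 i).
exists u, (logn p i`!); split=> //.
by rewrite lt0n; apply: contraTneq (fact_gt0 i) => u0; rewrite e u0.
Qed.

(** [R] has no torsion prime to [p] either, as [p] lies in the radical of [A]. *)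
Let gam_Fil i : (2 <= i)%N -> fr_Fil FS (iota (gam i Ex)).
Proof.
move=> i2; rewrite FS_Fil /=; set r := rho _.
have : i`!%:R * r = 0.
  rewrite -(rmorph_nat rho) -(rmorph_nat iota) -!rmorphM (pd_fact DP) //.
  rewrite !rmorphXn /Ex rhoP (pi0 E).2; last by move: (principalM E 1); rewrite mulr1.
  by rewrite expr0n gtn_eqF // (leq_trans _ i2).
have [u [v [co u0 [-> _]]]] := fact_split i.
rewrite natrM natrX mulrAC mulrC => /R_pow_flat.
have pJ : jacobson_radical (p%:R : A) := fr_p_jac FA.
have [w /(congr1 pi)] := coprime_unit pJ u0 co.
rewrite rmorphM rmorph_nat rmorph1 => uw ur.
by rewrite -[r]mul1r -uw mulrAC ur mul0r.
Qed.

(** [phi1 (gam_i E) = (p^(i-1) / i!) c^i] is divisible by [p] for [i >= 2] since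
    [p >= 3]. *)
Let gam_phi1 i : (2 <= i)%N -> principal p%:R (fr_phi1 FS (iota (gam i Ex))).
Proof.
move=> i2; have Fg := gam_Fil i2; set f := fr_phi1 FS _.
have FE : fr_Fil FS (iota Ex).
  by rewrite FS_Fil /= rhoP; apply/pi0; move: (principalM E 1); rewrite mulr1.
have [u [v [co u0 [e vE]]]] := fact_split i.
have v2 : (v.+2 <= i)%N.
  by have := @double_logn_fact p i p_prime p_ge3 (leq_trans (isT : 0 < 2)%N i2); rewrite -vE; lia.
have h : i`!%:R * (p%:R * f) = p%:R ^+ i * c ^+ i.
  rewrite FS_phi1 // -(rmorph_nat (fr_phi FS)) -(rmorph_nat iota) -!rmorphM.
  by rewrite (pd_fact DP) // !rmorphXn -(FS_phi1 FE) cE exprMn.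
have uf : u%:R * f = p%:R * (p%:R ^+ (i - v.+2) * c ^+ i).
  apply/eqP; rewrite -subr_eq0; apply/eqP; apply: (@S_pow_flat v.+1).
  have -> : p%:R ^+ v.+1 * (u%:R * f - p%:R * (p%:R ^+ (i - v.+2) * c ^+ i))
     = (u * p ^ v)%:R * (p%:R * f) - p%:R ^+ v.+2 * p%:R ^+ (i - v.+2) * c ^+ i.
    by rewrite natrM natrX !exprS; ring.
  by rewrite -e h -exprD subnKC // subrr.
have [w uw] := coprime_unit (fr_p_jac FS) u0 co.
have -> : f = p%:R * (p%:R ^+ (i - v.+2) * c ^+ i * w).
  by rewrite mulrA -uf mulrAC uw mul1r.
exact: principalM.
Qed.

Let J2 := pd_ge2 E gam eta.
Let hJ2 : ideal J2. Proof. exact: pd_ge2_ideal. Qed.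

Let J2_Fil j : J2 j -> fr_Fil FS (iota j) /\ principal p%:R (fr_phi1 FS (iota j)).
Proof.
move: j; apply: (@ideal_gen_min _ _ [set j | fr_Fil FS (iota j) /\
    principal p%:R (fr_phi1 FS (iota j))]).
  apply: idealP => [|x y /= [Fx px] [Fy py]|a x /= [Fx px]].
  - rewrite /= rmorph0 fr_phi1_0; split; first exact: ideal0.
    exact: ideal0 (principal_ideal _).
  - rewrite rmorphD fr_phi1D //; split; first exact: idealD.
    exact: idealD (principal_ideal _) px py.
  - rewrite rmorphM fr_phi1M //; split; first exact: idealMl.
    exact: idealMl (principal_ideal _) px.
by move=> _ [i [i2 ->]] /=; split; [apply: gam_Fil | apply: gam_phi1].
Qed.

(** The divided powers of order at least two and [p Fil S]. *)
Definition Fil2 : set S :=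
  [set s | exists j s', [/\ pd_ge2 E gam eta j, fr_Fil FS s' & s = iota j + p%:R * s']].

Lemma Fil2_ideal : ideal Fil2.
Proof.
apply: idealP.
- by exists 0, 0; rewrite rmorph0 mulr0 addr0; split=> //; apply: ideal0.
- move=> _ _ [j [s [Jj Fs ->]]] [k [t [Jk Ft ->]]]; exists (j + k), (s + t).
  by split; [apply: idealD | apply: idealD | rewrite rmorphD; ring].
- move=> a _ [j [s [Jj Fs ->]]]; have [d [a' ->]] := completion_surj SP a.
  exists (d * j), (a' * iota j + (iota d + p%:R * a') * s).
  split; [exact: idealMl | | by rewrite rmorphM; ring].
  by apply: idealD => //; apply: idealMl => //; have [] := J2_Fil Jj.
Qed.

Lemma Fil2_Fil z : Fil2 z -> fr_Fil FS z.
Proof.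
move=> [j [s [Jj Fs ->]]]; apply: idealD => //; last exact: idealMl.
by have [] := J2_Fil Jj.
Qed.

Lemma Fil2_phi1 z : Fil2 z -> principal p%:R (fr_phi1 FS z).
Proof.
move=> [j [s [Jj Fs ->]]]; have [Fj pj] := J2_Fil Jj.
rewrite fr_phi1D //; last exact: idealMl.
rewrite fr_phi1M // rmorph_nat; apply: idealD pj _; first exact: principal_ideal.
exact: principalM.
Qed.

(** Modulo [p] every element comes from [D], which is the sum of the image of [A] and
    of the divided powers of order at least two; the remaining multiple of [p] is
    decomposed once more along the surjection of [A] onto [R]. *)
Lemma Fil2_decomp s : exists a z, Fil2 z /\ s = lam a + z.
Proof.
have [d [s' ->]] := completion_surj SP s.
have [a [j [Jj ->]]] := pd_envelope_decomp DP d.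
have [a' ra'] := pi_surj (rho s').
exists (a + p%:R * a'), (iota j + p%:R * (s' - lam a')); split.
  exists j, (s' - lam a'); split=> //.
  by rewrite FS_Fil /= rmorphB rhoP ra' subrr.
by rewrite /= !rmorphD !rmorphM !rmorph_nat; ring.
Qed.

Lemma Fil2_decomp_Fil s : fr_Fil FS s -> exists a z, [/\ Fil2 z, fr_Fil FA a & s = lam a + z].
Proof.
move=> Fs; have [a [z [Zz e]]] := Fil2_decomp s; exists a, z; split=> //.
rewrite FA_Fil; apply/pi0; rewrite -rhoP.
have -> : iota (eta a) = s - z by rewrite e /= addrK.
by have := idealB hFS Fs (Fil2_Fil Zz); rewrite FS_Fil.
Qed.

Lemma Fil2_E2 a : Fil2 (lam (E ^+ 2 * a)).
Proof.
exists (eta (E ^+ 2 * a)), 0; rewrite mulr0 addr0; split=> //; last exact: ideal0.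
have -> : eta (E ^+ 2 * a) = 2%:R * eta a * gam 2 Ex.
  have h : 2%:R * gam 2 Ex = Ex ^+ 2 := pd_fact DP 2 JE.
  by rewrite [RHS]mulrAC h rmorphM rmorphXn.
by apply: idealMl hJ2 _; apply: sub_ideal_gen; exists 2%N.
Qed.

(** The quotient [A/(p, E^2)] receives a homomorphism from [D] that kills the
    divided powers of order at least two and [p]. *)
Lemma lam_Fil2 a z s : Fil2 z -> lam a = z + p%:R * s ->
  exists u v, a = p%:R * u + E ^+ 2 * v.
Proof.
move=> [j [s' [Jj _ ->]]] e.
have hK : ideal (ideal_gen [set (p%:R : A); E ^+ 2]) := ideal_gen_ideal _.
pose q : {rmorphism A -> quot hK} := to_quot hK.
have [_ q0] := quotient_map_to_quot hK.
have qE : q E ^+ 2 = 0 by rewrite -rmorphXn; apply/q0/gen2b.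
have [g [gE gJ2]] := pd_envelope_sq0 DP qE.
have : principal p%:R (eta a - j).
  apply: (completion_inj SP); rewrite rmorphB; exists (s' + s) => //.
  by rewrite [iota (eta a)]e; ring.
move=> /principalP[d de]; apply: gen2P; apply: (q0 _).1.
rewrite -[LHS]gE -[eta a](subrK j) de rmorphD (gJ2 _ Jj) addr0 rmorphM rmorph_nat.
have -> : p%:R = 0 :> quot hK; last by rewrite mul0r.
by rewrite -(rmorph_nat q); apply: (q0 _).2; apply: gen2a.
Qed.

Lemma breuil_comparison : comparison FA FS lam c E Fil2.
Proof.
split.
- exact frame_hom_lam.
- exact A_complete.
- exact pA_reg.
- exact A_sep.
- exact A_lim.
- exact E_lim_mod_p.
- exact E_sep_mod_p.
- exact FA_Fil.
- by move=> x; rewrite FA_phi1 FA_phi.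
- exact FilA_p.
- exact FilA_closed.
- exact S_flat.
- exact (completion_sep SP).
- exact (completion_lim SP).
- exact FS_varpi.
- by move=> x h; apply: (@FilS_p 1); rewrite expr1.
- exact FilS_closed.
- exact Fil2_ideal.
- exact Fil2_Fil.
- exact Fil2_phi1.
- exact Fil2_decomp.
- exact Fil2_decomp_Fil.
- exact Fil2_E2.
- exact lam_Fil2.
Qed.

End DividedPowerComparison.

Theorem proposition2p3p2
  (p : nat) (p_prime : prime p) (p_ge3 : (3 <= p)%N)
  (* the ring frakS, written A, with E and the Frobenius lift phi *)
  (A : comPzRingType) (E : A)
  (pE_regular : regular_pair p%:R E)
  (A_complete : adic_complete (ideal_gen [set p%:R; E]))
  (phi : {rmorphism A -> A}) (phi_frob : frobenius_lift p phi)
  (* R = A / E A *)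
  (R : comPzRingType) (pi : {rmorphism A -> R})
  (piP : quotient_map (principal E) pi)
  (* D is the divided power envelope of E A, and S its p-adic completion *)
  (D : comPzRingType) (J : set D) (gam : nat -> D -> D)
  (eta : {rmorphism A -> D}) (DP : pd_envelope (principal E) J gam eta)
  (S : comPzRingType) (iota : {rmorphism D -> S})
  (SP : adic_completion (principal p%:R) iota)
  (S_flat : forall x : S, p%:R * x = 0 -> x = 0)
  (* the natural map S -> R *)
  (rho : {rmorphism S -> R}) (rhoP : forall a, rho (iota (eta a)) = pi a)
  (* the frame of frakS *)
  (FA : frame p A)
  (FA_Fil : fr_Fil FA = principal E)
  (FA_phi : forall x, fr_phi FA x = phi x)
  (FA_phi1 : forall x, fr_phi1 FA (E * x) = phi x)
  (FA_varpi : fr_varpi FA = phi E)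
  (* the frame of S *)
  (FS : frame p S)
  (FS_Fil : fr_Fil FS = [set x | rho x = 0])
  (FS_phi : forall a, fr_phi FS (iota (eta a)) = iota (eta (phi a)))
  (FS_phi1 : forall x, fr_Fil FS x -> p%:R * fr_phi1 FS x = fr_phi FS x)
  (FS_varpi : fr_varpi FS = p%:R)
  (* c = phi_1(E) *)
  (c : S) (cE : c = fr_phi1 FS (iota (eta E))) (c_unit : is_unit c) :
  crystalline FA FS c (iota \o eta) /\
  forall (n : nat) (n_ge1 : (1 <= n)%N)
    (An Sn : comPzRingType) (FAn : frame p An) (FSn : frame p Sn)
    (qA : {rmorphism A -> An}) (qS : {rmorphism S -> Sn})
    (FAnP : frame_reduction n FA FAn qA) (FSnP : frame_reduction n FS FSn qS)
    (lambda_n : {rmorphism An -> Sn})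
    (lambda_nP : forall a, lambda_n (qA a) = qS (iota (eta a))),
    crystalline FAn FSn (qS c) lambda_n.
Proof.
have cmp := breuil_comparison p_prime p_ge3 pE_regular A_complete piP DP SP S_flat
  rhoP FA_Fil FA_phi FA_phi1 FA_varpi FS_Fil FS_phi FS_phi1 FS_varpi cE c_unit.
have [ci cci] := c_unit.
have id_red (B : comPzRingType) (F : frame p B) : reduction 0 F F idfun.
  split=> //; last by apply/seteqP; split=> [x Fx|_ [x Fx <-]] //; exists x.
  split=> [b|a]; first by exists b.
  by split=> [/= ->|[x _ <-]] /=; rewrite ?mul0r //; exists 0; rewrite ?mulr0.
split.
  exact: (crystalline_reduction p_prime p_ge3 cmp cci (or_introl erefl)
    (id_red _ FA) (id_red _ FS) (lam' := iota \o eta)).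
move=> n n1 An Sn FAn FSn qA qS FAnP FSnP lambda_n lambda_nP.
have red (B B' : comPzRingType) (F : frame p B) (F' : frame p B') q :
    frame_reduction n F F' q -> reduction (p ^ n) F F' q.
  by case=> hq hF hphi hphi1 hv; split=> //; rewrite natrX.
have tP : (p ^ n = 0)%N \/ exists m, (p ^ n = p ^ m.+1)%N.
  by right; exists n.-1; rewrite prednK.
exact: (crystalline_reduction p_prime p_ge3 cmp cci tP (red _ _ _ _ _ FAnP)
  (red _ _ _ _ _ FSnP) lambda_nP).
Qed.
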